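(* Let $G = \langle A * B;\ H\rangle$ be the generalized free product of groups $A$ and $B$ with amalgamated subgroup $H$, and let $\mathfrak{P}$ be a set of primes such that $G$ and $\mathfrak{P}$ satisfy Condition $( * )$. Let $\lambda$ and $\mu$ be homomorphisms of $A$ and $B$, respectively, such that $A\lambda, B\mu \in \mathcal{BN}_{\mathfrak{P}}$ and $\ker\lambda \cap H = 1 = \ker\mu \cap H$ (they exist by Condition $( * )$). Suppose that $H$ is normal in $A$ and in $B$. For each $p \in \mathfrak{P}$ put $$U(p) = H^{p}H',\quad V(p) = p'\text{-}\mathfrak{Is}(A,\ U(p)\cdot\ker\lambda),\quad W(p) = p'\text{-}\mathfrak{Is}(B,\ U(p)\cdot\ker\mu).$$ If, for each $p\in\mathfrak{P}$, the group $\operatorname{Aut}_{G_{V(p),W(p)}}(H\rho_{V(p),W(p)})$ is a $p$-group, then the following statements hold. 1. If $H$ is $\mathcal{F}_{q}$-separable in $A$ and in $B$ for some $q \in \mathfrak{P}$, then $G$ is residually an $\mathcal{FN}_{\mathfrak{P}}$-group. 2. If $G$ is residually an $\mathcal{FN}_{\mathfrak{P}}$-group, then $H$ is $q'$-isolated in $A$ and in $B$ for some $q \in \mathfrak{P}$. 3. The group $G$ is residually a $\Phi\cdot\mathcal{FN}_{\mathfrak{P}}$-group and, for each prime $p$, residually an $\mathcal{F}_{p}\cdot\mathcal{FN}_{\mathfrak{P}}$-group if and only if $H$ is $\mathcal{FN}_{\mathfrak{P}}$-separable in $A$ and in $B$.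
   Context: $G=\langle A*B;\ H\rangle$ means that $G$ is the generalized (amalgamated) free product of $A$ and $B$ with amalgamated subgroup $H$; $A$ and $B$ are regarded as subgroups of $G$, with $A\cap B=H$. If $R$ and $S$ are normal subgroups of $A$ and $B$ with $R\cap H=S\cap H$, then $G_{R,S}$ is the generalized free product of $A/R$ and $B/S$ with the subgroups $HR/R$ and $HS/S$ amalgamated under the isomorphism $hR\mapsto hS$ $(h\in H)$, and $\rho_{R,S}\colon G\to G_{R,S}$ is the surjective homomorphism extending the natural homomorphisms $A\to A/R$ and $B\to B/S$. In the situation of the theorem, $V(p)$ and $W(p)$ are normal in $A$ and $B$ and $V(p)\cap H=U(p)=W(p)\cap H$, so $G_{V(p),W(p)}$ and $\rho_{V(p),W(p)}$ are defined, and $H\rho_{V(p),W(p)}$ is normal in $G_{V(p),W(p)}$. For a group $X$: $X'$ is its commutator subgroup and $X^n$ is the subgroup generated by $\{x^n\mid x\in X\}$. If $Y$ is a normal subgroup of $X$, $\operatorname{Aut}_X(Y)\leqslant\operatorname{Aut}Y$ is the group of restrictions to $Y$ of all inner automorphisms of $X$. For a prime $p$, $p'$ is the set of all primes different from $p$. A subgroup $Y\leqslant X$ is $p'$-isolated in $X$ if for every prime $r\neq p$ and every $x\in X$, $x^r\in Y$ implies $x\in Y$; $p'\text{-}\mathfrak{Is}(X,Y)$ is the smallest $p'$-isolated subgroup of $X$ containing $Y$. For a set of primes $\mathfrak{P}$, a $\mathfrak{P}$-group is a periodic group in which all prime divisors of orders of elements lie in $\mathfrak{P}$. $\Phi$,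 $\mathcal{FN}_{\mathfrak{P}}$, $\mathcal{F}_p$ are the classes of free groups, finite nilpotent $\mathfrak{P}$-groups and finite $p$-groups. For classes $\mathcal{C},\mathcal{D}$, $\mathcal{C}\cdot\mathcal{D}$ is the class of all extensions of a $\mathcal{C}$-group by a $\mathcal{D}$-group (groups having a normal subgroup in $\mathcal{C}$ with quotient in $\mathcal{D}$). A group $X$ is residually a $\mathcal{C}$-group if for every $x\in X\setminus\{1\}$ there is a homomorphism $\sigma$ of $X$ onto a group from $\mathcal{C}$ with $x\sigma\neq1$. A subgroup $Y\leqslant X$ is $\mathcal{C}$-separable in $X$ if for every $x\in X\setminus Y$ there is a homomorphism $\sigma$ of $X$ onto a group from $\mathcal{C}$ with $x\sigma\notin Y\sigma$. An abelian group is $\mathfrak{P}$-bounded if in each of its quotient groups, for every $p\in\mathfrak{P}$, the $p$-primary component of the periodic part is finite. A nilpotent group is $\mathfrak{P}$-bounded if it has a finite central series with $\mathfrak{P}$-bounded abelian factors; $\mathcal{BN}_{\mathfrak{P}}$ is the class of $\mathfrak{P}$-bounded nilpotent groups. $G=\langle A*B;\ H\rangle$ and $\mathfrak{P}$ satisfy Condition $( * )$ if: (i) $A\neq H\neq B$; (ii) $\mathfrak{P}$ is non-empty; (iii) $A$ and $B$ are residually $\mathcal{FN}_{\mathfrak{P}}$-groups; (iv) there exist homomorphisms of $A$ and of $B$ mapping them onto $\mathcal{BN}_{\mathfrak{P}}$-groups and acting injectively on $H$. *)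

(* Defs.v *)
From HB Require Import structures.
From mathcomp Require Import all_boot.
From mathcomp Require Import boolp classical_sets functions cardinality.

Set Implicit Arguments.
Unset Strict Implicit.
Unset Printing Implicit Defensive.

Local Open Scope classical_set_scope.
Local Open Scope group_scope.
Local Open Scope quotient_scope.

Notation hom X Y := (UMagmaMorphism.type X Y).

Definition kernel (X Y : groupType) (f : X -> Y) : set X := f @^-1` [set 1].

Section Subgroups.
Variable X : groupType.
Implicit Types (Y S N : set X).

Definition subgroup Y : Prop :=
  Y 1 /\ forall x y, Y x -> Y y -> Y (x / y).

Definition normal N : Prop :=
  subgroup N /\ forall x y, N x -> N (x ^ y).

Definition generated S : set X := smallest subgroup S.

Definition normal_closure S : set X := smallest normal S.

Definition set_prod S1 S2 : set X := [set x * y | x in S1 & y in S2].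

Lemma generated_group S : subgroup (generated S).
Proof.
split=> [Y [[]]|x y Sx Sy Y YS] //.
by case: (YS) => -[_ YF] _; apply: YF; [apply: Sx|apply: Sy].
Qed.

Lemma generated_id S : subgroup S -> generated S = S.
Proof. exact: smallest_id. Qed.

Lemma normal_closure_normal S : normal (normal_closure S).
Proof.
split=> [|x y Sx Y YS].
  split=> [Y [[[]]]|x y Sx Sy Y YS] //.
  by case: (YS) => -[[_ YF] _] _; apply: YF; [apply: Sx|apply: Sy].
by case: (YS) => -[_ YJ] _; apply: YJ; apply: Sx.
Qed.

Lemma normal_closure_id S : normal S -> normal_closure S = S.
Proof. exact: smallest_id. Qed.

(* The subgroup generated by S, as a group in its own right; for a subgroup Y,
   [subg Y] is Y itself by [generated_id]. *)
Definition subg_pred S : pred X := fun x => `[< generated S x >].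
Record subg S : Type := Subg { sgval :> X; sgvalP : subg_pred S sgval }.

HB.instance Definition _ S := [isSub for @sgval S].
HB.instance Definition _ S := [Choice of subg S by <:].

Fact subg_closed S : group_closed (subg_pred S).
Proof.
have [S1 SF] := generated_group S.
split=> [|x y]; rewrite !unfold_in.
  by apply/asboolP; apply: S1.
by move=> /asboolP Sx /asboolP Sy; apply/asboolP; apply: SF.
Qed.

HB.instance Definition _ S :=
  SubChoice_isSubGroup.Build X (subg_pred S) (subg S) (subg_closed S).

(* The quotient by the normal closure of N; for a normal subgroup N this is
   X/N by [normal_closure_id], so no normality proof has to be carried around. *)
Definition quo_rel N : rel X := fun x y => `[< normal_closure N (x^-1 * y) >].

Fact quo_rel_equiv N : equiv_class_of (quo_rel N).
Proof.
have [[N1 NF] _] := normal_closure_normal N.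
have NV x : normal_closure N x -> normal_closure N x^-1.
  by move=> /(NF _ _ N1); rewrite mul1g.
split=> [x|x y|y x z].
- by apply/asboolP; rewrite mulVg.
- by apply/asboolP/asboolP => /NV; rewrite invgM invgK.
move=> /asboolP xy /asboolP yz; apply/asboolP.
by have := NF _ _ xy (NV _ yz); rewrite invgK mulgA mulgK.
Qed.

Canonical quo_equiv N := EquivRelPack (quo_rel_equiv N).

Definition quotient N : Type := {eq_quot (quo_equiv N)}.
HB.instance Definition _ N := Choice.on (quotient N).
HB.instance Definition _ N := Quotient.on (quotient N).

Section QuotientGroup.
Variable N : set X.
Let pi : X -> quotient N := \pi_(quotient N).

Definition quo_mul (a b : quotient N) : quotient N := pi (repr a * repr b).
Definition quo_inv (a : quotient N) : quotient N := pi (repr a)^-1.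

Fact quo_ex (a : quotient N) : exists x, a = pi x.
Proof. by exists (repr a); rewrite /pi reprK. Qed.

Fact quo_piP x y : pi x = pi y <-> normal_closure N (x^-1 * y).
Proof.
split=> [xy|xy]; last by apply/eqmodP/asboolP.
by have /eqmodP/asboolP := xy.
Qed.

Fact quo_mulE x y : quo_mul (pi x) (pi y) = pi (x * y).
Proof.
have [[N1 NF] NJ] := normal_closure_normal N.
have NV z : normal_closure N z -> normal_closure N z^-1.
  by move=> /(NF _ _ N1); rewrite mul1g.
rewrite /quo_mul; apply/quo_piP.
set x' := repr (pi x); set y' := repr (pi y).
have /quo_piP xx : pi x' = pi x by rewrite /pi reprK.
have /quo_piP yy : pi y' = pi y by rewrite /pi reprK.
have := NF _ _ (NJ _ y' xx) (NV _ yy).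
by rewrite invgK /conjg invgM !mulgA mulgK.
Qed.

Fact quo_invE x : quo_inv (pi x) = pi x^-1.
Proof.
have [[N1 NF] NJ] := normal_closure_normal N.
rewrite /quo_inv; apply/quo_piP.
set x' := repr (pi x).
have /quo_piP xx : pi x = pi x' by rewrite /pi reprK.
have := NJ _ x^-1 xx.
by rewrite /conjg !invgK !mulgA mulgV mul1g.
Qed.

Fact quo_mulA : associative quo_mul.
Proof.
move=> a b c; have [x ->] := quo_ex a; have [y ->] := quo_ex b.
by have [z ->] := quo_ex c; rewrite !quo_mulE mulgA.
Qed.
Fact quo_mul1 : left_id (pi 1) quo_mul.
Proof. by move=> z; have [x ->] := quo_ex z; rewrite quo_mulE mul1g. Qed.
Fact quo_1mul : right_id (pi 1) quo_mul.
Proof. by move=> z; have [x ->] := quo_ex z; rewrite quo_mulE mulg1. Qed.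
Fact quo_mulV : left_inverse (pi 1) quo_inv quo_mul.
Proof. by move=> z; have [x ->] := quo_ex z; rewrite quo_invE quo_mulE mulVg. Qed.
Fact quo_Vmul : right_inverse (pi 1) quo_inv quo_mul.
Proof. by move=> z; have [x ->] := quo_ex z; rewrite quo_invE quo_mulE mulgV. Qed.

HB.instance Definition _ :=
  isGroup.Build (quotient N) quo_mulA quo_mul1 quo_1mul quo_mulV quo_Vmul.

Definition quo_pi (x : X) : quotient N := pi x.

Fact quo_pi_morph : {morph quo_pi : x y / x / y}.
Proof.
move=> x y; transitivity (quo_mul (pi x) (quo_inv (pi y))) => //.
by rewrite quo_invE quo_mulE.
Qed.

HB.instance Definition _ :=
  isGroupMorphism.Build X (quotient N) quo_pi quo_pi_morph.

Lemma quo_pi_surj : range quo_pi = [set: quotient N].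
Proof.
by apply/seteqP; split=> // a _; exists (repr a) => //; rewrite /quo_pi /pi reprK.
Qed.

Lemma quo_pi_kernel : kernel quo_pi = normal_closure N.
Proof.
have [[N1 NF] _] := normal_closure_normal N.
apply/seteqP; split=> x /=.
  rewrite /kernel /= -[1]/(pi 1) => /esym/quo_piP.
  by rewrite invg1 mul1g.
by move=> Nx; apply/esym/quo_piP; rewrite invg1 mul1g.
Qed.

End QuotientGroup.
End Subgroups.

Arguments quo_pi {X} N x.

Section Automorphisms.
Variable Y : groupType.

Record aut : Type := Aut {
  aut_fun :> Y -> Y;
  aut_morph : {morph aut_fun : x y / x * y};
  aut_bij : bijective aut_fun }.

Lemma aut_eq (a b : aut) : a =1 b -> a = b.
Proof.
case: a b => [f fM fB] [g gM gB] /= /funext fg.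
by case: g / fg gM gB => gM gB; congr Aut; apply: Prop_irrelevance.
Qed.

HB.instance Definition _ := gen_eqMixin aut.
HB.instance Definition _ := gen_choiceMixin aut.

Definition aut_one : aut := @Aut id (fun _ _ => erefl) (Bijective (fun=> erefl) (fun=> erefl)).

Fact aut_mul_morph (a b : aut) : {morph b \o a : x y / x * y}.
Proof. by move=> x y /=; rewrite !aut_morph. Qed.

(* As for permutations in MathComp, products are composed from left to right. *)
Definition aut_mul (a b : aut) : aut :=
  Aut (@aut_mul_morph a b) (bij_comp (aut_bij b) (aut_bij a)).

Fact aut_inv_ex (a : aut) : exists b : aut, cancel a b /\ cancel b a.
Proof.
have [g aK gK] := aut_bij a.
have gM : {morph g : x y / x * y}.
  by move=> x y; rewrite -[RHS]aK aut_morph !gK.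
by exists (Aut gM (Bijective gK aK)).
Qed.

Definition aut_inv (a : aut) : aut := sval (cid (aut_inv_ex a)).

Fact aut_mulA : associative aut_mul. Proof. by move=> a b c; apply: aut_eq. Qed.
Fact aut_mul1 : left_id aut_one aut_mul. Proof. by move=> a; apply: aut_eq. Qed.
Fact aut_1mul : right_id aut_one aut_mul. Proof. by move=> a; apply: aut_eq. Qed.
Fact aut_mulV : left_inverse aut_one aut_inv aut_mul.
Proof.
move=> a; apply: aut_eq => x /=; rewrite /aut_inv.
by case: cid => b /= [aK bK]; rewrite bK.
Qed.
Fact aut_Vmul : right_inverse aut_one aut_inv aut_mul.
Proof.
move=> a; apply: aut_eq => x /=; rewrite /aut_inv.
by case: cid => b /= [aK bK]; rewrite aK.
Qed.

HB.instance Definition _ :=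
  isGroup.Build aut aut_mulA aut_mul1 aut_1mul aut_mulV aut_Vmul.

End Automorphisms.

(* Aut_X(Y), for Y a normal subgroup of X: the restrictions to Y of the inner
   automorphisms of X. *)
Definition aut_in (X : groupType) (Y : set X) : set (aut (subg Y)) :=
  [set a | exists x : X, forall y : subg Y, val (a y) = val y ^ x].
Arguments aut_in {X} Y _.

Lemma aut_in_subgroup (X : groupType) (Y : set X) : subgroup (aut_in Y).
Proof.
split; first by exists 1 => y; rewrite conjg1.
move=> a b [x xa] [z zb]; exists (x / z) => y.
rewrite -[LHS]/(val (aut_inv b (a y))).
have bK : b (aut_inv b (a y)) = a y by rewrite /aut_inv; case: cid => c [/= _ ->].
by rewrite conjgM -xa -[in RHS]bK zb conjgK.
Qed.

Definition is_order (X : groupType) (x : X) (n : nat) : Prop :=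
  [/\ (0 < n)%N, x ^+ n = 1
    & forall m, (0 < m)%N -> x ^+ m = 1 -> (n <= m)%N].

(* A P-group; the existence of the order n says that X is periodic. *)
Definition prime_group (P : set nat) (X : groupType) : Prop :=
  forall x : X, exists2 n, is_order x n &
    forall r, prime r -> (r %| n)%N -> P r.

Definition finite_group (X : groupType) : Prop := finite_set [set: X].

Definition abelian_group (X : groupType) : Prop := forall x y : X, commute x y.

Definition central_series (X : groupType) (n : nat) (c : nat -> set X) : Prop :=
  [/\ c 0%N = [set 1], c n = [set: X],
      forall k, (k <= n)%N -> normal (c k),
      forall k, (k < n)%N -> c k `<=` c k.+1
    & forall k, (k < n)%N -> forall x y, c k.+1 x -> c k [~ x, y]].

Definition series_factor (X : groupType) (c : nat -> set X) (k : nat) : groupType :=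
  quotient [set y : subg (c k.+1) | c k (val y)].

Definition nilpotent_group (X : groupType) : Prop :=
  exists n c, @central_series X n c.

(* The elements of p-power order, i.e. the p-primary component of the periodic
   part of an abelian X. *)
Definition primary_component (p : nat) (X : groupType) : set X :=
  [set x | exists k, x ^+ (p ^ k) = 1].
Arguments primary_component p X : clear implicits.

Definition bounded_abelian (P : set nat) (X : groupType) : Prop :=
  abelian_group X /\
  forall N : set X, normal N -> forall p, P p ->
    finite_set (primary_component p (quotient N)).

Definition class_BN (P : set nat) (X : groupType) : Prop :=
  exists n c, @central_series X n c /\
    forall k, (k < n)%N -> bounded_abelian P (series_factor c k).

Definition class_FN (P : set nat) (X : groupType) : Prop :=
  [/\ finite_group X, nilpotent_group X & prime_group P X].

Definition class_F (p : nat) (X : groupType) : Prop :=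
  finite_group X /\ prime_group [set p] X.

(* X is free on S; the values of f outside S are irrelevant. *)
Definition class_free (X : groupType) : Prop :=
  exists S : set X, forall (Y : groupType) (f : X -> Y),
    exists2 g : hom X Y, (forall x, S x -> g x = f x) &
      forall g' : hom X Y, (forall x, S x -> g' x = f x) -> g' =1 g.

Definition class_ext (C D : groupType -> Prop) (X : groupType) : Prop :=
  exists N : set X, [/\ normal N, C (subg N) & D (quotient N)].

Definition residually (C : groupType -> Prop) (X : groupType) : Prop :=
  forall x : X, x <> 1 -> exists (Y : groupType) (s : hom X Y),
    [/\ C Y, range s = [set: Y] & s x <> 1].

Definition separable (C : groupType -> Prop) (X : groupType) (Y : set X) : Prop :=
  forall x : X, ~ Y x -> exists (Z : groupType) (s : hom X Z),
    [/\ C Z, range s = [set: Z] & ~ (s @` Y) (s x)].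

(* Isolation at the complementary set p' of primes. *)
Definition isolated (p : nat) (X : groupType) (Y : set X) : Prop :=
  subgroup Y /\
  forall r, prime r -> r != p -> forall x, Y (x ^+ r) -> Y x.

Definition isolator (p : nat) (X : groupType) (Y : set X) : set X :=
  smallest (@isolated p X) Y.

(* H^p H' *)
Definition power_derived (p : nat) (H : groupType) : set H :=
  set_prod (generated [set x ^+ p | x in [set: H]])
           (generated [set [~ x, y] | x in [set: H] & y in [set: H]]).
Arguments power_derived p H : clear implicits.

(* [gfp f g] is the group generated by A and B subject to the relations
   f h = g h, for h in the index type H.  It is <A * B; H> when f and g are the
   embeddings of H in A and B.  For f : h |-> hR and g : h |-> hS, with
   R and S meeting H in the same subgroup, it is G_{R,S}: the generalized free
   product of A/R and B/S with HR/R and HS/S amalgamated under hR |-> hS. *)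

Section Gfp.
Variables (H : Type) (A B : groupType) (f : H -> A) (g : H -> B).

Definition word : Type := seq (A + B).
HB.instance Definition _ := Choice.on word.

Inductive gfp_eq : word -> word -> Prop :=
| gfp_refl w : gfp_eq w w
| gfp_sym w1 w2 : gfp_eq w1 w2 -> gfp_eq w2 w1
| gfp_trans w1 w2 w3 : gfp_eq w1 w2 -> gfp_eq w2 w3 -> gfp_eq w1 w3
| gfp_cat w1 w2 v1 v2 :
    gfp_eq w1 w2 -> gfp_eq v1 v2 -> gfp_eq (w1 ++ v1) (w2 ++ v2)
| gfp_one1 : gfp_eq [:: inl 1] [::]
| gfp_one2 : gfp_eq [:: inr 1] [::]
| gfp_mul1 x y : gfp_eq [:: inl x; inl y] [:: inl (x * y)]
| gfp_mul2 x y : gfp_eq [:: inr x; inr y] [:: inr (x * y)]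
| gfp_amalgam h : gfp_eq [:: inl (f h)] [:: inr (g h)].

Definition gfp_rel : rel word := fun w1 w2 => `[< gfp_eq w1 w2 >].

Fact gfp_rel_equiv : equiv_class_of gfp_rel.
Proof.
split=> [w|w1 w2|w1 w2 w3].
- exact/asboolP/gfp_refl.
- by apply/asboolP/asboolP; apply: gfp_sym.
by move=> /asboolP E1 /asboolP E2; apply/asboolP/(gfp_trans E1).
Qed.

Canonical gfp_equiv := EquivRelPack gfp_rel_equiv.

Definition gfp : Type := {eq_quot gfp_equiv}.
HB.instance Definition _ := Choice.on gfp.
HB.instance Definition _ := Quotient.on gfp.

Let pi : word -> gfp := \pi_gfp.

Definition letter_inv (s : A + B) : A + B :=
  match s with inl x => inl x^-1 | inr y => inr y^-1 end.
Definition word_inv (w : word) : word := rev (map letter_inv w).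

Definition gfp_mul (a b : gfp) : gfp := pi (repr a ++ repr b).
Definition gfp_inv (a : gfp) : gfp := pi (word_inv (repr a)).

Fact gfp_ex (a : gfp) : exists w, a = pi w.
Proof. by exists (repr a); rewrite /pi reprK. Qed.

Fact gfp_piP w v : pi w = pi v <-> gfp_eq w v.
Proof.
split=> [wv|wv]; last by apply/eqmodP/asboolP.
by have /eqmodP/asboolP := wv.
Qed.

Fact gfp_repr w : gfp_eq (repr (pi w)) w.
Proof. by apply/gfp_piP; rewrite /pi reprK. Qed.

Fact word_invV w : gfp_eq (word_inv w ++ w) [::].
Proof.
elim: w => [|s w IHw]; first exact: gfp_refl.
rewrite /word_inv map_cons rev_cons -cats1 -catA.
apply: gfp_trans IHw; apply: gfp_cat; first exact: gfp_refl.
rewrite -[s :: w]/([:: s] ++ w) catA -[X in gfp_eq _ X]cat0s.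
apply: gfp_cat; last exact: gfp_refl.
case: s => x /=.
  by apply: (gfp_trans (gfp_mul1 _ _)); rewrite mulVg; apply: gfp_one1.
by apply: (gfp_trans (gfp_mul2 _ _)); rewrite mulVg; apply: gfp_one2.
Qed.

Fact word_invK w : word_inv (word_inv w) = w.
Proof.
rewrite /word_inv map_rev revK -map_comp -[RHS]map_id.
by apply: eq_map => -[] x /=; rewrite invgK.
Qed.

Fact gfp_mulE w v : gfp_mul (pi w) (pi v) = pi (w ++ v).
Proof. by apply/gfp_piP/gfp_cat; apply: gfp_repr. Qed.

Fact gfp_invE w : gfp_inv (pi w) = pi (word_inv w).
Proof.
apply/gfp_piP; set v := repr _; have vw : gfp_eq v w by apply: gfp_repr.
have vK := word_invV v; have := word_invV (word_inv w).
rewrite word_invK => wK.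
have E1 : gfp_eq (word_inv v ++ (w ++ word_inv w)) (word_inv v).
  rewrite -[X in gfp_eq _ X]cats0; apply: gfp_cat => //; exact: gfp_refl.
apply: (gfp_trans (gfp_sym E1)); rewrite catA -[X in gfp_eq _ X]cat0s.
apply: gfp_cat; last exact: gfp_refl.
apply: gfp_trans vK; apply: gfp_cat; first exact: gfp_refl.
exact: gfp_sym.
Qed.

Fact gfp_mulA : associative gfp_mul.
Proof.
move=> a b c; have [x ->] := gfp_ex a; have [y ->] := gfp_ex b.
by have [z ->] := gfp_ex c; rewrite !gfp_mulE catA.
Qed.
Fact gfp_1mul : left_id (pi [::]) gfp_mul.
Proof. by move=> z; have [x ->] := gfp_ex z; rewrite gfp_mulE. Qed.
Fact gfp_mul1g : right_id (pi [::]) gfp_mul.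
Proof. by move=> z; have [x ->] := gfp_ex z; rewrite gfp_mulE cats0. Qed.
Fact gfp_mulV : left_inverse (pi [::]) gfp_inv gfp_mul.
Proof.
by move=> z; have [x ->] := gfp_ex z; rewrite gfp_invE gfp_mulE; apply/gfp_piP/word_invV.
Qed.
Fact gfp_Vmul : right_inverse (pi [::]) gfp_inv gfp_mul.
Proof.
move=> z; have [x ->] := gfp_ex z; rewrite gfp_invE gfp_mulE; apply/gfp_piP.
by have := word_invV (word_inv x); rewrite word_invK.
Qed.

HB.instance Definition _ :=
  isGroup.Build gfp gfp_mulA gfp_1mul gfp_mul1g gfp_mulV gfp_Vmul.

Definition gfp_in1 (x : A) : gfp := pi [:: inl x].
Definition gfp_in2 (y : B) : gfp := pi [:: inr y].

Fact gfp_in1_morph : {morph gfp_in1 : x y / x / y}.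
Proof.
move=> x y; transitivity (gfp_mul (gfp_in1 x) (gfp_inv (gfp_in1 y))) => //.
by rewrite gfp_invE gfp_mulE; apply/gfp_piP/gfp_sym/gfp_mul1.
Qed.
Fact gfp_in2_morph : {morph gfp_in2 : x y / x / y}.
Proof.
move=> x y; transitivity (gfp_mul (gfp_in2 x) (gfp_inv (gfp_in2 y))) => //.
by rewrite gfp_invE gfp_mulE; apply/gfp_piP/gfp_sym/gfp_mul2.
Qed.

HB.instance Definition _ := isGroupMorphism.Build A gfp gfp_in1 gfp_in1_morph.
HB.instance Definition _ := isGroupMorphism.Build B gfp gfp_in2 gfp_in2_morph.

Lemma gfp_in_amalgam h : gfp_in1 (f h) = gfp_in2 (g h).
Proof. exact/gfp_piP/gfp_amalgam. Qed.

Definition word_eval (X : groupType) (a : A -> X) (b : B -> X) (w : word) : X :=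
  foldr (fun s z => (match s with inl x => a x | inr y => b y end) * z) 1 w.

Definition gfp_lift (X : groupType) (a : A -> X) (b : B -> X) (z : gfp) : X :=
  word_eval a b (repr z).

Section Lift.
Variables (X : groupType) (a : hom A X) (b : hom B X).
Hypothesis ab : forall h, a (f h) = b (g h).

Fact word_eval_cat w v :
  word_eval a b (w ++ v) = word_eval a b w * word_eval a b v.
Proof. by elim: w => [|s w IHw] /=; rewrite ?mul1g // IHw mulgA. Qed.

Fact word_evalP w v : gfp_eq w v -> word_eval a b w = word_eval a b v.
Proof.
elim=> {w v} //=; rewrite ?mulg1 ?gmulf1 //.
- by move=> ? ? ? _ -> _ ->.
- by move=> ? ? ? ? _ E1 _ E2; rewrite !word_eval_cat E1 E2.
- by move=> x y; rewrite !mulg1 gmulfM.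
- by move=> x y; rewrite !mulg1 gmulfM.
- by move=> h; rewrite !mulg1 ab.
Qed.

Fact gfp_liftE w : gfp_lift a b (pi w) = word_eval a b w.
Proof. exact/word_evalP/gfp_repr. Qed.

Lemma gfp_liftM : {morph gfp_lift a b : x y / x * y}.
Proof.
move=> a' b'; have [x ->] := gfp_ex a'; have [y ->] := gfp_ex b'.
rewrite -[_ * _]/(gfp_mul (pi x) (pi y)) gfp_mulE !gfp_liftE.
exact: word_eval_cat.
Qed.

Lemma gfp_lift1 x : gfp_lift a b (gfp_in1 x) = a x.
Proof. by rewrite gfp_liftE /= mulg1. Qed.

Lemma gfp_lift2 y : gfp_lift a b (gfp_in2 y) = b y.
Proof. by rewrite gfp_liftE /= mulg1. Qed.

Lemma gfp_lift_unique (t : hom gfp X) :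
  (forall x, t (gfp_in1 x) = a x) -> (forall y, t (gfp_in2 y) = b y) ->
  t =1 gfp_lift a b.
Proof.
move=> ta tb; move=> z; have [w ->] := gfp_ex z; rewrite gfp_liftE.
elim: w => [|s w IHw]; first exact: gmulf1.
rewrite -[s :: w]/([:: s] ++ w) -gfp_mulE -[gfp_mul _ _]/(pi [:: s] * pi w).
by rewrite gmulfM IHw word_eval_cat; case: s => x /=; rewrite mulg1 -(ta, tb).
Qed.

End Lift.
End Gfp.

Arguments gfp_in1 {H A B} f g x.
Arguments gfp_in2 {H A B} f g y.

Section Gfp_quotient.
Variables (H A B : groupType) (i : hom H A) (j : hom H B).
Variables (R : set A) (S : set B).

Definition gfp_quo : groupType := gfp (quo_pi R \o i) (quo_pi S \o j).

Let to1 : hom A gfp_quo := gfp_in1 (quo_pi R \o i) (quo_pi S \o j) \o quo_pi R.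
Let to2 : hom B gfp_quo := gfp_in2 (quo_pi R \o i) (quo_pi S \o j) \o quo_pi S.

Definition gfp_rho : gfp i j -> gfp_quo := gfp_lift to1 to2.

Fact gfp_rho_compat h : to1 (i h) = to2 (j h).
Proof. exact: (gfp_in_amalgam (quo_pi R \o i) (quo_pi S \o j)). Qed.

Fact gfp_rho_morph : {morph gfp_rho : x y / x / y}.
Proof.
have M := gfp_liftM gfp_rho_compat.
move=> x y; apply: (mulIg (gfp_rho y)).
by rewrite mulgVK -M mulgVK.
Qed.

HB.instance Definition _ :=
  isGroupMorphism.Build (gfp i j) gfp_quo gfp_rho gfp_rho_morph.

Lemma gfp_rho1 x :
  gfp_rho (gfp_in1 i j x) =
  gfp_in1 (quo_pi R \o i) (quo_pi S \o j) (quo_pi R x).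
Proof. exact: gfp_lift1 gfp_rho_compat _. Qed.

Lemma gfp_rho2 y :
  gfp_rho (gfp_in2 i j y) =
  gfp_in2 (quo_pi R \o i) (quo_pi S \o j) (quo_pi S y).
Proof. exact: gfp_lift2 gfp_rho_compat _. Qed.

End Gfp_quotient.

Arguments gfp_quo {H A B} i j R S.
Arguments gfp_rho {H A B} i j R S _.

Definition gfp_amalgamated (H A B : groupType) (i : hom H A) (j : hom H B) :
  set (gfp i j) := gfp_in1 i j @` range i.
Arguments gfp_amalgamated {H A B} i j _.

Definition condition_star (H A B : groupType) (i : hom H A) (j : hom H B)
    (P : set nat) : Prop :=
  [/\ range i <> [set: A] /\ range j <> [set: B],
      P !=set0,
      residually (class_FN P) A /\ residually (class_FN P) B
    & (exists (L : groupType) (l : hom A L),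
         [/\ class_BN P L, range l = [set: L] & injective (l \o i)]) /\
      (exists (M : groupType) (m : hom B M),
         [/\ class_BN P M, range m = [set: M] & injective (m \o j)])].

(* Main.v *)
From mathcomp Require Import all_boot fingroup cyclic pgroup center sylow.
(* After fingroup: normal, generated, quotient, subg, isolated are those of Defs. *)
Require Import Defs.
From HB Require Import structures.
From mathcomp Require Import all_boot ssralg zmodp.
From mathcomp Require Import boolp classical_sets functions cardinality.

(* H embeds into a nilpotent group with P-bounded factors, so for p in P all the
   quotients H/K_m by the terms K_m of the lower exponent-p central series are
   finite p-groups, and A and B have finite p-quotients meeting H exactly in H/K_m
   (a normal subgroup maximal among those avoiding a given p-element has a finite
   p-quotient).  By hypothesis G acts on H/K_1 through a p-group, hence also on
   H/K_m.  Now let A, B be finite p-groups, write A = A/H x H and B = B/H x H as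
   right H-sets, and let both act on A/H x B/H x H: this is a representation of G
   which is faithful on H and whose image is a finite p-group.  So an element of
   H \ 1 survives in a finite p-quotient of G for some p in P.

   An element outside H survives in A/H * B/H, and by separability in X * Y with X, Y
   finite.  The kernel of X * Y -> X x Y is free, and free groups are residually
   finite p-groups for every p.  This gives (1) and the "if" part of (3).

   Conversely, let D be the set of the g in G whose image in each finite quotient
   of the class considered lies in the image of H.  If G is residually in this
   class, D satisfies the commutator laws of H, so D/H, if nontrivial, has an
   element whose conjugates commute with each other and with D/H; in the free
   product A/H * B/H this is impossible as soon as D meets A \ H or B \ H, or A/H
   or B/H has more than two elements.  An x in A \ H with x^r in H lies in D for the finite groups of order
   prime to r.  In (2) a failure for all q in P produces either one such x with r
   not in P, or x1, x2 with distinct r1, r2, and then [x1, x2^g] is in D.  In (3),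
   if H is not FN_P-separable in A, there is such an x with r not in P, and one
   takes the quotients in F_p.FN_P with p <> r. *)

Set Implicit Arguments.
Unset Strict Implicit.
Unset Printing Implicit Defensive.

Local Open Scope classical_set_scope.
Local Open Scope group_scope.

(** * Subgroups, homomorphisms and quotients *)

(** Elements of [H] and elements outside it are separated for different reasons. An element of [H]
    may survive only for one particular prime, the one supplied by [A] being residually finite
    nilpotent, and there the action of G on [H] is the obstacle; outside [H] the separability
    hypothesis decides. The hypothesis controls this action only on the first layer. A homomorphism
    to a finite p-group that kills [U(p)] and the kernel of [lam] also kills [V(p)], because its
    kernel is p'-isolated; this carries the p-group condition over to H/K_1. An automorphism trivial
    on H/K_1 is trivial on every K_i/K_{i+1}, and these have exponent p, so it has p-power order
    modulo K_m. In the converse direction the exception is genuine: the free product of two groups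
    of order 2 is infinite dihedral and has an infinite cyclic normal subgroup. With two roots it is
    avoided because one of two distinct primes is odd, and a root x for an odd prime has x^2 outside
    [H]. *)

Section SubgroupTheory.
Variable X : groupType.
Implicit Types (S N K : set X) (x y : X).

Lemma subgroup1 S : subgroup S -> S 1. Proof. by case. Qed.

Lemma subgroupF S x y : subgroup S -> S x -> S y -> S (x / y).
Proof. by move=> [_ SF]; apply: SF. Qed.

Lemma subgroupV S x : subgroup S -> S x -> S x^-1.
Proof. by move=> sS Sx; rewrite -[_^-1]mul1g; apply: subgroupF => //; case: sS. Qed.

Lemma subgroupM S x y : subgroup S -> S x -> S y -> S (x * y).
Proof.
by move=> sS Sx Sy; rewrite -[y]invgK; apply: subgroupF => //; apply: subgroupV.
Qed.

Lemma subgroupX S x n : subgroup S -> S x -> S (x ^+ n).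
Proof.
move=> sS Sx; elim: n => [|n IHn]; first exact: subgroup1.
by rewrite expgS; apply: subgroupM.
Qed.

Lemma normalJ N x y : normal N -> N (x ^ y) <-> N x.
Proof. by move=> [_ NJ]; split=> [/NJ-/(_ y^-1)|/NJ//]; rewrite conjgK. Qed.

Lemma normalR N x y : normal N -> N x -> N [~ x, y].
Proof.
move=> nN Nx; have [sN _] := nN; apply: subgroupM => //; first exact: subgroupV.
exact/normalJ.
Qed.

Lemma normalRr N x y : normal N -> N y -> N [~ x, y].
Proof. by move=> nN /(normalR x nN) /(subgroupV (proj1 nN)); rewrite invgR. Qed.

Lemma normal_setT : normal [set: X]. Proof. by []. Qed.

Lemma normal_1 : normal [set (1 : X)].
Proof.
split=> [|x y ->]; last exact: conj1g.
by split=> // x y -> ->; rewrite divg1.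
Qed.

Lemma generated_sub S K : subgroup K -> S `<=` K -> generated S `<=` K.
Proof. by move=> sK SK x; apply; split. Qed.

Lemma sub_generated S : S `<=` generated S.
Proof. by move=> x Sx K [_]; apply. Qed.

Lemma normal_closure_sub S K : normal K -> S `<=` K -> normal_closure S `<=` K.
Proof. by move=> sK SK x; apply; split. Qed.

Lemma sub_normal_closure S : S `<=` normal_closure S.
Proof. by move=> x Sx K [_]; apply. Qed.

Lemma generated_normal S : (forall x y, S x -> S (x ^ y)) -> normal (generated S).
Proof.
move=> SJ; split=> [|x y Sx]; first exact: generated_group.
suff: generated S `<=` [set x | generated S (x ^ y)] by apply.
apply: generated_sub.
  split=> [|u v Su Sv] /=; first by rewrite conj1g; case: (generated_group S).
  by rewrite conjMg conjVg; apply: (subgroupF (generated_group S)).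
by move=> u Su; apply: sub_generated; apply: SJ.
Qed.

End SubgroupTheory.

Section Homs.
Variables (X Y : groupType).

Definition mkhom_fun (f : X -> Y) (fM : {morph f : x y / x * y}) : X -> Y := f.

Fact mkhom_morph (f : X -> Y) (fM : {morph f : x y / x * y}) :
  {morph mkhom_fun fM : x y / x / y}.
Proof. by move=> x y; apply: (mulIg (f y)); rewrite -fM !mulgVK. Qed.

HB.instance Definition _ f fM :=
  isGroupMorphism.Build X Y (@mkhom_fun f fM) (mkhom_morph fM).

Definition mkhom f fM : hom X Y := @mkhom_fun f fM.

Lemma mkhomE f fM x : @mkhom f fM x = f x. Proof. by []. Qed.

Lemma kernel_normal (f : hom X Y) : normal (kernel f).
Proof.
split=> [|x y]; rewrite /kernel /=; last by rewrite gmulfJ => ->; rewrite conj1g.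
by split=> [|x y fx fy]; [apply: gmulf1|rewrite /= gmulfF fx fy divg1].
Qed.

Lemma preimage_subgroup (f : hom X Y) (S : set Y) : subgroup S -> subgroup (f @^-1` S).
Proof.
move=> [S1 SF]; split=> [|x y Sx Sy]; first by rewrite /preimage /= gmulf1.
by rewrite /preimage /= gmulfF; apply: SF.
Qed.

Lemma preimage_normal (f : hom X Y) (S : set Y) : normal S -> normal (f @^-1` S).
Proof.
move=> [sS SJ]; split=> [|x y]; first exact: preimage_subgroup.
by rewrite /preimage /= gmulfJ; apply: SJ.
Qed.

Lemma image_subgroup (f : hom X Y) (S : set X) : subgroup S -> subgroup (f @` S).
Proof.
move=> [S1 SF]; split=> [|_ _ [x Sx <-] [y Sy <-]]; first by exists 1; rewrite ?gmulf1.
by exists (x / y); [apply: SF|rewrite gmulfF].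
Qed.

Lemma range_subgroup (f : hom X Y) : subgroup (range f).
Proof. exact: image_subgroup. Qed.

Lemma surjP (f : X -> Y) : range f = [set: Y] <-> forall y, exists x, f x = y.
Proof.
split=> [fT y|fT]; last by apply/seteqP; split=> // y _; have [x <-] := fT y; exists x.
have [x _ <-] : range f y by rewrite fT.
by exists x.
Qed.

Lemma image_normal (f : hom X Y) (S : set X) :
  range f = [set: Y] -> normal S -> normal (f @` S).
Proof.
move=> /surjP fT [sS SJ]; split=> [|_ y [x Sx <-]]; first exact: image_subgroup.
by have [z <-] := fT y; exists (x ^ z); [apply: SJ|rewrite gmulfJ].
Qed.

Lemma kernelP (f : hom X Y) x y : f x = f y <-> kernel f (x^-1 * y).
Proof.
rewrite /kernel /= gmulfM gmulfV; split=> [->|/mulg1_eq]; first by rewrite mulVg.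
by rewrite invgK.
Qed.

End Homs.

Lemma range_comp (X Y Z : groupType) (s : X -> Y) (t : Y -> Z) :
  range s = [set: Y] -> range t = [set: Z] -> range (t \o s) = [set: Z].
Proof.
move=> /surjP sT /surjP tT; apply/surjP => z; have [y <-] := tT z.
by have [x <-] := sT y; exists x.
Qed.

Section QuotientTheory.
Variables (X : groupType) (N : set X).

Lemma quo_eq1 x : quo_pi N x = 1 <-> normal_closure N x.
Proof. by rewrite -[normal_closure N x]/(normal_closure N x) -quo_pi_kernel. Qed.

Lemma quo_eq1n x : normal N -> quo_pi N x = 1 <-> N x.
Proof. by move=> nN; rewrite quo_eq1 normal_closure_id. Qed.

Lemma quo_eqP x y : normal N -> quo_pi N x = quo_pi N y <-> N (x^-1 * y).
Proof. by move=> nN; rewrite kernelP quo_pi_kernel normal_closure_id. Qed.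

Lemma quo_surj (a : quotient N) : exists x, quo_pi N x = a.
Proof. by move: a; apply/surjP/quo_pi_surj. Qed.

End QuotientTheory.

Section Factor.
Variables (X Z Y : groupType) (r : hom X Z) (s : hom X Y).

(* The choice of a preimage is harmless as ker r lies in ker s. *)
Lemma factor_hom : range r = [set: Z] -> kernel r `<=` kernel s ->
  exists t : hom Z Y, forall x, t (r x) = s x.
Proof.
move=> /surjP rT rs; pose g z := sval (cid (rT z)).
have gK z : r (g z) = z by rewrite /g; case: cid.
have E x y : r x = r y -> s x = s y by move=> /kernelP /rs /kernelP.
have gM : {morph s \o g : x y / x * y}.
  by move=> x y /=; rewrite -gmulfM; apply: E; rewrite gmulfM !gK.
by exists (mkhom gM) => x; rewrite mkhomE /=; apply: E; rewrite gK.
Qed.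

End Factor.

Lemma quo_factor (X Y : groupType) (N : set X) (s : hom X Y) :
  N `<=` kernel s -> exists t : hom (quotient N) Y, forall x, t (quo_pi N x) = s x.
Proof.
move=> Ns; apply: factor_hom; first exact: quo_pi_surj.
by rewrite quo_pi_kernel; apply: normal_closure_sub => //; apply: kernel_normal.
Qed.

Section SubgTheory.
Variables (X : groupType) (S : set X).

Lemma subgP (x : subg S) : generated S (val x).
Proof. by case: x => x /= /asboolP. Qed.

Lemma subg_val (x : subg S) : subgroup S -> S (val x).
Proof. by move=> sS; have := subgP x; rewrite {1}generated_id. Qed.

Lemma subg_in x : S x -> subg_pred S x.
Proof. by move=> Sx; apply/asboolP; apply: sub_generated. Qed.

Definition insubg x (Sx : S x) : subg S := Subg (subg_in Sx).

Lemma insubgK x (Sx : S x) : val (insubg Sx) = x. Proof. by []. Qed.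

Fact subg_val_morph : {morph (val : subg S -> X) : x y / x * y}.
Proof. by move=> x y; rewrite gmulfM. Qed.

Definition subg_incl : hom (subg S) X := mkhom subg_val_morph.

Lemma subg_inclE x : subg_incl x = val x. Proof. by []. Qed.

End SubgTheory.

Section Corestrict.
Variables (X Y : groupType) (f : hom X Y).

Definition corestr_fun x : subg (range f) := insubg (imageT f x).

Fact corestr_morph : {morph corestr_fun : x y / x * y}.
Proof. by move=> x y; apply: val_inj; rewrite gmulfM /= gmulfM. Qed.

Definition corestr : hom X (subg (range f)) := mkhom corestr_morph.

Lemma corestrE x : val (corestr x) = f x. Proof. by []. Qed.

Lemma corestr_surj : range corestr = [set: subg (range f)].
Proof.
apply/surjP => y; have [x _ xy] := subg_val y (range_subgroup f).
by exists x; apply: val_inj.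
Qed.

Lemma corestr_eq1 x : corestr x = 1 <-> f x = 1.
Proof. by split=> [/(congr1 val)|fx]; [rewrite val1|apply: val_inj; rewrite val1]. Qed.

End Corestrict.

Section PairHoms.
Variables (X Y Z : groupType).

Fact pair_hom_morph (s : hom X Y) (t : hom X Z) :
  {morph (fun x => (s x, t x)) : x y / x * y >-> x * y}.
Proof. by move=> x y; rewrite !gmulfM. Qed.

Definition pair_hom (s : hom X Y) (t : hom X Z) : hom X (Y * Z)%type :=
  mkhom (pair_hom_morph s t).

Lemma pair_homE s t x : pair_hom s t x = (s x, t x). Proof. by []. Qed.

End PairHoms.

(** * Finite groups and permutations *)

Section Finiteness.

Lemma finite_inj (T U : Type) (f : T -> U) :
  injective f -> finite_set [set: U] -> finite_set [set: T].
Proof.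
move=> fI fU; rewrite -[setT](preimage_setT f).
by apply: finite_preimage => // x y _ _; apply: fI.
Qed.

Lemma finite_surj (T U : Type) (f : T -> U) :
  range f = [set: U] -> finite_set [set: T] -> finite_set [set: U].
Proof. by move=> <-; apply: finite_image. Qed.

Lemma finite_seq_size (U : Type) n :
  finite_set [set: U] -> finite_set [set l : seq U | size l = n].
Proof.
move=> fU; elim: n => [|n IHn].
  by rewrite (_ : [set _ | _] = [set [::]]) //; apply/seteqP; split=> -[|x l].
rewrite (_ : [set _ | _] =
  [set x :: l | x in [set: U] & l in [set l : seq U | size l = n]]).
  exact: finite_image2.
apply/seteqP; split=> [[|x l] //= [szl]|_ [x _ [l /= <- <-]] //].
by exists x => //; exists l.
Qed.

Lemma finite_fun (T : choiceType) (U : Type) :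
  finite_set [set: T] -> finite_set [set: U] -> finite_set [set: T -> U].
Proof.
move=> /finite_seqP [s Ts] fU; pose F (f : T -> U) := map f s.
rewrite (_ : setT = F @^-1` [set l : seq U | size l = size s]).
  apply: finite_preimage; last exact: finite_seq_size.
  move=> f g _ _ /eq_in_map E; apply/funext => x; apply: E.
  by have : [set: T] x by []; rewrite Ts.
by apply/seteqP; split=> // f _; rewrite /F /= size_map.
Qed.

Lemma finite_prod (T U : Type) :
  finite_set [set: T] -> finite_set [set: U] -> finite_set [set: T * U].
Proof. by move=> fT fU; rewrite -setXTT; apply: finite_setX. Qed.

End Finiteness.

Section Sym.
Variable T : Type.

Record sym : Type := MkSym { sym_fun :> T -> T; sym_bij : bijective sym_fun }.

Lemma sym_eq (a b : sym) : a =1 b -> a = b.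
Proof.
case: a b => [f fB] [g gB] /= /funext fg.
by case: g / fg gB => gB; congr MkSym; apply: Prop_irrelevance.
Qed.

HB.instance Definition _ := gen_eqMixin sym.
HB.instance Definition _ := gen_choiceMixin sym.

Definition sym_one : sym := @MkSym id (Bijective (fun=> erefl) (fun=> erefl)).
Definition sym_mul (a b : sym) : sym := MkSym (bij_comp (sym_bij b) (sym_bij a)).

Fact sym_inv_ex (a : sym) : exists b : sym, cancel a b /\ cancel b a.
Proof.
by have [g aK gK] := sym_bij a; exists (MkSym (Bijective gK aK)).
Qed.

Definition sym_inv (a : sym) : sym := sval (cid (sym_inv_ex a)).

Fact sym_mulA : associative sym_mul. Proof. by move=> a b c; apply: sym_eq. Qed.
Fact sym_mul1 : left_id sym_one sym_mul. Proof. by move=> a; apply: sym_eq. Qed.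
Fact sym_1mul : right_id sym_one sym_mul. Proof. by move=> a; apply: sym_eq. Qed.
Fact sym_mulV : left_inverse sym_one sym_inv sym_mul.
Proof.
move=> a; apply: sym_eq => x /=; rewrite /sym_inv.
by case: cid => b /= [aK bK]; rewrite bK.
Qed.
Fact sym_Vmul : right_inverse sym_one sym_inv sym_mul.
Proof.
move=> a; apply: sym_eq => x /=; rewrite /sym_inv.
by case: cid => b /= [aK bK]; rewrite aK.
Qed.

HB.instance Definition _ :=
  isGroup.Build sym sym_mulA sym_mul1 sym_1mul sym_mulV sym_Vmul.

Lemma symM (a b : sym) x : (a * b) x = b (a x). Proof. by []. Qed.
Lemma sym1 x : (1 : sym) x = x. Proof. by []. Qed.
Lemma symVK (a : sym) : cancel (a^-1)%g a. Proof. by move=> x; rewrite -symM mulVg. Qed.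

Lemma sym_eq1 (a : sym) : (forall x, a x = x) -> a = 1.
Proof. by move=> aE; apply: sym_eq => x; rewrite aE. Qed.

Section Action.
Variables (X : groupType) (act : X -> T -> T).
Hypotheses (act1 : forall t, act 1 t = t).
Hypothesis (actM : forall x y t, act (x * y) t = act y (act x t)).

Fact act_bij x : bijective (act x).
Proof. by exists (act x^-1) => t; rewrite -actM ?mulgV ?mulVg act1. Qed.

Definition act_sym x : sym := MkSym (act_bij x).

Fact act_sym_morph : {morph act_sym : x y / x * y}.
Proof. by move=> x y; apply: sym_eq => t /=; rewrite actM. Qed.

Definition act_hom : hom X sym := mkhom act_sym_morph.

Lemma act_homE x t : act_hom x t = act x t. Proof. by []. Qed.

End Action.
End Sym.

Lemma finite_sym (T : choiceType) :
  finite_set [set: T] -> finite_set [set: sym T].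
Proof.
move=> fT; apply: (@finite_inj _ (T -> T) (@sym_fun T)); last exact: finite_fun.
by move=> a b E; apply: sym_eq => x; rewrite E.
Qed.

Section Orders.
Variable X : groupType.
Implicit Type x : X.

Lemma expg_mod1 x n m : x ^+ n = 1 -> x ^+ (m %% n) = x ^+ m.
Proof. by move=> xn; rewrite [in RHS](divn_eq m n) expgnDr mulnC expgnA xn expg1n mul1g. Qed.

Lemma is_order_ex x n : (0 < n)%N -> x ^+ n = 1 ->
  exists2 m, is_order x m & m %| n.
Proof.
move=> n0 xn; pose P m := (0 < m)%N && `[< x ^+ m = 1 >].
have exP : exists m, P m by exists n; rewrite /P n0 /=; apply/asboolP.
case: (ex_minnP exP) => m /andP [m0 /asboolP xm] mmin.
exists m; first by split=> // k k0 xk; apply: mmin; rewrite /P k0; apply/asboolP.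
apply: contraT => mn; have m' : (0 < n %% m)%N by rewrite lt0n.
have : P (n %% m) by rewrite /P m' /=; apply/asboolP; rewrite expg_mod1.
by move=> /mmin; rewrite leqNgt ltn_pmod.
Qed.

Lemma is_order_dvdn x m n : is_order x m -> x ^+ n = 1 -> m %| n.
Proof.
case=> m0 xm mmin xn; apply: contraT => mn.
have m' : (0 < n %% m)%N by rewrite lt0n.
by have := mmin _ m'; rewrite expg_mod1 // leqNgt ltn_pmod // => /(_ xn).
Qed.

End Orders.

Definition pnumber (P : set nat) n : Prop :=
  (0 < n)%N /\ forall r, prime r -> (r %| n)%N -> P r.

Lemma pnumber_dvd P m n : (m %| n)%N -> pnumber P n -> pnumber P m.
Proof.
move=> mn [n0 nP]; split=> [|r rp rm]; first exact: dvdn_gt0 mn.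
by apply: nP => //; apply: dvdn_trans mn.
Qed.

Lemma pnumberM P m n : pnumber P m -> pnumber P n -> pnumber P (m * n).
Proof.
move=> [m0 mP] [n0 nP]; split=> [|r rp]; first by rewrite muln_gt0 m0.
by rewrite Euclid_dvdM // => /orP[]; [apply: mP|apply: nP].
Qed.

Lemma pnumberX (P : set nat) p k : prime p -> P p -> pnumber P (p ^ k).
Proof.
move=> pp Pp; split=> [|r rp]; first by rewrite expn_gt0 prime_gt0.
by rewrite Euclid_dvdX // dvdn_prime2 // => /andP [/eqP ->].
Qed.

Lemma pnumber_coprime P n r : prime r -> ~ P r -> pnumber P n -> coprime n r.
Proof.
move=> rp Pr [n0 nP]; rewrite coprime_sym prime_coprime //.
by apply/negP => /(nP _ rp).
Qed.

Lemma pnumber1_pow p n : prime p -> pnumber [set p] n -> exists k, n = (p ^ k)%N.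
Proof.
move=> pp [n0 nP]; exists (logn p n).
have := part_pnat_id (n := n) (pi := p); rewrite p_part => ->//.
by apply/pnatP => // r rp /(nP _ rp) ->; rewrite inE /= eqxx.
Qed.

Lemma prime_groupP P (X : groupType) :
  prime_group P X <-> forall x : X, exists2 n, pnumber P n & x ^+ n = 1.
Proof.
split=> XP x; first by have [n [n0 xn _] nP] := XP x; exists n.
have [n nP xn] := XP x; have [m xm mn] := is_order_ex (proj1 nP) xn.
by exists m => //; have [] := pnumber_dvd mn nP.
Qed.

Lemma prime_powP p (X : groupType) : prime p ->
  prime_group [set p] X <-> forall x : X, exists k, x ^+ (p ^ k) = 1.
Proof.
move=> pp; rewrite prime_groupP; split=> XP x; have [n] := XP x.
  by move=> /(pnumber1_pow pp) [k ->]; exists k.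
by exists (p ^ n)%N => //; apply: pnumberX.
Qed.

Lemma expg_pow_le (X : groupType) (x : X) p k l :
  (k <= l)%N -> x ^+ (p ^ k) = 1 -> x ^+ (p ^ l) = 1.
Proof. by move=> /subnKC <- xk; rewrite expnD expgnA xk expg1n. Qed.

Section ClassF.
Variable p : nat.
Hypothesis pp : prime p.

Lemma class_F_exponent (X : groupType) : class_F p X ->
  exists k, forall x : X, x ^+ (p ^ k) = 1.
Proof.
move=> [/finite_seqP [s Xs] /(prime_powP _ pp) XP].
suff [k kP] : exists k, forall x, x \in s -> x ^+ (p ^ k) = 1.
  by exists k => x; apply: kP; have : [set: X] x by []; rewrite Xs.
elim: s {Xs} => [|x s [k IH]]; first by exists 0%N.
have [l xl] := XP x; exists (maxn k l) => y; rewrite inE => /predU1P [->|/IH].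
  exact: expg_pow_le (leq_maxr _ _) xl.
exact: expg_pow_le (leq_maxl _ _).
Qed.

Lemma class_F_intro (X : groupType) : finite_set [set: X] ->
  (forall x : X, exists k, x ^+ (p ^ k) = 1) -> class_F p X.
Proof. by move=> fX XP; split=> //; apply/prime_powP. Qed.

Lemma class_F_inj (X Y : groupType) (f : hom X Y) :
  injective f -> class_F p Y -> class_F p X.
Proof.
move=> fI [fY /(prime_powP _ pp) YP]; apply: class_F_intro; first exact: (finite_inj fI).
by move=> x; have [k xk] := YP (f x); exists k; apply: fI; rewrite gmulfXn xk gmulf1.
Qed.

Lemma class_F_surj (X Y : groupType) (f : hom X Y) :
  range f = [set: Y] -> class_F p X -> class_F p Y.
Proof.
move=> fT [fX /(prime_powP _ pp) XP]; apply: class_F_intro; first exact: (finite_surj fT).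
move: fT => /surjP fT y; have [x <-] := fT y; have [k xk] := XP x.
by exists k; rewrite -gmulfXn xk gmulf1.
Qed.

Lemma class_F_range (X Y : groupType) (f : hom X Y) :
  class_F p Y -> class_F p (subg (range f)).
Proof. by apply: (@class_F_inj _ _ (subg_incl (range f))); apply: val_inj. Qed.

Lemma expg_pair (X Y : groupType) (u : X * Y) n : u ^+ n = (u.1 ^+ n, u.2 ^+ n).
Proof. by case: u => x y; elim: n => // n IHn; rewrite !expgS IHn. Qed.

Lemma class_F_prod (X Y : groupType) :
  class_F p X -> class_F p Y -> class_F p (X * Y)%type.
Proof.
move=> FX FY; apply: class_F_intro; first by apply: finite_prod; [case: FX|case: FY].
have [k kP] := class_F_exponent FX; have [l lP] := class_F_exponent FY.
move=> u; exists (maxn k l); rewrite expg_pair.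
by rewrite (expg_pow_le (leq_maxl _ _) (kP _)) (expg_pow_le (leq_maxr _ _) (lP _)).
Qed.

Lemma class_F_triv (X : groupType) : (forall x : X, x = 1) -> class_F p X.
Proof.
move=> X1; apply: class_F_intro => [|x]; last by exists 0%N; apply: X1.
by rewrite (_ : setT = [set 1]) //; apply/seteqP; split=> // x _; apply: X1.
Qed.

End ClassF.

(** * Central series *)

Section CommutatorIdentities.
Variable X : groupType.
Implicit Types x y z : X.

Lemma commMg x y z : [~ x * y, z] = [~ x, z] ^ y * [~ y, z].
Proof. by rewrite /commg /conjg !gnorm. Qed.

Lemma commgM x y z : [~ x, y * z] = [~ x, z] * [~ x, y] ^ z.
Proof. by rewrite /commg /conjg !gnorm. Qed.

Lemma commVg x z : [~ x^-1, z] = ([~ x, z] ^ x^-1)^-1.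
Proof. by rewrite /commg /conjg !gnorm. Qed.

Lemma commg_expl x y n : commute x [~ x, y] -> [~ x ^+ n, y] = [~ x, y] ^+ n.
Proof.
move=> xC; elim: n => [|n IHn]; first exact: comm1g.
rewrite expgS commMg IHn expgS; congr (_ * _).
by apply/conjg_fixP/commgP/commuteX/commute_sym.
Qed.

End CommutatorIdentities.

Section UpperCentral.

Fixpoint upper_central (X : groupType) (k : nat) : set X :=
  if k is k'.+1 then [set x | forall y, upper_central k' [~ x, y]] else [set 1].
Arguments upper_central X k : clear implicits.

Lemma upper_central_normal (X : groupType) k : normal (upper_central X k).
Proof.
elim: k => [|k IHk]; first exact: normal_1.
have [sZ ZJ] := IHk; split; first split.
- by move=> y; rewrite comm1g; apply: subgroup1.
- move=> x y Zx Zy z; rewrite commMg.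
  apply: subgroupM => //; first exact: ZJ.
  by rewrite commVg; apply: subgroupV => //; apply: ZJ.
by move=> x y Zx z; rewrite -(conjgKV y z) -conjRg; apply: ZJ.
Qed.

Lemma upper_centralS (X : groupType) k : upper_central X k `<=` upper_central X k.+1.
Proof. by move=> x Zx y; apply: normalR => //; apply: upper_central_normal. Qed.

Lemma upper_central_le (X : groupType) k l :
  (k <= l)%N -> upper_central X k `<=` upper_central X l.
Proof.
move=> /subnKC <-; elim: (l - k)%N => [|m IHm]; first by rewrite addn0.
by rewrite addnS; apply: subset_trans IHm (@upper_centralS _ _).
Qed.

Lemma nilpotentP (X : groupType) :
  nilpotent_group X <-> exists n, upper_central X n = [set: X].
Proof.
split=> [[n [c [c0 cn _ _ cR]]]|[n Zn]]; exists n.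
  apply/seteqP; split=> // x; rewrite -cn; move: (leqnn n) x.
  elim: {1 3 4}n => [|k IHk] kn x; first by rewrite c0.
  by move=> cx y; apply: IHk; [apply: ltnW|apply: cR].
exists (upper_central X); split=> // k _; first exact: upper_central_normal.
exact: upper_centralS.
Qed.

Lemma upper_central_surj (X Y : groupType) (f : hom X Y) k x :
  range f = [set: Y] -> upper_central X k x -> upper_central Y k (f x).
Proof.
move=> /surjP fT; elim: k x => [|k IHk] x; first by move=> ->; rewrite gmulf1.
by move=> Zx y; have [z <-] := fT y; rewrite -gmulfR; apply: IHk.
Qed.

Lemma upper_central_inj (X Y : groupType) (f : hom X Y) k x :
  injective f -> upper_central Y k (f x) -> upper_central X k x.
Proof.
move=> fI; elim: k x => [|k IHk] x; first by move=> fx; apply: fI; rewrite gmulf1.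
by move=> Zx y; apply: IHk; rewrite gmulfR.
Qed.

Lemma nilpotent_surj (X Y : groupType) (f : hom X Y) :
  range f = [set: Y] -> nilpotent_group X -> nilpotent_group Y.
Proof.
move=> fT /nilpotentP [n Xn]; apply/nilpotentP; exists n; apply/seteqP; split=> // y _.
by have [x <-] := (surjP f).1 fT y; apply: upper_central_surj => //; rewrite Xn.
Qed.

Lemma nilpotent_inj (X Y : groupType) (f : hom X Y) :
  injective f -> nilpotent_group Y -> nilpotent_group X.
Proof.
move=> fI /nilpotentP [n Yn]; apply/nilpotentP; exists n; apply/seteqP; split=> // x _.
by apply: (upper_central_inj fI); rewrite Yn.
Qed.

Lemma nilpotent_prod (X Y : groupType) :
  nilpotent_group X -> nilpotent_group Y -> nilpotent_group (X * Y)%type.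
Proof.
move=> /nilpotentP [n Xn] /nilpotentP [m Ym]; apply/nilpotentP; exists (maxn n m).
have E k (u : X * Y) : upper_central X k u.1 -> upper_central Y k u.2 ->
    upper_central (X * Y)%type k u.
  elim: k u => [|k IHk] [x y] /=; first by move=> -> ->.
  by move=> Zx Zy [z t]; apply: IHk; [apply: Zx|apply: Zy].
apply/seteqP; split=> // u _; apply: E.
  by apply: (upper_central_le (leq_maxl n m)); rewrite Xn.
by apply: (upper_central_le (leq_maxr n m)); rewrite Ym.
Qed.

(** If x lies in term k + 2, then [x, u] is central modulo term k, so [x^q, u] = [x, u]^q there and
    induction applies to [x, u]. Hence raising to the power q lowers the term by one, and k such
    steps reach 1. *)
Lemma upper_central_exponent (X : groupType) q :
  (forall z : X, (forall y, [~ z, y] = 1) -> z ^+ q = 1) ->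
  forall k x, upper_central X k x -> x ^+ (q ^ k) = 1.
Proof.
move=> Zq; have step k x : upper_central X k.+1 x -> upper_central X k (x ^+ q).
  elim: k x => [|k IHk] x Zx; first exact: Zq.
  move=> u; have nZ := upper_central_normal X k.
  apply/(quo_eq1n _ nZ); rewrite gmulfR gmulfXn commg_expl.
    by rewrite -gmulfR -gmulfXn; apply/(quo_eq1n _ nZ)/IHk/Zx.
  apply: commute_sym; apply/commgP/eqP; rewrite -!gmulfR; apply/(quo_eq1n _ nZ).
  exact: Zx.
elim=> [|k IHk] x Zx; first by rewrite expn0.
by rewrite expnS expgnA; apply: IHk; apply: step.
Qed.

End UpperCentral.
Arguments upper_central X k : clear implicits.

Section ClassFN.
Variable P : set nat.

Lemma class_FN_surj (X Y : groupType) (f : hom X Y) :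
  range f = [set: Y] -> class_FN P X -> class_FN P Y.
Proof.
move=> fT [fX nX /prime_groupP pX]; split; first exact: (finite_surj fT).
  exact: (nilpotent_surj fT).
apply/prime_groupP => y; have [x <-] := (surjP f).1 fT y; have [n nP xn] := pX x.
by exists n => //; rewrite -gmulfXn xn gmulf1.
Qed.

Lemma class_FN_inj (X Y : groupType) (f : hom X Y) :
  injective f -> class_FN P Y -> class_FN P X.
Proof.
move=> fI [fY nY /prime_groupP pY]; split; first exact: (finite_inj fI).
  exact: (nilpotent_inj fI).
apply/prime_groupP => x; have [n nP xn] := pY (f x).
by exists n => //; apply: fI; rewrite gmulfXn xn gmulf1.
Qed.

Lemma class_FN_prod (X Y : groupType) :
  class_FN P X -> class_FN P Y -> class_FN P (X * Y)%type.
Proof.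
move=> [fX nX /prime_groupP pX] [fY nY /prime_groupP pY]; split.
- exact: finite_prod.
- exact: nilpotent_prod.
apply/prime_groupP => u; have [n nP xn] := pX u.1; have [m mP ym] := pY u.2.
exists (n * m)%N; first exact: pnumberM.
by rewrite expg_pair expgnA xn expg1n mulnC expgnA ym expg1n.
Qed.

Lemma class_FN_triv (X : groupType) : (forall x : X, x = 1) -> class_FN P X.
Proof.
move=> X1; split.
- by have [] := class_F_triv (p := 2) isT X1.
- apply/nilpotentP; exists 0%N; apply/seteqP; split=> // x _; exact: X1.
apply/prime_groupP => x; exists 1%N => //; split=> // r rp.
by rewrite dvdn1 => /eqP r1; rewrite r1 in rp.
Qed.

End ClassFN.

(** The bridge to the finite group library, through which Cauchy's theorem and the nontriviality of
    the centre of a finite p-group become available. *)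
Lemma finite_group_finGroup (X : groupType) : finite_group X ->
  exists (gT : finGroupType) (f : X -> gT), {morph f : x y / x * y} /\ bijective f.
Proof.
move=> /finite_seqP [s Xs].
pose e := undup s.
have eP : Finite.axiom e.
  move=> x; rewrite count_uniq_mem ?undup_uniq // mem_undup.
  by have : [set: X] x by []; rewrite Xs /= => ->.
have cK : pcancel (fun x : X => index x e) (fun k => nth None (map Some e) k).
  move=> x; have xe : x \in e by rewrite mem_undup; have : [set: X] x by []; rewrite Xs.
  by rewrite (nth_map x) ?index_mem // nth_index.
pose cM := Choice_isCountable.Build X cK.
pose fM := isFinite.Build X eP.
pose gT : finGroupType := HB.pack (Group.sort X) (Group.class X) cM fM.
exists gT, (fun x : X => x : gT); split=> //.
by exists (fun x : gT => x : X).
Qed.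

Lemma count_ltn (T : eqType) (a b : pred T) (s : seq T) x :
  x \in s -> subpred a b -> ~~ a x && b x -> (count a s < count b s)%N.
Proof.
move=> xs ab /andP [ax bx]; elim: s xs => //= y s IHs.
rewrite inE => /predU1P [<-|/IHs lt_ab]; last first.
  by rewrite -addnS leq_add //; case: (a y) (ab y) => // ->.
by rewrite (negPf ax) bx ltnS sub_count.
Qed.

Section FinitePGroups.
Variable p : nat.
Hypothesis pp : prime p.

Lemma class_F_center (X : groupType) : class_F p X -> (exists x : X, x <> 1) ->
  exists z : X, [/\ z <> 1, forall y, [~ z, y] = 1 & z ^+ p = 1].
Proof.
move=> FX [x x1]; have [fX /(prime_powP _ pp) pX] := FX.
have [gT [f [fM [g fK gK]]]] := finite_group_finGroup fX.
have gM : {morph g : x y / x * y} by move=> u v; rewrite -[RHS]fK fM !gK.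
have f1 : f 1 = 1 by rewrite -(mkhomE fM) gmulf1.
pose G := [set: gT]%G; have inG u : u \in G by rewrite inE.
have pG : p.-group G.
  apply/pgroup.pgroupP => q qp /(Cauchy qp) [u _ uq]; rewrite inE /=.
  have [k uk] := pX (g u); have : u ^+ (p ^ k) = 1.
    by rewrite -[u]gK -[LHS](gmulfXn (mkhom fM)) uk.
  move/eqP; rewrite -order_dvdn uq Euclid_dvdX // dvdn_prime2 // => /andP [/eqP -> _].
  exact: eqxx.
have /trivgPn [z Zz z1] : 'Z(G)%g != 1%g.
  apply/eqP => /(trivg_center_pgroup pG) /= G1; apply: x1.
  by have := inG (f x); rewrite /G /= G1 inE => /eqP fx; rewrite -[x]fK fx -f1 fK.
have [k zk] := pX (g z).
have {zk} [l zl zl1] : exists2 l, g z ^+ (p ^ l) <> 1 & g z ^+ (p ^ l.+1) = 1.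
  elim: k zk => [|k IHk] zk; last first.
    by have [/IHk|] := pselect (g z ^+ (p ^ k) = 1); [|exists k].
  by case/eqP: z1; rewrite -[z]gK -[g z]expg1 -[1%N]/(p ^ 0)%N zk f1.
exists (g z ^+ (p ^ l)); split=> // [y|]; last by rewrite -expgnA -expnSr.
apply/eqP/commgP/commute_sym/commuteX; rewrite /commute -[y]fK -!gM.
by congr g; case/centerP: Zz => _ /(_ (f y) (inG _)) ->.
Qed.

(** The ascending counterpart of [lower_pcentral]; it serves to bound the lower series of a finite
    p-group and to show that such a group is nilpotent. *)
Fixpoint upper_pcentral (X : groupType) (k : nat) : set X :=
  if k is k'.+1 then
    [set x | (forall y, upper_pcentral k' [~ x, y]) /\ upper_pcentral k' (x ^+ p)]
  else [set 1].
Arguments upper_pcentral X k : clear implicits.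

Lemma upper_pcentral_normal (X : groupType) k : normal (upper_pcentral X k).
Proof.
elim: k => [|k IHk]; first exact: normal_1.
have [sZ ZJ] := IHk; split; first split.
- split=> [y|]; last exact: (subgroupX _ sZ (subgroup1 sZ)).
  by rewrite comm1g; apply: subgroup1 sZ.
- move=> x y [Zx Zxp] [Zy Zyp]; split=> [z|].
    rewrite commMg; apply: subgroupM => //; first exact: (ZJ _ _ (Zx _)).
    by rewrite commVg; apply: subgroupV => //; apply: (ZJ _ _ (Zy _)).
  have E u : upper_pcentral X k (u ^+ p) -> quo_pi (upper_pcentral X k) u ^+ p = 1.
    by move=> Zu; rewrite -gmulfXn; apply/(quo_eq1n _ IHk).
  apply/(quo_eq1n _ IHk); rewrite gmulfXn gmulfF expgnFl.
    by rewrite !E // divg1.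
  by apply/commgP/eqP; rewrite -gmulfR; apply/(quo_eq1n _ IHk)/Zx.
move=> x y [Zx Zxp]; split=> [z|]; last by rewrite -conjXg; apply: ZJ.
by rewrite -(conjgKV y z) -conjRg; apply: (ZJ _ _ (Zx _)).
Qed.

Lemma class_F_upper_pcentral (X : groupType) : class_F p X ->
  exists n, upper_pcentral X n = [set: X].
Proof.
move=> FX; have [/finite_seqP [s Xs] _] := FX.
have incr k : upper_pcentral X k `<=` upper_pcentral X k.+1.
  have nE := upper_pcentral_normal X k.
  by move=> x Ex; split=> [y|]; [apply: normalR|apply: subgroupX => //; case: nE].
pose m k := count (fun x => `[< upper_pcentral X k x >]) s.
have [|full] := pselect (exists n, upper_pcentral X n = [set: X]); first by [].
(* While a term is proper, the quotient by it has a nontrivial central element of order p, whose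
   preimages lie in the next term only. So term k would account for at least k entries of [s], for
   every k. *)
suff : forall k, (k <= m k)%N.
  by move=> /(_ (size s).+1); rewrite leqNgt ltnS count_size.
elim=> // k IHk; apply: (leq_ltn_trans IHk); rewrite /m.
have nE := upper_pcentral_normal X k.
have FQ : class_F p (quotient (upper_pcentral X k)).
  by apply: class_F_surj FX => //; apply: quo_pi_surj.
have [|z [z1 zC zp]] := class_F_center FQ.
  apply: contrapT => Q1; apply: full; exists k; apply/seteqP; split=> // x _.
  by apply/(quo_eq1n _ nE); apply: contrapT => x1; apply: Q1; exists (quo_pi _ x).
have [x xz] := quo_surj z; subst z.
have Ex : upper_pcentral X k.+1 x.
  by split=> [y|]; apply/(quo_eq1n _ nE); rewrite ?gmulfR ?gmulfXn.
have xs : x \in s by have : [set: X] x by []; rewrite Xs.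
apply: (count_ltn xs) => [y /asboolP Ey|]; first by apply/asboolP/incr.
rewrite (asboolT Ex) andbT; apply/negP => /asboolP /(quo_eq1n _ nE); exact: z1.
Qed.

End FinitePGroups.
Arguments upper_pcentral p X k : clear implicits.

Fact aut_fun_morph (X : groupType) (a : aut X) : {morph a : x y / x / y}.
Proof. by move=> x y; rewrite -!(mkhomE (aut_morph a)) gmulfF. Qed.

HB.instance Definition _ (X : groupType) (a : aut X) :=
  isGroupMorphism.Build X X (aut_fun a) (aut_fun_morph a).

Lemma commg_central (X : groupType) (x y u v : X) :
  [~ x * u, v] = 1 -> [~ u, y] = 1 -> (forall z, commute [~ x, y] z) ->
  [~ x * u, y * v] = [~ x, y].
Proof.
move=> xuv uy xyC; rewrite commgM xuv mul1g commMg uy mulg1.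
have xyJ z : [~ x, y] ^ z = [~ x, y] by apply/conjg_fixP/commgP/xyC.
by rewrite !xyJ.
Qed.

(** * Lower exponent-p central series and automorphisms of p-power order *)

Section LowerPCentral.
Variable p : nat.

Fixpoint lower_pcentral (X : groupType) (k : nat) : set X :=
  if k is k'.+1 then
    generated ([set [~ x, y] | x in lower_pcentral k' & y in [set: X]] `|`
               [set x ^+ p | x in lower_pcentral k'])
  else [set: X].
Arguments lower_pcentral X k : clear implicits.

Lemma lower_pcentralR (X : groupType) k (x y : X) :
  lower_pcentral X k x -> lower_pcentral X k.+1 [~ x, y].
Proof. by move=> Kx; apply: sub_generated; left; exists x => //; exists y. Qed.

Lemma lower_pcentralX (X : groupType) k (x : X) :
  lower_pcentral X k x -> lower_pcentral X k.+1 (x ^+ p).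
Proof. by move=> Kx; apply: sub_generated; right; exists x. Qed.

Lemma lower_pcentral_hom (X Y : groupType) (f : hom X Y) k x :
  lower_pcentral X k x -> lower_pcentral Y k (f x).
Proof.
elim: k x => [//|k IHk] x.
suff: lower_pcentral X k.+1 `<=` f @^-1` lower_pcentral Y k.+1 by apply.
apply: generated_sub; first exact/preimage_subgroup/generated_group.
move=> _ [[u /IHk Ku [v _ <-]]|[u /IHk Ku <-]].
  by rewrite /preimage /mkset gmulfR; apply: lower_pcentralR.
by rewrite /preimage /mkset gmulfXn; apply: lower_pcentralX.
Qed.

Lemma lower_pcentral_normal (X : groupType) k : normal (lower_pcentral X k).
Proof.
elim: k => [|k [_ KJ]]; first exact: normal_setT.
apply: generated_normal => x z [[u Ku [v _ <-]]|[u Ku <-]].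
  left; exists (u ^ z); first exact: KJ.
  by exists (v ^ z); rewrite // conjRg.
by right; exists (u ^ z); [apply: KJ|rewrite conjXg].
Qed.

Lemma lower_pcentralS (X : groupType) k : lower_pcentral X k.+1 `<=` lower_pcentral X k.
Proof.
have nK := lower_pcentral_normal X k.
apply: generated_sub; first by case: nK.
move=> _ [[u Ku [v _ <-]]|[u Ku <-]]; first exact: normalR.
by apply: subgroupX => //; case: nK.
Qed.

Lemma lower_pcentral_exponent (X : groupType) k (x : X) :
  lower_pcentral X k (x ^+ (p ^ k)).
Proof.
elim: k => // k IHk; rewrite expnSr expgnA; exact: lower_pcentralX.
Qed.

Lemma power_derived_sub (X : groupType) : power_derived p X `<=` lower_pcentral X 1.
Proof.
have [sK _] := lower_pcentral_normal X 1.
move=> _ [x Kx [y Ky <-]]; apply: (subgroupM sK).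
  suff: generated [set x ^+ p | x in [set: X]] `<=` lower_pcentral X 1 by apply.
  by apply: generated_sub => // _ [u _ <-]; apply: (@lower_pcentralX X 0).
suff: generated [set [~ x, y] | x in [set: X] & y in [set: X]] `<=` lower_pcentral X 1.
  by apply.
by apply: generated_sub => // _ [u _ [v _ <-]]; apply: (@lower_pcentralR X 0).
Qed.

(** If the ascending series exhausts the group at n, then term k of the lower series lies in term n
    - k of the ascending one. *)
Lemma class_F_lower_pcentral (X : groupType) : prime p -> class_F p X ->
  exists n, lower_pcentral X n `<=` [set 1].
Proof.
move=> pp FX; have [n En] := class_F_upper_pcentral pp FX; exists n.
suff KE k : (k <= n)%N -> lower_pcentral X k `<=` upper_pcentral p X (n - k).
  by have := KE n (leqnn n); rewrite subnn.
elim: k => [_|k IHk kn]; first by rewrite subn0 En.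
have {}IHk := IHk (ltnW kn); rewrite -(ltn_predK (_ : 0 < n - k)%N) ?subn_gt0 // -subnS in IHk.
apply: generated_sub; first by case: (upper_pcentral_normal p X (n - k.+1)).
by move=> _ [[u /IHk [Eu _] [v _ <-]]|[u /IHk [_ Eu] <-]]; [apply: Eu|apply: Eu].
Qed.

Lemma class_F_nilpotent (X : groupType) : prime p -> class_F p X -> nilpotent_group X.
Proof.
move=> pp FX; have [n En] := class_F_upper_pcentral pp FX.
apply/nilpotentP; exists n; apply/seteqP; split=> // x _.
have {En} : upper_pcentral p X n x by rewrite En.
by elim: n x => // n IHn x [Ex _] y; apply/IHn/Ex.
Qed.

(* Modulo the (i+2)nd term, [w, -] is a homomorphism into a central subgroup of
   exponent p; hence it kills the first term. *)
Lemma lower_pcentralR1 (X : groupType) i (w v : X) :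
  lower_pcentral X i w -> lower_pcentral X 1 v -> lower_pcentral X i.+2 [~ w, v].
Proof.
move=> Kw Kv; pose K := lower_pcentral X i.+2.
have nK : normal K by apply: lower_pcentral_normal.
pose c u := quo_pi K [~ w, u].
have cC u (x : quotient K) : commute (c u) x.
  have [y <-] := quo_surj x; apply/commgP/eqP; rewrite -gmulfR.
  by apply/(quo_eq1n _ nK); do 2!apply: lower_pcentralR.
have cM : {morph c : u u' / u * u'}.
  move=> u u'; rewrite /c commgM gmulfM gmulfJ -[RHS]cC; congr (_ * _).
  exact/conjg_fixP/commgP/cC.
apply/(quo_eq1n _ nK); rewrite -/(c v) -(mkhomE cM).
suff: lower_pcentral X 1 `<=` kernel (mkhom cM) by apply.
apply: generated_sub; first by case: (kernel_normal (mkhom cM)).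
move=> _ [[u _ [u' _ <-]]|[u _ <-]]; rewrite /kernel /preimage /mkset.
  by rewrite gmulfR; apply/eqP/commgP/cC.
rewrite gmulfXn mkhomE /c -gmulfXn.
by apply/(quo_eq1n _ nK); apply: lower_pcentralX; apply: lower_pcentralR.
Qed.

Definition trivial_mod (X : groupType) (N : set X) (a : aut X) : Prop :=
  forall x, N (x^-1 * a x).

Lemma trivial_modP (X : groupType) (N : set X) (a : aut X) : normal N ->
  trivial_mod N a <-> forall x, quo_pi N (a x) = quo_pi N x.
Proof.
move=> nN; split=> aN x; first by apply/esym/kernelP/(quo_eq1n _ nN)/aN.
by have /esym/kernelP/(quo_eq1n _ nN) := aN x.
Qed.

(** Term i + 1 is generated by commutators [x, y] and powers x^p with x in term i, so these suffice.
    Write a x = x u and a y = y v, with u in term i + 1 by induction and v in term 1. Modulo term i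
    + 2, [x u, v] vanishes by [lower_pcentralR1] and u is central of exponent p, so neither u nor v
    changes [x, y] or x^p. *)
Lemma trivial_mod_section (X : groupType) (a : aut X) i x :
  trivial_mod (lower_pcentral X 1) a -> lower_pcentral X i x ->
  lower_pcentral X i.+1 (x^-1 * a x).
Proof.
move=> a1; elim: i x => [x _|i IHi]; first exact: a1.
pose K := lower_pcentral X i.+2.
have nK : normal K by apply: lower_pcentral_normal.
have KC u (y : quotient K) : lower_pcentral X i.+1 u -> commute (quo_pi K u) y.
  move=> Ku; have [z <-] := quo_surj y; apply/commgP/eqP; rewrite -gmulfR.
  by apply/(quo_eq1n _ nK); apply: lower_pcentralR.
pose T := [set x | quo_pi K (a x) = quo_pi K x].
have TE x : T x <-> K (x^-1 * a x).
  split=> [/esym/kernelP/(quo_eq1n _ nK) //|Kx].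
  by apply/esym/kernelP/(quo_eq1n _ nK).
have sT : subgroup T.
  split=> [|x y Tx Ty]; rewrite /T /=; first by rewrite gmulf1.
  by rewrite (gmulfF a) !gmulfF /= Tx Ty.
suff: lower_pcentral X i.+1 `<=` T by move=> KT x /KT /TE.
apply: generated_sub => // _ [[x Kx [y _ <-]]|[x Kx <-]]; rewrite /T /=.
  have Ku := IHi _ Kx; have Kv := a1 y; set u := _ * a x in Ku; set v := _ * a y in Kv.
  have ax : a x = x * u by rewrite mulVKg.
  have ay : a y = y * v by rewrite mulVKg.
  rewrite (gmulfR a) /= ax ay.
  have Kxu : lower_pcentral X i (x * u).
    by apply: subgroupM => //; [case: (lower_pcentral_normal X i)|apply: lower_pcentralS].
  rewrite gmulfR [RHS]gmulfR (gmulfM x u) (gmulfM y v); apply: commg_central.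
  - by have := (quo_eq1n _ nK).2 (lower_pcentralR1 Kxu Kv); rewrite gmulfR (gmulfM x u).
  - by have := (quo_eq1n _ nK).2 (lower_pcentralR y Ku); rewrite gmulfR.
  by move=> z; have := KC _ z (lower_pcentralR y Kx); rewrite gmulfR.
have Ku := IHi _ Kx; set u := _ * a x in Ku; have ax : a x = x * u by rewrite mulVKg.
rewrite (gmulfXn a) /= ax gmulfXn gmulfM /=.
rewrite expgMn; last exact/commute_sym/KC.
rewrite -gmulfXn -gmulfXn [X in _ * X](quo_eq1n _ nK).2 ?mulg1 //.
exact: lower_pcentralX.
Qed.

(** If b x = x w with w in term m + 1, then b fixes w modulo term m + 2, so b^n x = x w^n there; for
    n = p the factor disappears. Each further term therefore costs one more p-th power. *)
Lemma trivial_mod_pow (X : groupType) (a : aut X) m :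
  trivial_mod (lower_pcentral X 1) a ->
  exists l, trivial_mod (lower_pcentral X m) (a ^+ (p ^ l)).
Proof.
move=> a1; case: m => [|m]; first by exists 0%N.
elim: m => [|m [l IHm]]; first by exists 0%N.
exists l.+1; rewrite expnSr expgnA; set b := a ^+ _ in IHm *.
have b1 : trivial_mod (lower_pcentral X 1) b.
  move=> x; move: (IHm x); elim: (m) => // k IHk; move/lower_pcentralS; exact: IHk.
have nK := lower_pcentral_normal X m.+2; set K := lower_pcentral X m.+2 in nK.
have bE n w : lower_pcentral X m.+1 w -> quo_pi K ((b ^+ n) w) = quo_pi K w.
  elim: n w => // n IHn w Kw; rewrite expgS.
  rewrite -[LHS]/(quo_pi K ((b ^+ n) (b w))) IHn.
    by apply/esym/(quo_eqP _ _ nK); apply: trivial_mod_section b1 Kw.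
  exact: lower_pcentral_hom.
have bX n x : quo_pi K ((b ^+ n) x) = quo_pi K x * quo_pi K (x^-1 * b x) ^+ n.
  elim: n x => [|n IHn] x; first by rewrite mulg1.
  rewrite expgS -[LHS]/(quo_pi K ((b ^+ n) (b x))) -[b x in LHS](mulVKg x).
  by rewrite aut_morph gmulfM /= IHn bE // expgSr mulgA.
apply/trivial_modP => // x; rewrite bX.
have := (quo_eq1n _ nK).2 (lower_pcentralX (IHm x)).
by rewrite gmulfXn => ->; rewrite mulg1.
Qed.

End LowerPCentral.
Arguments lower_pcentral p X k : clear implicits.

Lemma class_F_FN (P : set nat) p (X : groupType) :
  prime p -> P p -> class_F p X -> class_FN P X.
Proof.
move=> pp Pp FX; have [fX /(prime_powP _ pp) pX] := FX; split=> //.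
  exact: class_F_nilpotent FX.
apply/prime_groupP => x; have [k xk] := pX x.
by exists (p ^ k)%N => //; apply: pnumberX.
Qed.

(** * Bounded nilpotent groups *)

(* Each section K/N of X in which every element has p-power order is finite: T
   meets all the cosets of N in K. *)
Definition finite_sections p (X : groupType) : Prop := forall K N : set X,
  subgroup K -> subgroup N -> N `<=` K -> (forall x y, N x -> K y -> N (x ^ y)) ->
  (forall x, K x -> exists e, N (x ^+ (p ^ e))) ->
  exists T : seq X, forall x, K x -> exists2 t, t \in T & N (t^-1 * x).

Lemma finite_sections_finite p (X : groupType) :
  finite_group X -> finite_sections p X.
Proof.
move=> /finite_seqP [s Xs] K N _ sN _ _ _; exists s => x Kx; exists x.
  by have : [set: X] x by []; rewrite Xs.
by rewrite mulVg; apply: subgroup1.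
Qed.

Section BoundedNilpotent.
Variables (P : set nat) (X : groupType) (n : nat) (c : nat -> set X).
Hypothesis cc : central_series n c.
Hypothesis cP : forall k, (k < n)%N -> bounded_abelian P (series_factor c k).
Variables (p : nat) (K N : set X).
Hypotheses (Pp : P p) (sK : subgroup K) (sN : subgroup N) (NK : N `<=` K).
Hypothesis NJ : forall x y, N x -> K y -> N (x ^ y).
Hypothesis KNp : forall x, K x -> exists e, N (x ^+ (p ^ e)).

(** Modulo the image [M] of [N] in the factor, the elements coming from [K] have p-power order, so
    boundedness leaves only finitely many values of [phi] on them; one representative in [K] is
    chosen for each value. *)
Lemma bounded_series_step k : (k < n)%N ->
  exists s : seq X, (forall t, t \in s -> K t) /\
    forall x, K x -> c k.+1 x ->
      exists2 t, t \in s & exists2 u, N u & c k (u^-1 * (t^-1 * x)).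
Proof.
move=> kn; have [_ _ cn csub _] := cc.
have [abF bF] := cP kn.
pose S := [set y : subg (c k.+1) | c k (val y)].
have nS : normal S.
  have [sc cJ] := cn _ (ltnW kn); split; first split.
  - by rewrite /S /mkset val1; apply: subgroup1.
  - by move=> x y Sx Sy; apply: (subgroupF sc Sx Sy).
  by move=> x y Sx; apply: cJ Sx.
have sc1 : subgroup (c k.+1) by have [] := cn _ kn.
pose F := series_factor c k; pose piS : hom (subg (c k.+1)) F := quo_pi S.
pose M : set F := piS @` [set y | N (val y)].
have nM : normal M.
  split; last by move=> x y Mx; rewrite conjgE abF mulgK.
  apply: image_subgroup; split; first by rewrite /mkset val1; apply: subgroup1.
  by move=> x y Nx Ny; apply: (subgroupF sN Nx Ny).
have /finite_seqP [l lE] := bF _ nM _ Pp.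
pose phi : hom (subg (c k.+1)) (quotient M) := quo_pi M \o piS.
pose good d t := K t /\ exists2 y : subg (c k.+1), val y = t & phi y = d.
(* A value [d] that is not attained on [K] gets the dummy representative 1, so that all of [map r l]
   lies in [K]. *)
have /choice [r rP] : forall d, exists t, K t /\ ((exists t, good d t) -> good d t).
  move=> d; have [[t dt]|nd] := pselect (exists t, good d t).
    by exists t; split=> //; case: dt.
  by exists 1; split; [apply: subgroup1|].
exists (map r l); split=> [_ /mapP [d _ ->]|x Kx cx]; first by case: (rP d).
pose xx := insubg cx; pose d := phi xx.
have dl : d \in l.
  suff : primary_component p (quotient M) d by rewrite lE.
  have [e xe] := KNp Kx; exists e; rewrite /d -gmulfXn.
  apply/(quo_eq1n _ nM); exists (xx ^+ (p ^ e)) => //.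
  by rewrite /mkset -subg_inclE gmulfXn.
have [|_ [y yt yd]] := (rP d).2; first by exists x; split=> //; exists xx.
exists (r d); first exact: map_f.
move: (yd) => /(quo_eqP _ _ nM); rewrite -gmulfV -gmulfM => -[u Nu /(quo_eqP _ _ nS) Su].
exists (val u) => //; move: Su; rewrite /S /mkset -subg_inclE.
by rewrite !(gmulfM, gmulfV) /= !mkhomE yt.
Qed.

Lemma bounded_series_sections :
  exists T : seq X, forall x, K x -> exists2 t, t \in T & N (t^-1 * x).
Proof.
have [c0 cnT _ _ _] := cc.
suff IH k : (k <= n)%N -> exists T : seq X, (forall t, t \in T -> K t) /\
    forall x, K x -> c k x -> exists2 t, t \in T & N (t^-1 * x).
  have [T [_ TP]] := IH n (leqnn n).
  by exists T => x Kx; apply: TP; rewrite ?cnT.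
elim: k => [_|k IHk kn].
  exists [:: 1]; split=> [t|x _]; first by rewrite inE => /eqP ->; apply: subgroup1.
  rewrite c0 => ->; exists 1; first by rewrite inE.
  by rewrite mulVg; apply: subgroup1.
have [T [TK TP]] := IHk (ltnW kn); have [s [sK' sP]] := bounded_series_step kn.
exists [seq x * y | x <- s, y <- T]; split=> [_ /allpairsP [[x y] /= [xs yT ->]]|x Kx cx].
  by apply: subgroupM; [|apply: sK'|apply: TK].
have [t ts [u Nu cy]] := sP _ Kx cx.
have [|t' t'T Nt'] := TP _ _ cy.
  by apply: subgroupM => //; [|apply: subgroupM => //]; apply: subgroupV => //; [apply: NK|apply: sK'].
exists (t * t'); first by apply/allpairsP; exists (t, t').
(* Here x = t u y and y = t' n with n in [N]; moving u past t' turns it into u ^ t', still in [N]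
   because t' is in [K]. *)
rewrite (_ : _ * x = u ^ t' * (t'^-1 * (u^-1 * (t^-1 * x)))).
  by apply: subgroupM => //; apply: NJ => //; apply: TK.
by rewrite /conjg !gnorm.
Qed.

End BoundedNilpotent.

Lemma class_BN_sections (P : set nat) p (X : groupType) :
  P p -> class_BN P X -> finite_sections p X.
Proof.
by move=> Pp [n [c [cc cP]]] K N sK sN NK NJ KNp; apply: (bounded_series_sections cc cP Pp).
Qed.

Lemma class_BN_nilpotent (P : set nat) (X : groupType) :
  class_BN P X -> nilpotent_group X.
Proof. by move=> [n [c [cc _]]]; exists n, c. Qed.

Lemma finite_sections_surj p (X Y : groupType) (f : hom X Y) :
  range f = [set: Y] -> finite_sections p X -> finite_sections p Y.
Proof.
move=> /surjP fT fX K N sK sN NK NJ KNp.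
have [||x /NK //|x y Nx Ky|x Kx|T TP] := fX (f @^-1` K) (f @^-1` N).
- exact: preimage_subgroup.
- exact: preimage_subgroup.
- by rewrite /preimage /mkset gmulfJ; apply: NJ.
- by have [e xe] := KNp _ Kx; exists e; rewrite /preimage /mkset gmulfXn.
exists (map f T) => y Ky; have [x xy] := fT y; subst y.
have [t tT Nt] := TP _ Ky; exists (f t); first exact: map_f.
by move: Nt; rewrite /preimage /mkset gmulfM gmulfV.
Qed.

Lemma expg_eq_diff (X : groupType) (x : X) a b :
  x ^+ a = x ^+ b -> x ^+ (maxn a b - minn a b) = 1.
Proof.
by case: (leqP a b) => [ab|/ltnW ab] E; rewrite expgnFr // E mulgV.
Qed.

Lemma generated1 (X : groupType) (w y : X) :
  generated [set w] y -> exists a b, y = w ^+ a / w ^+ b.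
Proof.
suff: generated [set w] `<=` [set y | exists a b, y = w ^+ a / w ^+ b] by apply.
apply: generated_sub => [|_ ->]; last first.
  by exists 1%N, 0%N; rewrite divg1.
split=> [|_ _ [a [b ->]] [c [d ->]]]; first by exists 0%N, 0%N; rewrite divg1.
exists (a + d)%N, (c + b)%N; rewrite invgF !expgnDr invgM -!mulgA; congr (_ * _).
by rewrite [LHS]mulgA [RHS]mulgA; congr (_ * _); apply/commute_sym/commuteV/commuteX2.
Qed.

Lemma expg_coprime (X : groupType) (x : X) m n :
  (0 < m)%N -> coprime m n -> x ^+ m = 1 -> x ^+ n = 1 -> x = 1.
Proof.
move=> m0 cmn xm xn; have [k ok km] := is_order_ex m0 xm.
have kn := is_order_dvdn ok xn.
have : k %| gcdn m n by rewrite dvdn_gcd km.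
by rewrite (eqP cmn) dvdn1 => /eqP k1; case: ok; rewrite k1 expg1.
Qed.

(** * Separation of elements by finite p-quotients *)

Section ResiduallyP.
Variables (p : nat) (X : groupType).
Hypotheses (pp : prime p) (nilX : nilpotent_group X) (secX : finite_sections p X).

Lemma maximal_avoiding (N : set X) x : normal N -> ~ N x ->
  exists K : set X, [/\ normal K, N `<=` K, ~ K x &
    forall K', normal K' -> K `<=` K' -> ~ K' x -> K' `<=` K].
Proof.
move=> nN Nx.
pose Q (K : set X) := K = set0 \/ [/\ normal K, N `<=` K & ~ K x].
have [|K [QK Kmax]] := @Zorn_bigcup X Q.
  move=> F FQ Ftot; have [[K FK [k Kk]]|F0] := pselect (exists2 K, F K & K !=set0).
    right; have FE K' y : F K' -> K' y -> [/\ normal K', N `<=` K' & ~ K' x].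
      by move=> /FQ [->|].
    split.
    - have [[[K1 _] _] _ _] := FE _ _ FK Kk.
      split; first split; first by exists K.
        move=> y z [K' FK' K'y] [K'' FK'' K''z].
        have [[sK' _] _ _] := FE _ _ FK' K'y; have [[sK'' _] _ _] := FE _ _ FK'' K''z.
        have [sub|sub] := Ftot _ _ FK' FK''.
          by exists K'' => //; apply: subgroupF => //; apply: sub.
        by exists K' => //; apply: subgroupF => //; apply: sub.
      move=> y z [K' FK' K'y]; exists K' => //.
      by have [[_ K'J] _ _] := FE _ _ FK' K'y; apply: K'J.
    - by have [_ NK _] := FE _ _ FK Kk; move=> y /NK Ky; exists K.
    by move=> [K' FK' K'x]; have [_ _] := FE _ _ FK' K'x.
  left; apply/seteqP; split=> // y [K FK Ky]; apply: F0.
  by exists K => //; exists y.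
case: QK => [K0|[nK NK Kx]].
  exfalso; apply: (Kmax N); last by right; split.
  by rewrite K0; split=> // /(_ 1); apply; apply: subgroup1; case: nN.
exists K; split=> // K' nK' KK' K'x; apply: contrapT => nsub.
by apply: (Kmax K'); [split|right; split=> //; apply: subset_trans KK'].
Qed.

(* For K maximal among the normal subgroups over N avoiding x, every nontrivial
   central element of X/K has x as a power.  So the centre of X/K is a p-group,
   hence finite, and X/K has p-power exponent because it is nilpotent. *)
Lemma residual_p (N : set X) x m : normal N -> ~ N x -> N (x ^+ (p ^ m)) ->
  exists (Z : groupType) (s : hom X Z), [/\ class_F p Z, N `<=` kernel s & s x <> 1].
Proof.
move=> nN Nx Nxm; have [K [nK NK Kx Kmax]] := maximal_avoiding nN Nx.
pose Y : groupType := quotient K; pose s : hom X Y := quo_pi K.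
have sT : range s = [set: Y] by apply: quo_pi_surj.
have s1 u : s u = 1 <-> K u by apply: quo_eq1n.
have sx1 : s x <> 1 by move=> /s1.
have sxm : s x ^+ (p ^ m) = 1 by rewrite -gmulfXn; apply/s1/NK.
have central_gen (z : Y) : (forall y, [~ z, y] = 1) -> z <> 1 ->
    exists a b, s x = z ^+ a / z ^+ b.
  move=> zC z1; apply: generated1; apply: contrapT => gx.
  have [w wz] := (surjP s).1 sT z; apply: z1; rewrite -wz; apply/s1.
  apply: (Kmax (s @^-1` generated [set z])) => //.
  - apply: preimage_normal; apply: generated_normal => _ y ->.
    exact/conjg_fixP/eqP/zC.
  - by move=> u /s1 su; rewrite /preimage /mkset su; apply: subgroup1; apply: generated_group.
  by rewrite /preimage /mkset wz; apply: sub_generated.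
have central_p (z : Y) : (forall y, [~ z, y] = 1) -> exists e, z ^+ (p ^ e) = 1.
  move=> zC; have [->|/eqP z1] := eqVneq z 1; first by exists 0%N.
  have [a [b xz]] := central_gen z zC z1.
  have ab : s x ^+ (p ^ m) = z ^+ (a * p ^ m) / z ^+ (b * p ^ m).
    by rewrite xz expgnFl ?expgnA //; apply: commuteX2.
  have {ab} zab : z ^+ (a * p ^ m) = z ^+ (b * p ^ m) by apply: divg1_eq; rewrite -ab.
  have nab : a <> b by move=> E; apply: sx1; rewrite xz E mulgV.
  have pm0 : (0 < p ^ m)%N by rewrite expn_gt0 prime_gt0.
  have := expg_eq_diff zab; set n := (_ - _)%N => zn.
  have n0 : (0 < n)%N.
    rewrite subn_gt0 gtn_min !leq_max !ltnn /= orbF -neq_ltn eqn_pmul2r //.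
    exact/eqP.
  (* Since z^n = 1, the element [w] has order dividing q, which is prime to p. If w were nontrivial,
     s x would be a quotient of powers of w; its order would divide both q and p^m, so s x would be
     1. *)
  have [q cq nE] := pfactor_coprime pp n0; set w := z ^+ (p ^ logn p n).
  have wq : w ^+ q = 1 by rewrite /w -expgnA mulnC -nE.
  exists (logn p n); apply: contrapT => w1.
  have [|//|a' [b' xw]] := central_gen w.
    by move=> y; apply/eqP/commgP/commute_sym/commuteX/commute_sym/commgP/eqP.
  apply: sx1; apply: (@expg_coprime _ _ (p ^ m) q) => //; first by rewrite coprimeXl.
  rewrite xw expgnFl; last exact: commuteX2.
  by rewrite ![w ^+ _ ^+ q]expgnAC wq !expg1n divg1.
have nilY : nilpotent_group Y := nilpotent_surj sT nilX.
(* The centre of X/K consists of elements of p-power order, so [secX] applies to its preimage over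
   [K]: finitely many representatives have a common exponent. *)
have [e eP] : exists e, forall z : Y, (forall y, [~ z, y] = 1) -> z ^+ (p ^ e) = 1.
  pose Kc := s @^-1` upper_central Y 1.
  have sKc : subgroup Kc by apply/preimage_subgroup; case: (upper_central_normal Y 1).
  have [||u ucent|T TP] := secX sKc (proj1 nK).
  - by move=> u Ku y; rewrite (s1 u).2 // comm1g.
  - by move=> u v Ku _; case: nK => _; apply.
  - by have [e ue] := central_p _ ucent; exists e; apply/s1; rewrite gmulfXn.
  have [e eT] : exists e, forall t, t \in T -> Kc t -> s t ^+ (p ^ e) = 1.
    elim: T {TP} => [|t T [e eT]]; first by exists 0%N.
    have [ct|nct] := pselect (Kc t); last first.
      by exists e => u; rewrite inE => /predU1P [->|/eT].
    have [e' te'] := central_p _ ct; exists (maxn e e') => u.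
    rewrite inE => /predU1P [-> _|uT uc]; first exact: expg_pow_le (leq_maxr _ _) te'.
    exact: expg_pow_le (leq_maxl _ _) (eT _ uT uc).
  exists e => z zC; have [u uz] := (surjP s).1 sT z.
  have [|t tT Kt] := TP u; first by move=> y; rewrite uz; apply: zC.
  have st : s t = s u by apply/(quo_eqP _ _ nK).
  by rewrite -uz -st; apply: eT => // y; rewrite st uz; apply: zC.
have [k Yk] := (nilpotentP Y).1 nilY.
have Yexp (y : Y) : y ^+ (p ^ (e * k)) = 1.
  by rewrite expnM; apply: (upper_central_exponent eP); rewrite Yk.
exists Y, s; split=> //; last by move=> u /NK /s1.
apply: class_F_intro => //; last by move=> y; exists (e * k)%N.
have [sKK KJ] := nK.
have [|//|u v Ku _|u _|T TP] := @secX setT K _ sKK; [by []|exact: KJ| |].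
  by exists (e * k)%N; apply/s1; rewrite gmulfXn.
apply: (@sub_finite_set _ _ [set` map s T]); last exact: finite_seq.
move=> y _; have [u uy] := (surjP s).1 sT y; have [//|t tT Kt] := TP u.
by apply/mapP; exists t => //; rewrite -uy; apply/esym/(quo_eqP _ _ nK).
Qed.

End ResiduallyP.

Lemma expg_prime_order (X : groupType) (x : X) n p :
  is_order x n -> prime p -> p %| n -> x ^+ (n %/ p) <> 1 /\ x ^+ (n %/ p) ^+ p = 1.
Proof.
move=> [n0 xn nmin] pp pn; split=> [E|]; last by rewrite -expgnA divnK.
have := nmin _ _ E; rewrite divn_gt0 ?prime_gt0 // dvdn_leq // => /(_ isT).
by rewrite leqNgt ltn_Pdiv // prime_gt1.
Qed.

Lemma residual_p_element (X : groupType) p (x : X) :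
  prime p -> nilpotent_group X -> finite_sections p X -> x <> 1 -> x ^+ p = 1 ->
  exists (Z : groupType) (s : hom X Z), class_F p Z /\ s x <> 1.
Proof.
move=> pp nX fX x1 xp; have [|Z [s [FZ _ sx]]] := residual_p pp nX fX (normal_1 X) x1 (m := 1).
  by rewrite expn1.
by exists Z, s.
Qed.

Lemma class_FN_residual_F (P : set nat) (X : groupType) (x : X) :
  class_FN P X -> x <> 1 ->
  exists p, [/\ prime p, P p &
    exists (Z : groupType) (s : hom X Z), class_F p Z /\ s x <> 1].
Proof.
move=> [fX nX pX] x1; have [n xn nP] := pX x.
have n1 : (1 < n)%N.
  have [n0 xn1 _] := xn; rewrite ltn_neqAle n0 andbT.
  by apply: contra_notN x1 => /eqP E; move: xn1; rewrite -E.
have pp := pdiv_prime n1; exists (pdiv n); split=> //; first by apply: nP; rewrite ?pdiv_dvd.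
have [y1 yp] := expg_prime_order xn pp (pdiv_dvd n).
have [Z [s [FZ sy]]] := residual_p_element pp nX (finite_sections_finite fX) y1 yp.
by exists Z, s; split=> // sx; apply: sy; rewrite gmulfXn sx expg1n.
Qed.

(** It is enough that some power of x survives. If a prime p of [P] divides the order of x, a power
    of x has order p; if x has infinite order, any prime of [P] will do. Only a finite order prime
    to [P] remains. *)
Lemma nilpotent_residual_F (P : set nat) (X : groupType) (x : X) :
  P `<=` [set p | prime p] -> P !=set0 -> nilpotent_group X ->
  (forall p, P p -> finite_sections p X) ->
  (exists2 n, (0 < n)%N /\ forall p, P p -> ~~ (p %| n) & x ^+ n = 1) \/
  exists p, [/\ prime p, P p &
    exists (Z : groupType) (s : hom X Z), class_F p Z /\ s x <> 1].
Proof.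
move=> Pp [p0 P0] nX fX.
have [[n [n0 xn]]|xinf] := pselect (exists n, (0 < n)%N /\ x ^+ n = 1).
  have [m xm _] := is_order_ex n0 xn; have [m0 xm1 _] := xm.
  have [[p pP pm]|nop] := pselect (exists2 p, P p & p %| m); last first.
    by left; exists m => //; split=> // p pP; apply/negP => pm; apply: nop; exists p.
  right; exists p; have pp := Pp _ pP; split=> //.
  have [y1 yp] := expg_prime_order xm pp pm.
  have [Z [s [FZ sy]]] := residual_p_element pp nX (fX _ pP) y1 yp.
  by exists Z, s; split=> // sx; apply: sy; rewrite gmulfXn sx expg1n.
right; exists p0; have pp := Pp _ P0; split=> //.
(* The last term of the upper central series that contains no positive power of x. Modulo it, y =
   x^m is central of infinite order, hence not in the normal subgroup generated by y^p0, whereas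
   y^p0 is: [residual_p] applies with exponent 1. *)
have [k [m m0 [Zxm Zmin]]] : exists k, exists2 m, (0 < m)%N & upper_central X k.+1 (x ^+ m) /\
    forall l, (0 < l)%N -> ~ upper_central X k (x ^+ l).
  have [n Xn] := (nilpotentP X).1 nX.
  have {Xn} : exists2 m, (0 < m)%N & upper_central X n (x ^+ m) by exists 1%N; rewrite ?Xn.
  elim: n => [[m m0 xm]|n IHn [m m0 Zxm]]; first by case: xinf; exists m.
  have [/IHn //|no] := pselect (exists2 m, (0 < m)%N & upper_central X n (x ^+ m)).
  by exists n, m => //; split=> // l l0 Zl; apply: no; exists l.
have nZ := upper_central_normal X k; set y := x ^+ m in Zxm *.
pose pi : hom X (quotient (upper_central X k)) := quo_pi (upper_central X k).
have yC z : [~ pi y, z] = 1.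
  have [u <-] := quo_surj z; rewrite -gmulfR; apply/(quo_eq1n _ nZ); exact: Zxm.
pose N := pi @^-1` generated [set pi y ^+ p0].
have nN : normal N.
  apply: preimage_normal; apply: generated_normal => _ z ->.
  by apply/conjg_fixP/commgP/commute_sym/commuteX/commute_sym/commgP/eqP.
have Ny : ~ N y.
  move=> /generated1 [a [b E]].
  have {}E : pi y ^+ (p0 * b).+1 = pi y ^+ (p0 * a).
    by rewrite expgS {1}E !expgnA mulgVK.
  have := expg_eq_diff E; set d := (_ - _)%N => yd.
  have d0 : (0 < d)%N.
    rewrite subn_gt0 gtn_min !leq_max !ltnn /= orbF -neq_ltn; apply/eqP => Eab.
    have := dvdn_mulr a (dvdnn p0); rewrite -Eab -addn1 dvdn_addr ?dvdn_mulr //.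
    by rewrite dvdn1 => /eqP p1; rewrite p1 in pp.
  apply: (Zmin (m * d)%N); first by rewrite muln_gt0 m0.
  rewrite expgnA -/y; apply/(quo_eq1n _ nZ); rewrite -yd; exact: (gmulfXn pi d y).
have [|Z [s [FZ _ sy]]] := residual_p pp nX (fX _ P0) nN Ny (m := 1).
  by rewrite /N /preimage /mkset expn1; apply: sub_generated; apply: (gmulfXn pi p0 y).
by exists Z, s; split=> // sx; apply: sy; rewrite gmulfXn sx expg1n.
Qed.

Section Combine.
Variable C : groupType -> Prop.
Hypothesis C_prod : forall X Y : groupType, C X -> C Y -> C (X * Y)%type.
Hypothesis C_triv : forall X : groupType, (forall x : X, x = 1) -> C X.

Lemma combine_homs (X : groupType) (N : set X) (l : seq X) :
  (forall x, x \in l -> exists (Z : groupType) (s : hom X Z),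
     [/\ C Z, N `<=` kernel s & s x <> 1]) ->
  exists (Z : groupType) (s : hom X Z),
    [/\ C Z, N `<=` kernel s & forall x, x \in l -> s x <> 1].
Proof.
elim: l => [|x l IHl] lP.
  pose E : groupType := subg [set (1 : X)]; exists E, (one_fun E : hom X E); split=> //.
  apply: C_triv => x; apply: val_inj; rewrite val1.
  exact: (subg_val x (proj1 (normal_1 X))).
have [|Z [s [CZ Ns sl]]] := IHl; first by move=> y yl; apply: lP; rewrite inE yl orbT.
have [Z' [s' [CZ' Ns' sx]]] := lP x (mem_head _ _).
exists (Z' * Z)%type, (pair_hom s' s); split; first exact: C_prod.
  by move=> y Ny; rewrite /kernel /preimage /mkset pair_homE Ns // Ns'.
by move=> y; rewrite inE => /predU1P [->|/sl sy] [].
Qed.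

End Combine.

Section NormalSubgroupQuotients.
Variables (H A L : groupType) (i : hom H A) (lam : hom A L) (P : set nat).
Hypotheses (iI : injective i) (nH : normal (range i)).
Hypothesis BNlam : class_BN P (subg (range lam)).
Hypothesis lamI : kernel lam `&` range i = [set 1].

Lemma kernel_meets_trivially h : lam (i h) = 1 -> h = 1.
Proof.
move=> E; apply: iI; rewrite gmulf1.
by have : [set 1] (i h) by rewrite -lamI; split=> //; exists h.
Qed.

Lemma normal_range_image k p : normal (i @` lower_pcentral p H k).
Proof.
split=> [|_ a [h Kh <-]].
  by apply: image_subgroup; case: (lower_pcentral_normal p H k).
have cJ h' : exists h'', i h'' = i h' ^ a.
  by have [|h'' _ E] := nH.2 (i h') a; [exists h'|exists h''].
have /choice [f fP] := cJ.
have fM : {morph f : x y / x * y}.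
  by move=> x y; apply: iI; rewrite gmulfM !fP gmulfM conjMg.
exists (f h); last exact: fP.
by rewrite -(mkhomE fM); apply: lower_pcentral_hom.
Qed.

(** Modulo the image [N] of K_m, the image of [H] consists of elements of p-power order, so
    [residual_p] separates those outside [N] from it. This section is finite, hence one product of
    finitely many p-quotients separates all of them, and its kernel meets [H] exactly in K_m. *)
Lemma finite_p_quotient p m : prime p -> P p ->
  exists (Z : groupType) (s : hom A Z),
    [/\ class_F p Z, range s = [set: Z], kernel lam `<=` kernel s
      & forall h, s (i h) = 1 <-> lower_pcentral p H m h].
Proof.
move=> pp Pp; pose X := subg (range lam); pose l : hom A X := corestr lam.
have lT : range l = [set: X] by apply: corestr_surj.
have nX : nilpotent_group X := class_BN_nilpotent BNlam.
have fX : finite_sections p X := class_BN_sections Pp BNlam.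
have lI h : l (i h) = 1 -> h = 1 by move=> /corestr_eq1 /kernel_meets_trivially.
have nK := lower_pcentral_normal p H m; set K := lower_pcentral p H m in nK *.
pose N := l @` (i @` K).
have nN : normal N by apply: image_normal => //; apply: normal_range_image.
have NE h : N (l (i h)) <-> K h.
  split=> [[_ [h' Kh' <-] /kernelP]|Kh]; last by exists (i h) => //; exists h.
  rewrite /kernel /preimage /mkset -gmulfV -gmulfM => /lI /mulg1_eq.
  by rewrite invgK => <-.
have [|||T TP] := fX (range (l \o i)) N (range_subgroup _) (proj1 nN).
- by move=> _ [_ [h Kh <-] <-]; exists h.
- by move=> x y Nx _; apply: nN.2.
- move=> _ [h _ <-]; exists m; rewrite -gmulfXn; apply/NE.
  exact: lower_pcentral_exponent.
pose T' := [seq t <- T | `[< exists h, ~ K h /\ N (t^-1 * l (i h)) >]].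
have [|Z [s [FZ Ns sT]]] := @combine_homs (class_F p) (class_F_prod pp) (class_F_triv pp) X N T'.
  move=> t; rewrite mem_filter => /andP [/asboolP [h [Kh Nth]] _].
  have [||Z [s [FZ Ns sh]]] := residual_p pp nX fX nN (x := l (i h)) (m := m).
  + by move=> /NE.
  + by rewrite -!gmulfXn; apply/NE/lower_pcentral_exponent.
  exists Z, s; split=> // st; apply: sh; move: (Ns _ Nth).
  by rewrite /kernel /preimage /mkset gmulfM gmulfV st invg1 mul1g.
have FZ' : class_F p (subg (range (s \o l))) by apply: class_F_range.
exists (subg (range (s \o l))), (corestr (s \o l)); split=> //.
- exact: corestr_surj.
- move=> a la; apply/corestr_eq1; rewrite /= (_ : l a = 1) ?gmulf1 //.
  exact/corestr_eq1.
move=> h; rewrite corestr_eq1 /=; split=> [sh|Kh]; last exact: (Ns _ ((NE h).2 Kh)).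
apply: contrapT => Kh; have [|t tT Nt] := TP (l (i h)); first by exists h.
apply: (sT t).
  by rewrite mem_filter tT andbT; apply/asboolP; exists h.
have := Ns _ Nt; rewrite /kernel /preimage /mkset gmulfM gmulfV sh mulg1 => E.
by rewrite -[s t]invgK E invg1.
Qed.

End NormalSubgroupQuotients.

(** * Amalgams over a normal subgroup *)

Section GfpUniversal.
Variables (H : Type) (A B : groupType) (f : H -> A) (g : H -> B).

Lemma gfp_ind (Q : gfp f g -> Prop) :
  Q 1 -> (forall x z, Q z -> Q (gfp_in1 f g x * z)) ->
  (forall y z, Q z -> Q (gfp_in2 f g y * z)) -> forall z, Q z.
Proof.
move=> Q1 QA QB z; have [w ->] := gfp_ex z; elim: w => [|[x|y] w IHw]; first exact: Q1.
  by have := QA x _ IHw; rewrite -[_ * _]/(gfp_mul _ _) gfp_mulE.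
by have := QB y _ IHw; rewrite -[_ * _]/(gfp_mul _ _) gfp_mulE.
Qed.

Variables (X : groupType) (a : hom A X) (b : hom B X).
Hypothesis ab : forall h, a (f h) = b (g h).

Definition gfp_hom : hom (gfp f g) X := mkhom (gfp_liftM ab).

Lemma gfp_hom1 x : gfp_hom (gfp_in1 f g x) = a x. Proof. exact: gfp_lift1. Qed.
Lemma gfp_hom2 y : gfp_hom (gfp_in2 f g y) = b y. Proof. exact: gfp_lift2. Qed.

End GfpUniversal.

Lemma autM (X : groupType) (a b : aut X) x : (a * b) x = b (a x). Proof. by []. Qed.

Section NormalAction.
Variables (H A : groupType) (i : hom H A).
Hypotheses (iI : injective i) (nH : normal (range i)).

Lemma conj_ex (a : A) (h : H) : exists h', i h' = i h ^ a.
Proof. by have [|h' _ E] := nH.2 (i h) a; [exists h|exists h']. Qed.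

Definition conj_fun (a : A) (h : H) : H := sval (cid (conj_ex a h)).

Lemma conj_funE a h : i (conj_fun a h) = i h ^ a.
Proof. by rewrite /conj_fun; case: cid. Qed.

Lemma conj_fun_morph a : {morph conj_fun a : x y / x * y}.
Proof. by move=> x y; apply: iI; rewrite gmulfM !conj_funE gmulfM conjMg. Qed.

Lemma conj_fun_bij a : bijective (conj_fun a).
Proof.
exists (conj_fun a^-1) => h; apply: iI; rewrite !conj_funE ?conjgK //.
by rewrite conjgKV.
Qed.

Definition conj_aut_fun a : aut H := Aut (@conj_fun_morph a) (conj_fun_bij a).

Lemma conj_aut_morph : {morph conj_aut_fun : x y / x * y}.
Proof.
by move=> x y; apply: aut_eq => h; apply: iI; rewrite /= !conj_funE conjgM.
Qed.

Definition conj_aut : hom A (aut H) := mkhom conj_aut_morph.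

Lemma conj_autE a h : i (conj_aut a h) = i h ^ a.
Proof. exact: conj_funE. Qed.

Definition coset_rep (q : quotient (range i)) : A := sval (cid (quo_surj q)).

Lemma coset_repK q : quo_pi (range i) (coset_rep q) = q.
Proof. by rewrite /coset_rep; case: cid. Qed.

Lemma coset_shift_ex (q : quotient (range i)) (a : A) :
  exists h, i h = (coset_rep (q * quo_pi (range i) a))^-1 * (coset_rep q * a).
Proof.
suff [h _ E] : range i ((coset_rep (q * quo_pi (range i) a))^-1 * (coset_rep q * a)).
  by exists h.
by apply/(quo_eqP _ _ nH); rewrite coset_repK gmulfM /= coset_repK.
Qed.

Definition coset_shift q a : H := sval (cid (coset_shift_ex q a)).

Lemma coset_shiftE q a :
  i (coset_shift q a) = (coset_rep (q * quo_pi (range i) a))^-1 * (coset_rep q * a).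
Proof. by rewrite /coset_shift; case: cid. Qed.

(* Right multiplication on A, written in the coordinates a = coset_rep q * i x. *)
Definition regular_act (a : A) (u : quotient (range i) * H) :
    quotient (range i) * H :=
  (u.1 * quo_pi (range i) a, coset_shift u.1 a * conj_aut a u.2).

Lemma regular_act1 u : regular_act 1 u = u.
Proof.
case: u => q x; rewrite /regular_act /= !gmulf1 mulg1; congr (_, _); apply: iI.
by rewrite gmulfM coset_shiftE gmulf1 conj_funE conjg1 !mulg1 mulVg mul1g.
Qed.

Lemma regular_actM a b u : regular_act (a * b) u = regular_act b (regular_act a u).
Proof.
case: u => q x; rewrite /regular_act /= gmulfM mulgA; congr (_, _); apply: iI.
rewrite !gmulfM !conj_funE gmulfM conj_funE !coset_shiftE.
by rewrite gmulfM /= /conjg !gnorm.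
Qed.

Lemma regular_act_sub h u : regular_act (i h) u = (u.1, u.2 * h).
Proof.
case: u => q x; rewrite /regular_act /=.
have -> : quo_pi (range i) (i h) = 1 by apply/(quo_eq1n _ nH); exists h.
rewrite mulg1; congr (_, _); apply: iI; rewrite !gmulfM conj_funE coset_shiftE.
have -> : quo_pi (range i) (i h) = 1 by apply/(quo_eq1n _ nH); exists h.
by rewrite mulg1 /conjg !gnorm.
Qed.

End NormalAction.

Section AmalgamRep.
Variables (H A B : groupType) (i : hom H A) (j : hom H B).
Hypotheses (iI : injective i) (jI : injective j).
Hypotheses (nA : normal (range i)) (nB : normal (range j)).
Let G := gfp i j.

Fact Theta_compat h : conj_aut iI nA (i h) = conj_aut jI nB (j h).
Proof.
apply: aut_eq => x; transitivity (x ^ h).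
  by apply: iI; rewrite conj_autE gmulfJ.
by apply: jI; rewrite conj_autE gmulfJ.
Qed.

(** Conjugation of G on [H]. It is built on [H] itself and not on its image in G, since the
    injectivity of H -> G is only obtained later, from [amalgam_rep]. *)
Definition Theta : hom G (aut H) := gfp_hom Theta_compat.

Lemma ThetaE g h : gfp_in1 i j (i (Theta g h)) = gfp_in1 i j (i h) ^ g.
Proof.
move: h; pattern g; apply: gfp_ind => {g} [|x z IH|y z IH] h.
- by rewrite gmulf1 conjg1.
- rewrite gmulfM autM IH.
  by rewrite gfp_hom1 conj_autE gmulfJ conjgM.
rewrite gmulfM autM IH.
by rewrite gfp_hom2 !gfp_in_amalgam conj_autE gmulfJ conjgM.
Qed.

Lemma amalgamated_normal : normal (gfp_amalgamated i j).
Proof.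
split=> [|_ g [_ [h _ <-] <-]]; first by apply: image_subgroup; apply: range_subgroup.
exists (i (Theta g h)); last exact: ThetaE.
by exists (Theta g h).
Qed.

Let QA := quotient (range i).
Let QB := quotient (range j).
Let T : Type := (QA * QB * H)%type.

(* A acts on the first and third coordinates as on A itself, B on the second and
   third as on B; on H both are right translation of the third coordinate. *)
Definition rep1_fun (a : A) (t : T) : T :=
  let u := regular_act iI nA a (t.1.1, t.2) in (u.1, t.1.2, u.2).
Definition rep2_fun (b : B) (t : T) : T :=
  let u := regular_act jI nB b (t.1.2, t.2) in (t.1.1, u.1, u.2).

Fact rep1_fun1 t : rep1_fun 1 t = t.
Proof. by case: t => [[q r] x]; rewrite /rep1_fun regular_act1. Qed.
Fact rep2_fun1 t : rep2_fun 1 t = t.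
Proof. by case: t => [[q r] x]; rewrite /rep2_fun regular_act1. Qed.
Fact rep1_funM a b t : rep1_fun (a * b) t = rep1_fun b (rep1_fun a t).
Proof. by rewrite /rep1_fun regular_actM. Qed.
Fact rep2_funM a b t : rep2_fun (a * b) t = rep2_fun b (rep2_fun a t).
Proof. by rewrite /rep2_fun regular_actM. Qed.

Fact rep_compat h : act_hom rep1_fun1 rep1_funM (i h) = act_hom rep2_fun1 rep2_funM (j h).
Proof.
apply: sym_eq => -[[q r] x].
by rewrite !act_homE /rep1_fun /rep2_fun !regular_act_sub.
Qed.

Definition amalgam_rep : hom G (sym T) := gfp_hom rep_compat.

Fact pr1_compat h : quo_pi (range i) (i h) = one_fun QA (j h).
Proof. by apply/(quo_eq1n _ nA); exists h. Qed.
Fact pr2_compat h : one_fun QB (i h) = quo_pi (range j) (j h).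
Proof. by apply/esym/(quo_eq1n _ nB); exists h. Qed.

Let pr1 : hom G QA := @gfp_hom _ _ _ _ _ _ (quo_pi (range i)) (one_fun QA) pr1_compat.
Let pr2 : hom G QB := @gfp_hom _ _ _ _ _ _ (one_fun QB) (quo_pi (range j)) pr2_compat.

Lemma amalgam_rep_sub h t : amalgam_rep (gfp_in1 i j (i h)) t = (t.1, t.2 * h).
Proof.
by case: t => [[q r] x]; rewrite gfp_hom1 act_homE /rep1_fun regular_act_sub.
Qed.

(** The fibre over (q, r) is mapped to a fibre by x |-> k * Theta g x with k independent of x. So a
    power of g that is trivial in A/H, in B/H and under [Theta] acts on each fibre as left
    translation by an element of [H], and its order is bounded by the exponent of [H]. *)
Lemma amalgam_repE g q r : exists k, forall x,
  amalgam_rep g (q, r, x) = (q * pr1 g, r * pr2 g, k * Theta g x).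
Proof.
move: q r; pattern g; apply: gfp_ind => {g} [|a z IH|b z IH] q r.
- by exists 1 => x; rewrite !gmulf1 !mulg1 mul1g.
- have [k kE] := IH (q * quo_pi (range i) a) r.
  exists (k * Theta z (coset_shift nA q a)) => x.
  rewrite gmulfM symM gfp_hom1 act_homE /rep1_fun /regular_act /= kE.
  rewrite !gmulfM !gfp_hom1 /= mul1g !mulgA.
  by congr (_, _, _).
have [k kE] := IH q (r * quo_pi (range j) b).
exists (k * Theta z (coset_shift nB r b)) => x.
rewrite gmulfM symM gfp_hom2 act_homE /rep2_fun /regular_act /= kE.
rewrite !gmulfM !gfp_hom2 /= mul1g !mulgA.
by congr (_, _, _).
Qed.

Lemma amalgam_rep_class_F p : prime p -> class_F p A -> class_F p B ->
  (forall g, exists m, Theta (g ^+ (p ^ m)) = 1) ->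
  class_F p (subg (range amalgam_rep)).
Proof.
move=> pp FA FB Tp.
have FH : class_F p H by apply: class_F_inj iI FA.
have FQA : class_F p QA by apply: class_F_surj FA => //; apply: quo_pi_surj.
have FQB : class_F p QB by apply: class_F_surj FB => //; apply: quo_pi_surj.
have fT : finite_set [set: sym T].
  by apply: finite_sym; apply: finite_prod; [apply: finite_prod|]; [case: FQA|case: FQB|case: FH].
apply: class_F_intro => //.
  by apply: (@finite_inj _ _ (subg_incl (range amalgam_rep))) => //; apply: val_inj.
move=> s; have [g _ gs] := subg_val s (range_subgroup _).
have [eA eAP] := class_F_exponent pp FQA; have [eB eBP] := class_F_exponent pp FQB.
have [eH eHP] := class_F_exponent pp FH; have [m Tm] := Tp g.
pose l := maxn m (maxn eA eB); pose g' := g ^+ (p ^ l).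
have pr1g : pr1 g' = 1.
  by rewrite gmulfXn; apply: expg_pow_le (eAP _); rewrite !leq_max leqnn orbT.
have pr2g : pr2 g' = 1.
  by rewrite gmulfXn; apply: expg_pow_le (eBP _); rewrite !leq_max leqnn !orbT.
have Tg : Theta g' = 1.
  rewrite gmulfXn; apply: (@expg_pow_le _ _ _ m); first by rewrite leq_max leqnn.
  by rewrite -gmulfXn.
exists (l + eH)%N; apply: val_inj; rewrite val1 -subg_inclE gmulfXn subg_inclE -gs.
rewrite -gmulfXn expnD expgnA -/g'; apply: sym_eq1 => -[[q r] x].
have [k kE] := amalgam_repE g' q r.
have E n y : amalgam_rep (g' ^+ n) (q, r, y) = (q, r, k ^+ n * y).
  elim: n y => [|n IHn] y; first by rewrite gmulf1 mul1g.
  rewrite expgS gmulfM symM kE pr1g pr2g Tg !mulg1 IHn mulgA -expgSr expgS.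
  by [].
by rewrite E eHP mul1g.
Qed.

End AmalgamRep.

(** In a finite p-group a prime r other than p is invertible on exponents, so x^r = 1 forces x = 1.
    Through this lemma the isolators [V(p)] and [W(p)] vanish in finite p-quotients. *)
Lemma class_F_isolated p (X Z : groupType) (s : hom X Z) :
  prime p -> class_F p Z -> isolated p (kernel s).
Proof.
move=> pp FZ; split=> [|r rp rNp x]; first by case: (kernel_normal s).
have [e Ze] := class_F_exponent pp FZ.
rewrite /kernel /preimage /mkset gmulfXn => sx.
apply: expg_coprime (Ze (s x)) sx; first by rewrite expn_gt0 prime_gt0.
by rewrite coprimeXl // prime_coprime // dvdn_prime2 // eq_sym.
Qed.

Section GfpMaps.
Variables (H A B : groupType) (i : hom H A) (j : hom H B).
Hypotheses (iI : injective i) (jI : injective j).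
Hypotheses (nA : normal (range i)) (nB : normal (range j)).

(** The element of [H] is read off from its action on the point (1, 1, 1). *)
Lemma gfp_in1_amalgam_inj : injective (gfp_in1 i j \o i).
Proof.
move=> x y /= E; have := amalgam_rep_sub iI jI nA nB x (1, 1, 1).
by rewrite E amalgam_rep_sub /= !mul1g => -[].
Qed.

Variables (Hb Ab Bb : groupType) (ib : hom Hb Ab) (jb : hom Hb Bb).
Variables (pi : hom H Hb) (sA : hom A Ab) (sB : hom B Bb).
Hypotheses (sAi : forall h, sA (i h) = ib (pi h)) (sBj : forall h, sB (j h) = jb (pi h)).

Fact gfp_map_compat h : gfp_in1 ib jb (sA (i h)) = gfp_in2 ib jb (sB (j h)).
Proof. by rewrite sAi sBj gfp_in_amalgam. Qed.

Definition gfp_map : hom (gfp i j) (gfp ib jb) :=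
  @gfp_hom _ _ _ _ _ _ (gfp_in1 ib jb \o sA) (gfp_in2 ib jb \o sB) gfp_map_compat.

Lemma gfp_map1 x : gfp_map (gfp_in1 i j x) = gfp_in1 ib jb (sA x).
Proof. exact: gfp_hom1. Qed.

Lemma gfp_map2 y : gfp_map (gfp_in2 i j y) = gfp_in2 ib jb (sB y).
Proof. exact: gfp_hom2. Qed.

Lemma gfp_map_surj : range sA = [set: Ab] -> range sB = [set: Bb] ->
  range gfp_map = [set: gfp ib jb].
Proof.
move=> /surjP sAT /surjP sBT; apply/surjP; apply: gfp_ind => [|x z [g gz]|y z [g gz]].
- by exists 1; rewrite gmulf1.
- by have [a ax] := sAT x; exists (gfp_in1 i j a * g); rewrite gmulfM gz gfp_map1 ax.
by have [b bY] := sBT y; exists (gfp_in2 i j b * g); rewrite gmulfM gz gfp_map2 bY.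
Qed.

End GfpMaps.

Section ThetaMap.
Variables (H A B : groupType) (i : hom H A) (j : hom H B).
Hypotheses (iI : injective i) (jI : injective j).
Hypotheses (nA : normal (range i)) (nB : normal (range j)).
Variables (Hb Ab Bb : groupType) (ib : hom Hb Ab) (jb : hom Hb Bb).
Hypotheses (ibI : injective ib) (jbI : injective jb).
Hypotheses (nAb : normal (range ib)) (nBb : normal (range jb)).
Variables (pi : hom H Hb) (sA : hom A Ab) (sB : hom B Bb).
Hypotheses (sAi : forall h, sA (i h) = ib (pi h)) (sBj : forall h, sB (j h) = jb (pi h)).

Lemma Theta_map g h :
  Theta ibI jbI nAb nBb (gfp_map sAi sBj g) (pi h) = pi (Theta iI jI nA nB g h).
Proof.
apply: (gfp_in1_amalgam_inj ibI jbI nAb nBb) => /=.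
rewrite ThetaE -!sAi -!(gfp_map1 sAi sBj) -gmulfJ; congr (gfp_map _ _ _).
exact/esym/ThetaE.
Qed.

End ThetaMap.

(** * Finite p-quotients of the amalgam that separate elements of H *)

Section Reduction.
Variables (H A B L M : groupType) (i : hom H A) (j : hom H B) (P : set nat).
Variables (lam : hom A L) (mu : hom B M).
Hypotheses (iI : injective i) (jI : injective j).
Hypotheses (nA : normal (range i)) (nB : normal (range j)).
Hypotheses (BNlam : class_BN P (subg (range lam))) (BNmu : class_BN P (subg (range mu))).
Hypotheses (lamI : kernel lam `&` range i = [set 1]).
Hypotheses (muI : kernel mu `&` range j = [set 1]).
Variable p : nat.
Hypotheses (pp : prime p) (Pp : P p).

Lemma induced_embedding (X : groupType) (f : hom H X) (K : set H) :
  normal K -> (forall h, f h = 1 <-> K h) ->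
  exists2 g : hom (quotient K) X, injective g & forall h, g (quo_pi K h) = f h.
Proof.
move=> nK fK; have [|g gE] := @quo_factor _ _ K f; first by move=> h /fK.
exists g => //; apply: gmulf_inj => x; have [h <-] := quo_surj x.
by rewrite gE => /fK Kh; apply/quo_eq1n.
Qed.

Section Level.
Variable m : nat.
Let K := lower_pcentral p H m.
Let nK : normal K := lower_pcentral_normal p H m.
Let Hb : groupType := quotient K.
Let pi : hom H Hb := quo_pi K.

Lemma reduction : exists (Ab Bb : groupType) (sA : hom A Ab) (sB : hom B Bb)
    (ib : hom Hb Ab) (jb : hom Hb Bb),
  [/\ [/\ class_F p Ab, range sA = [set: Ab], kernel lam `<=` kernel sA,
          injective ib & normal (range ib)],
      [/\ class_F p Bb, range sB = [set: Bb], kernel mu `<=` kernel sB,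
          injective jb & normal (range jb)],
      forall h, sA (i h) = ib (pi h) & forall h, sB (j h) = jb (pi h)].
Proof.
have [Ab [sA [FA sAT lA sAK]]] := finite_p_quotient iI nA BNlam lamI m pp Pp.
have [Bb [sB [FB sBT lB sBK]]] := finite_p_quotient jI nB BNmu muI m pp Pp.
have [ib ibI ibE] := @induced_embedding _ (sA \o i) K nK sAK.
have [jb jbI jbE] := @induced_embedding _ (sB \o j) K nK sBK.
have rng (X Y : groupType) (f : hom H X) (s : hom X Y) (t : hom Hb Y) :
    normal (range f) -> range s = [set: Y] -> (forall h, t (pi h) = s (f h)) ->
    normal (range t).
  move=> nf sT tE; rewrite (_ : range t = s @` range f); first exact: image_normal.
  apply/seteqP; split=> [_ [x _ <-]|_ [_ [h _ <-] <-]].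
    by have [h <-] := quo_surj x; exists (f h); [exists h|rewrite -tE].
  by exists (pi h); rewrite ?tE.
exists Ab, Bb, sA, sB, ib, jb; split.
- by split=> //; apply: (rng _ _ i sA).
- by split=> //; apply: (rng _ _ j sB).
- by move=> h; rewrite ibE.
by move=> h; rewrite jbE.
Qed.

(** [amalgam_rep] is applied to the amalgam of the finite p-quotients of [A] and [B] over H/K_m.
    There the requirement of [amalgam_rep_class_F] on [Theta] is precisely the stated condition
    modulo K_m. *)
Lemma separating_p_quotient :
  (forall g, exists l, trivial_mod K (Theta iI jI nA nB (g ^+ (p ^ l)))) ->
  exists (Z : groupType) (s : hom (gfp i j) Z),
    [/\ class_F p Z, range s = [set: Z] & forall h, s (gfp_in1 i j (i h)) = 1 -> K h].
Proof.
move=> TK; have [Ab [Bb [sA [sB [ib [jb [[FA sAT _ ibI nAb] [FB sBT _ jbI nBb] sAi sBj]]]]]]] := reduction.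
pose r := gfp_map sAi sBj; have rT := gfp_map_surj sAi sBj sAT sBT.
pose R := amalgam_rep ibI jbI nAb nBb.
have FR : class_F p (subg (range R)).
  apply: amalgam_rep_class_F => // gb; have [g <-] := (surjP r).1 rT gb.
  have [l gl] := TK g; exists l; apply: aut_eq => x; have [h <-] := quo_surj x.
  rewrite -gmulfXn Theta_map -[RHS]/(pi h).
  exact/esym/(quo_eqP _ _ nK)/gl.
exists (subg (range R)), (corestr R \o r); split=> //.
  exact: range_comp rT (corestr_surj R).
move=> h /corestr_eq1 E; apply/(quo_eq1n _ nK).
have := amalgam_rep_sub ibI jbI nAb nBb (pi h) (1, 1, 1).
by rewrite -sAi -(gfp_map1 sAi sBj) -/R E sym1 /= mul1g => -[].
Qed.

End Level.

Let U := power_derived p H.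
Let V := isolator p (set_prod (i @` U) (kernel lam)).
Let W := isolator p (set_prod (j @` U) (kernel mu)).
Let rho : hom (gfp i j) (gfp_quo i j V W) := gfp_rho i j V W.
Let Y := rho @` gfp_amalgamated i j.

Lemma isolator_sub (X Z : groupType) (f : hom H X) (k : set X) (s : hom X Z) :
  class_F p Z -> k `<=` kernel s ->
  (forall h, lower_pcentral p H 1 h -> s (f h) = 1) ->
  isolator p (set_prod (f @` U) k) `<=` kernel s.
Proof.
move=> FZ ks sf x; apply; split; first exact: class_F_isolated.
move=> _ [_ [u Uu <-] [v kv <-]]; rewrite /kernel /preimage /mkset gmulfM.
by rewrite (ks _ kv) sf ?mulg1 //; apply: power_derived_sub.
Qed.

Lemma rho_normal : normal Y.
Proof.
apply: image_normal; last exact: (amalgamated_normal iI jI nA nB).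
apply/surjP; apply: gfp_ind => [|x z [g gz]|y z [g gz]].
- by exists 1; rewrite gmulf1.
- have [a ax] := quo_surj x; exists (gfp_in1 i j a * g).
  by rewrite gmulfM gz -ax; congr (_ * _); apply: gfp_rho1.
have [b bY] := quo_surj y; exists (gfp_in2 i j b * g).
by rewrite gmulfM gz -bY; congr (_ * _); apply: gfp_rho2.
Qed.

(** At level 1 the isolators die in the finite quotients of [A] and [B], so the map [r] of G onto
    their amalgam factors as t \o rho. Conjugation by rho g has p-power order on [Y] by hypothesis,
    and t transports this to H/K_1. *)
Lemma Theta_p_power :
  prime_group [set p] (subg (aut_in Y)) ->
  forall g, exists l, trivial_mod (lower_pcentral p H 1) (Theta iI jI nA nB (g ^+ (p ^ l))).
Proof.
move=> /(prime_powP _ pp) pY g.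
have [Ab [Bb [sA [sB [ib [jb [[FA sAT lA ibI nAb] [FB sBT lB jbI nBb] sAi sBj]]]]]]] := reduction 1.
have nK := lower_pcentral_normal p H 1.
pose r := gfp_map sAi sBj.
have [|tA tAE] := @quo_factor _ _ V sA.
  apply: isolator_sub => // h Kh; rewrite sAi (_ : _ h = 1) ?gmulf1 //.
  exact/(quo_eq1n _ nK).
have [|tB tBE] := @quo_factor _ _ W sB.
  apply: isolator_sub => // h Kh; rewrite sBj (_ : _ h = 1) ?gmulf1 //.
  exact/(quo_eq1n _ nK).
have tAB h : gfp_in1 ib jb (tA (quo_pi V (i h))) = gfp_in2 ib jb (tB (quo_pi W (j h))).
  by rewrite tAE tBE; apply: gfp_map_compat.
pose t : hom (gfp_quo i j V W) (gfp ib jb) :=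
  @gfp_hom _ _ _ _ _ _ (gfp_in1 ib jb \o tA) (gfp_in2 ib jb \o tB) tAB.
have tr z : t (rho z) = r z.
  pattern z; apply: gfp_ind => {z} [|x z IH|y z IH]; first by rewrite !gmulf1.
    rewrite !gmulfM IH; congr (_ * _); rewrite (gfp_map1 sAi sBj) -[rho _]/(gfp_rho i j V W _).
    by rewrite gfp_rho1 gfp_hom1 /= tAE.
  rewrite !gmulfM IH; congr (_ * _); rewrite (gfp_map2 sAi sBj) -[rho _]/(gfp_rho i j V W _).
  by rewrite gfp_rho2 gfp_hom2 /= tBE.
have valI : injective (subg_incl Y) by apply: val_inj.
have nY : normal (range (subg_incl Y)).
  rewrite (_ : range _ = Y); first exact: rho_normal.
  apply/seteqP; split=> [_ [y _ <-]|y Yy]; last by exists (insubg Yy).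
  by apply: subg_val; case: rho_normal.
pose c := conj_aut valI nY.
have cin : aut_in Y (c (rho g)) by exists (rho g) => y; apply: (conj_autE valI nY).
have [l /(congr1 val)] := pY (insubg cin).
rewrite val1 -subg_inclE gmulfXn subg_inclE insubgK -!gmulfXn => cl.
exists l => h; apply/(quo_eqP _ _ nK); apply: (gfp_in1_amalgam_inj ibI jbI nAb nBb).
rewrite /= -!sAi -!(gfp_map1 sAi sBj) -/r ThetaE -!tr.
have Yh : Y (rho (gfp_in1 i j (i h))).
  by exists (gfp_in1 i j (i h)) => //; exists (i h) => //; exists h.
have := conj_autE valI nY (rho (g ^+ (p ^ l))) (insubg Yh).
by rewrite -/c cl => E; congr (t _); rewrite gmulfJ; apply: E.
Qed.

Lemma separating_hom m :
  prime_group [set p] (subg (aut_in Y)) ->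
  exists (Z : groupType) (s : hom (gfp i j) Z),
    [/\ class_F p Z, range s = [set: Z]
      & forall h, s (gfp_in1 i j (i h)) = 1 -> lower_pcentral p H m h].
Proof.
move=> pY; apply: separating_p_quotient => g.
have [l0 gl0] := Theta_p_power pY g.
have [l gl] := trivial_mod_pow m gl0.
by exists (l0 + l)%N; rewrite expnD expgnA gmulfXn.
Qed.

End Reduction.

(** * Free products *)

Definition free_prod (X Y : groupType) : groupType := gfp (of_void X) (of_void Y).

Section FreeProduct.
Variables X Y : groupType.
Local Notation letter := (X + Y)%type.
Implicit Types (s t r : letter) (w v : seq letter).

Definition lside s : bool := if s is inl _ then true else false.
Definition ltriv s : bool := match s with inl x => x == 1 | inr y => y == 1 end.
Definition lmul s t : option letter :=
  match s, t with
  | inl x, inl x' => Some (inl (x * x'))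
  | inr y, inr y' => Some (inr (y * y'))
  | _, _ => None
  end.

Definition reduced w : bool :=
  sorted (fun s t => lside s != lside t) w && all (fun s => ~~ ltriv s) w.

Definition lcons s w := if ltriv s then w else s :: w.

(** Left multiplication by a letter, on reduced words. By van der Waerden's method, that these maps
    respect the relations ([lactM], [lact1]) gives the uniqueness of reduced forms. *)
Definition lact s w :=
  if w is t :: w' then if lmul s t is Some u then lcons u w' else lcons s w
  else lcons s w.

Definition wact w u := foldr lact u w.

Lemma lmul_side s t : lside s = lside t -> exists u, lmul s t = Some u.
Proof. by case: s t => x [] y //= _; eexists. Qed.

Lemma lmul_sideN s t : lside s != lside t -> lmul s t = None.
Proof. by case: s t => x []. Qed.

Lemma lmul_lside s t u : lmul s t = Some u -> lside u = lside s /\ lside u = lside t.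
Proof. by case: s t => x [] y //= [<-]. Qed.

Lemma reduced_cons s w :
  reduced (s :: w) = [&& ~~ ltriv s, reduced w &
    (if w is t :: _ then lside s != lside t else true)].
Proof.
case: w => [|t w]; first by rewrite /reduced /= !andbT.
by rewrite /reduced /=; case: (lside s != _); case: (ltriv s); rewrite ?andbF ?andbT.
Qed.

Lemma reduced_lact s w : reduced w -> reduced (lact s w).
Proof.
case: w => [_|t w]; rewrite /lact /lcons.
  by case: ifP => // /negbT st; rewrite reduced_cons st.
have [st|st] := eqVneq (lside s) (lside t); last first.
  rewrite (lmul_sideN st) => rw; case: ifP => // /negbT s1.
  by rewrite reduced_cons s1 rw.
have [u uE] := lmul_side st; rewrite uE reduced_cons => /and3P [_ rw tw].
case: ifP => // /negbT u1; rewrite reduced_cons u1 rw /=.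
by case: w tw {rw} => // r w; have [_ ->] := lmul_lside uE.
Qed.

Lemma reduced_wact w u : reduced u -> reduced (wact w u).
Proof. by move=> ru; elim: w => //= s w; apply: reduced_lact. Qed.

Lemma lact_reduced s w : reduced (s :: w) -> lact s w = s :: w.
Proof.
rewrite reduced_cons => /and3P [s1 _]; rewrite /lact /lcons (negPf s1).
by case: w => // t w /lmul_sideN ->.
Qed.

Lemma wact_reduced w : reduced w -> wact w [::] = w.
Proof.
elim: w => //= s w IHw rsw; rewrite IHw ?lact_reduced //.
by move: rsw; rewrite reduced_cons => /and3P [].
Qed.

Lemma lmulA s t r u (v : letter) : lmul s t = Some u -> lmul t r = Some v -> lmul s v = lmul u r.
Proof. by case: s t r => x [] y [] z //= [<-] [<-] /=; rewrite mulgA. Qed.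

Lemma lmul_triv s t u : lmul s t = Some u -> ltriv t -> u = s.
Proof. by case: s t => x [] y //= [<-] /eqP ->; rewrite mulg1. Qed.

Lemma lactM s t u w : lmul s t = Some u -> reduced w -> lact s (lact t w) = lact u w.
Proof.
move=> stu; have [us ut] := lmul_lside stu.
have lcl (v : seq letter) : (if v is r :: _ then lside t != lside r else true) ->
    lact s (lcons t v) = lcons u v.
  rewrite /lcons; case: ifP => [t1|t1] vt; last by rewrite /= stu /lcons.
  rewrite (lmul_triv stu t1) /lact /lcons; case: v vt => // r v.
  by rewrite -ut us => /lmul_sideN ->.
case: w => [|r w]; first by move=> _; apply: lcl.
have [tr|tr] := eqVneq (lside t) (lside r); last first.
  by move=> _; rewrite /lact (lmul_sideN tr) -/(lact s _) lcl // lmul_sideN // ut.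
have [v vE] := lmul_side tr; rewrite reduced_cons => /and3P [r1 rw rwt].
have vs : lside s = lside v by rewrite -us ut tr; have [_ ->] := lmul_lside vE.
have [u' u'E] := lmul_side vs.
rewrite /= vE -(lmulA stu vE) u'E {1}/lcons; case: ifP => v1; first last.
  by rewrite /lact u'E.
rewrite (lmul_triv u'E v1) /lact; case: w rw rwt => // r' w _ rr'.
by rewrite lmul_sideN // -us ut tr.
Qed.

Lemma lact1 s w : ltriv s -> reduced w -> lact s w = w.
Proof.
move=> s1; rewrite /lact /lcons s1; case: w => // t w.
have [st|/lmul_sideN -> //] := eqVneq (lside s) (lside t).
rewrite reduced_cons => /and3P [t1 _ _].
by case: s t s1 st t1 => x [] y //= /eqP -> _ t1; rewrite mul1g (negPf t1).
Qed.

Lemma gfp_eq_wact w v : gfp_eq (of_void X) (of_void Y) w v ->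
  forall u, reduced u -> wact w u = wact v u.
Proof.
elim=> {w v} //.
- by move=> w v _ E u ru; rewrite E.
- by move=> w1 w2 w3 _ E1 _ E2 u ru; rewrite E1 ?E2.
- move=> w1 w2 v1 v2 _ E1 _ E2 u ru; rewrite /wact !foldr_cat.
  by rewrite -/(wact v1 u) -/(wact v2 u) E2 //; apply: E1; apply: reduced_wact.
- by move=> u ru; rewrite /= lact1 //= eqxx.
- by move=> u ru; rewrite /= lact1 //= eqxx.
- by move=> x y u ru; apply: lactM.
by move=> x y u ru; apply: lactM.
Qed.

Definition wprod w : free_prod X Y := \pi_(gfp (of_void X) (of_void Y))%qT w.

Lemma wprod_nil : wprod [::] = 1. Proof. by []. Qed.

Lemma wprod_cat w v : wprod (w ++ v) = wprod w * wprod v.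
Proof. exact/esym/gfp_mulE. Qed.

Lemma wprod_cons s w : wprod (s :: w) = wprod [:: s] * wprod w.
Proof. exact: (wprod_cat [:: s]). Qed.

Lemma wprod_inv w : wprod (word_inv w) = (wprod w)^-1.
Proof. exact/esym/gfp_invE. Qed.

Lemma wprod_inl x : wprod [:: inl x] = gfp_in1 (of_void X) (of_void Y) x.
Proof. by []. Qed.

Lemma wprod_inr y : wprod [:: inr y] = gfp_in2 (of_void X) (of_void Y) y.
Proof. by []. Qed.

Lemma wprod_lmul s t u : lmul s t = Some u -> wprod [:: s] * wprod [:: t] = wprod [:: u].
Proof.
case: s t => x [] y //= [<-]; rewrite ?wprod_inl ?wprod_inr;
  by [rewrite -(gmulfM (gfp_in1 _ _))|rewrite -gmulfM].
Qed.

Lemma wprod_ltriv s : ltriv s -> wprod [:: s] = 1.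
Proof. by case: s => x /= /eqP ->; rewrite ?wprod_inl ?wprod_inr gmulf1. Qed.

Lemma wprod_lact s w : wprod (lact s w) = wprod [:: s] * wprod w.
Proof.
have lc t v : wprod (lcons t v) = wprod [:: t] * wprod v.
  by rewrite /lcons; case: ifP => [/wprod_ltriv ->|_]; rewrite ?mul1g // -wprod_cons.
case: w => [|t w]; first exact: lc.
rewrite /lact; case E: (lmul s t) => [u|]; last exact: lc.
by rewrite lc -(wprod_lmul E) (wprod_cons t w) mulgA.
Qed.

Lemma reduced_form (z : free_prod X Y) : exists2 w, reduced w & z = wprod w.
Proof.
have [w ->] := gfp_ex z; exists (wact w [::]); first exact: reduced_wact.
rewrite -[LHS]/(wprod w); elim: w => //= s w IHw.
by rewrite wprod_lact -IHw -wprod_cons.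
Qed.

(** A reduced word is recovered from its product by acting on the empty word. *)
Lemma reduced_form_inj w v : reduced w -> reduced v -> wprod w = wprod v -> w = v.
Proof.
move=> rw rv /gfp_piP /gfp_eq_wact /(_ [::] isT).
by rewrite !wact_reduced.
Qed.

End FreeProduct.

Section Commuting.
Variables X Y : groupType.
Local Notation letter := (X + Y)%type.
Implicit Types (s t r : letter) (w v : seq letter).

Lemma reduced_cat w v s t : reduced (rcons w s) -> reduced (t :: v) ->
  lside s != lside t -> reduced (rcons w s ++ t :: v).
Proof.
rewrite /reduced !all_cat => /andP [pw ->] /andP [pv ->] st; rewrite !andbT.
case: w pw => [_|r w] /=; first by rewrite /= st.
by rewrite cat_path rcons_path last_rcons /= => ->; rewrite st.
Qed.

Lemma lside_inv s : lside (letter_inv s) = lside s. Proof. by case: s. Qed.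
Lemma ltriv_inv s : ltriv (letter_inv s) = ltriv s.
Proof. by case: s => x /=; rewrite invg_eq1. Qed.

Lemma reduced_inv w : reduced w -> reduced (word_inv w).
Proof.
rewrite /reduced /word_inv rev_sorted all_rev sorted_map all_map => /andP [sw aw].
apply/andP; split; last by apply: sub_all aw => s; rewrite /= ltriv_inv.
by apply: sub_sorted sw => s t /=; rewrite !lside_inv eq_sym.
Qed.

Lemma word_inv_cons s w : word_inv (s :: w) = rcons (word_inv w) (letter_inv s).
Proof. by rewrite /word_inv map_cons rev_cons. Qed.

Lemma word_inv_rcons s w : word_inv (rcons w s) = letter_inv s :: word_inv w.
Proof. by rewrite /word_inv map_rcons rev_rcons. Qed.

Definition wlast w := if w is s :: w' then Some (lside (last s w')) else None.
Definition whead w := if w is s :: _ then Some (lside s) else None.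

Lemma wlast_rcons w s : wlast (rcons w s) = Some (lside s).
Proof. by case: w => //= r w; rewrite last_rcons. Qed.

Lemma wprod1 s : wprod [:: letter_inv s] = (wprod [:: s])^-1.
Proof. by rewrite -wprod_inv. Qed.

Lemma reduced1 s : reduced [:: s] = ~~ ltriv s. Proof. by rewrite /reduced /= andbT. Qed.

(** Both w s^-1 w s and s^-1 w s w are reduced as written, and their first letters lie on different
    sides. *)
Lemma same_ends_not_commute c w s : reduced w -> whead w = Some c -> wlast w = Some c ->
  ~~ ltriv s -> lside s = ~~ c -> ~ commute (wprod w) (wprod w ^ wprod [:: s]).
Proof.
case: w => // t v rw [tc] lc s1 sc.
have [v' [r [wE rc]]] : exists v' r, t :: v = rcons v' r /\ lside r = c.
  by exists (belast t v), (last t v); rewrite -lastI; case: lc.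
have rs' : reduced [:: letter_inv s] by rewrite reduced1 ltriv_inv.
have rs : reduced [:: s] by rewrite reduced1.
have r1 : reduced (letter_inv s :: t :: v).
  by apply: (@reduced_cat [::] _ _ _ rs' rw); rewrite lside_inv sc tc; case: (c).
have r2 : reduced (rcons v' r ++ letter_inv s :: t :: v).
  by apply: reduced_cat => //; rewrite -?wE // rc lside_inv sc; case: (c).
have r3 : reduced ((rcons v' r ++ letter_inv s :: t :: v) ++ [:: s]).
  have eq_rcons : rcons v' r ++ letter_inv s :: t :: v =
      rcons (rcons v' r ++ letter_inv s :: v') r by rewrite wE -rcons_cons -rcons_cat.
  rewrite eq_rcons in r2 *.
  by apply: reduced_cat => //; rewrite rc sc; case: (c).
have r4 : reduced (letter_inv s :: t :: (v ++ s :: t :: v)).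
  apply: (@reduced_cat [::]) => //; last by rewrite /= lside_inv sc tc; case: (c).
  have rsw : reduced (s :: t :: v).
    by apply: (@reduced_cat [::] _ _ _ rs rw); rewrite sc tc; case: (c).
  rewrite -cat_cons wE -wE; rewrite {1}wE; apply: reduced_cat => //; first by rewrite -wE.
  by rewrite rc sc; case: (c).
rewrite -wE -catA in r3; rewrite /commute => E.
have ts : t <> letter_inv s.
  by move=> ts; move: sc; rewrite -lside_inv -ts tc; case: (c).
suff /(reduced_form_inj r3 r4) [/ts] : wprod ((t :: v) ++ (letter_inv s :: t :: v) ++ [:: s])
  = wprod (letter_inv s :: t :: v ++ s :: t :: v) by [].
have wJ : wprod (t :: v) ^ wprod [:: s] = wprod (letter_inv s :: t :: v) * wprod [:: s].
  by rewrite (wprod_cons (letter_inv s)) wprod1 conjgE mulgA.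
have -> : letter_inv s :: t :: v ++ s :: t :: v =
    (letter_inv s :: t :: v) ++ [:: s] ++ (t :: v) by [].
rewrite (wprod_cat (t :: v)) (wprod_cat (letter_inv s :: t :: v) [:: s]) -wJ E wJ -mulgA.
by rewrite (wprod_cat (letter_inv s :: t :: v)) (wprod_cat [:: s]).
Qed.

(** The word w s is reduced and ends on side c. In s w only the first letter is affected, and as w
    has at least two letters, its reduced form still ends on the other side. *)
Lemma end_letter_not_commute c w s : reduced w -> whead w = Some c -> wlast w = Some (~~ c) ->
  ~~ ltriv s -> lside s = c -> ~ commute (wprod [:: s]) (wprod w).
Proof.
case: w => // t v rw [tc] [lc] s1 sc.
case: v rw lc => [|r v] rw lc; first by move: lc; rewrite /= tc; case: (c).
have [u uE] : exists u, lmul s t = Some u by apply: lmul_side; rewrite sc tc.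
have wE := lastI t (r :: v).
have rws : reduced (rcons (t :: r :: v) s).
  rewrite wE -cats1; apply: reduced_cat; rewrite -?wE ?reduced1 //.
  by rewrite lc sc; case: (c).
rewrite /commute -wprod_lact -wprod_cat cats1 => E.
have := reduced_form_inj (reduced_lact s rw) rws E.
move/(congr1 wlast); rewrite wlast_rcons /lact uE /lcons sc.
by case: ifP => _ /=; rewrite -/(last t (r :: v)) => -[]; rewrite [last _ _]/= in lc *; rewrite lc; case: (c).
Qed.

Lemma commute_conj_all (G : groupType) (z x : G) :
  (forall g, commute z (z ^ g)) -> forall g, commute (z ^ x) ((z ^ x) ^ g).
Proof.
move=> zC g; have /(congr1 (fun y => y ^ x)) := zC (x * g / x).
rewrite /commute /= (conjMg z) (conjMg (z ^ _) z) -(conjgM z) mulgVK.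
by rewrite conjgM.
Qed.

(** Conjugating w = t v by s gives (s^-1 t) v s, which begins and ends on side c provided that s
    differs from 1 and from t; then [same_ends_not_commute] applies. Here a factor with more than
    two elements enters. *)
Lemma alternating_not_commute c w : reduced w -> whead w = Some c -> wlast w = Some (~~ c) ->
  (forall t : letter, lside t = c -> exists s : letter, [/\ lside s = c, ~~ ltriv s &
     exists2 u, lmul (letter_inv s) t = Some u & ~~ ltriv u]) ->
  (exists2 s : letter, lside s = ~~ c & ~~ ltriv s) ->
  ~ forall g, commute (wprod w) (wprod w ^ g).
Proof.
case: w => // t v rw [tc] lc three [b bc b1] wC.
have [s [sc s1 [u uE u1]]] := three _ tc.
have [us ut] := lmul_lside uE.
have rl : reduced (u :: v).
  by have := reduced_lact (letter_inv s) rw; rewrite /lact uE /lcons (negPf u1).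
case: v rw lc rl wC => [|r v] rw lc rl wC; first by move: lc; rewrite /= tc => -[]; case: (c).
have wE := lastI u (r :: v).
have rs : reduced (rcons (u :: r :: v) s).
  rewrite wE -cats1; apply: reduced_cat; rewrite -?wE ?reduced1 //.
  by move: lc => [->]; rewrite sc; case: (c).
have E : wprod (rcons (u :: r :: v) s) = wprod (t :: r :: v) ^ wprod [:: s].
  rewrite -cats1 wprod_cat conjgE mulgA; congr (_ * _).
  by rewrite -wprod1 -wprod_lact /lact uE /lcons (negPf u1).
apply: (@same_ends_not_commute c (rcons (u :: r :: v) s) b) => //.
- by rewrite /= ut tc.
- by rewrite wlast_rcons sc.
by rewrite E; apply: commute_conj_all.
Qed.

Lemma whead_inv w : whead (word_inv w) = wlast w.
Proof.
case: (lastP w) => // v s; rewrite word_inv_rcons wlast_rcons /= lside_inv.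
by [].
Qed.

Lemma wlast_inv w : wlast (word_inv w) = whead w.
Proof. by case: w => // s w; rewrite word_inv_cons wlast_rcons lside_inv. Qed.

Lemma no_abelian_normal (z : free_prod X Y) :
  z <> 1 -> (exists x : X, x <> 1) -> (exists y : Y, y <> 1) ->
  (forall g, commute z (z ^ g)) ->
  (exists2 s : letter, ~~ ltriv s & commute (wprod [:: s]) z) \/
  (exists c, forall t, lside t = c -> exists s : letter, [/\ lside s = c, ~~ ltriv s &
     exists2 u, lmul (letter_inv s) t = Some u & ~~ ltriv u]) -> False.
Proof.
move=> z1 [x x1] [y y1] zC extra.
have letter_ex c : exists2 s : letter, lside s = c & ~~ ltriv s.
  by case: c; [exists (inl x)|exists (inr y)] => //=; apply/eqP.
have [w rw zw] := reduced_form z; subst z.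
have [c hc] : exists c, whead w = Some c by case: (w) z1 => // s v _; exists (lside s).
have [d hd] : exists d, wlast w = Some d by case: (w) z1 => // s v _; eexists.
have [cd|cd] := eqVneq c d.
  subst d; have [s sc s1] := letter_ex (~~ c).
  exact: (same_ends_not_commute rw hc hd s1 sc).
have {cd} dc : d = ~~ c by move: cd; case: (c) (d) => -[].
subst d; have rw' := reduced_inv rw.
(* A word whose ends lie on different sides, or its inverse, begins on any prescribed side. *)
have ends e : exists w', [/\ reduced w', whead w' = Some e, wlast w' = Some (~~ e) &
    wprod w' = wprod w \/ wprod w' = (wprod w)^-1].
  have [->|ec] := eqVneq e c; first by exists w; split=> //; left.
  have -> : e = ~~ c by move: ec; case: (e) (c) => -[].
  exists (word_inv w); rewrite whead_inv wlast_inv negbK wprod_inv.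
  by split=> //; right.
case: extra => [[s s1 sz]|[e three]].
  have [w' [rw1 hw lw E]] := ends (lside s).
  apply: (end_letter_not_commute rw1 hw lw s1 erefl).
  by case: E => ->; [|apply: commuteV].
have [w' [rw1 hw lw E]] := ends e.
apply: (alternating_not_commute rw1 hw lw three) => // g.
case: E => ->; first exact: zC.
by rewrite conjVg; apply/commute_sym/commuteV/commute_sym/commuteV.
Qed.

End Commuting.

Section Extension.
Variables (X K : groupType) (N : set X) (s : hom (subg N) K).
Hypothesis sN : subgroup N.

(** Makes a homomorphism of [N] applicable to expressions in X without carrying membership proofs in
    the terms. *)
Definition extend_by_one (x : X) : K :=
  if pselect (N x) is left Nx then s (insubg Nx) else 1.

Lemma extend_val (x : subg N) : extend_by_one (val x) = s x.
Proof.
rewrite /extend_by_one; case: pselect => [Nx|[]]; last exact: subg_val.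
by congr (s _); apply: val_inj.
Qed.

Lemma extend_in x (Nx : N x) : extend_by_one x = s (insubg Nx).
Proof. exact: (extend_val (insubg Nx)). Qed.

Lemma extendM x y : N x -> N y -> extend_by_one (x * y) = extend_by_one x * extend_by_one y.
Proof.
move=> Nx Ny; have Nxy : N (x * y) by apply: subgroupM.
rewrite (extend_in Nx) (extend_in Ny) (extend_in Nxy) -gmulfM.
by congr (s _); apply: val_inj; rewrite gmulfM.
Qed.

Lemma extend1 : extend_by_one 1 = 1.
Proof. by have := extend_val 1; rewrite val1 gmulf1. Qed.

Lemma extendV x : N x -> extend_by_one x^-1 = (extend_by_one x)^-1.
Proof.
move=> Nx; apply/esym/mulg1_eq; rewrite -extendM ?mulgV ?extend1 //.
exact: subgroupV.
Qed.

Lemma extendX x n : N x -> extend_by_one (x ^+ n) = extend_by_one x ^+ n.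
Proof.
move=> Nx; elim: n => [|n IHn]; first exact: extend1.
by rewrite !expgS extendM ?IHn //; apply: subgroupX.
Qed.

End Extension.

Lemma pair_mulE (X Y : groupType) (a c : X) (b d : Y) : (a, b) * (c, d) = (a * c, b * d).
Proof. by []. Qed.

Lemma pair_invE (X Y : groupType) (a : X) (b : Y) : (a, b)^-1 = (a^-1, b^-1).
Proof. by []. Qed.

(** * Freeness of the kernel of the projection to the direct product *)

Section FreeKernel.
Variables X Y : groupType.
Let F := free_prod X Y.
Let in1 : hom X F := gfp_in1 (of_void X) (of_void Y).
Let in2 : hom Y F := gfp_in2 (of_void X) (of_void Y).

Fact proj_compat (h : void) : pair_hom (idfun : hom X X) (one_fun Y : hom X Y) (of_void X h) =
  pair_hom (one_fun X : hom Y X) (idfun : hom Y Y) (of_void Y h).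
Proof. by case: h. Qed.

Definition free_prod_proj : hom F (X * Y)%type := gfp_hom proj_compat.
Let phi := free_prod_proj.

Lemma free_prod_proj1 x : phi (in1 x) = (x, 1). Proof. exact: gfp_hom1. Qed.
Lemma free_prod_proj2 y : phi (in2 y) = (1, y). Proof. exact: gfp_hom2. Qed.

Lemma free_prod_proj_surj : range phi = [set: (X * Y)%type].
Proof.
apply/surjP => -[x y]; exists (in1 x * in2 y).
by rewrite gmulfM free_prod_proj1 free_prod_proj2 pair_mulE mulg1 mul1g.
Qed.

Let N := kernel phi.
Let sN : subgroup N. Proof. by case: (kernel_normal phi). Qed.

(** With x and y different from 1 these commutators form the free basis of the kernel. If x or y is
    1, the commutator is trivial, which is why [D] takes the value 1 there. *)
Let d x y : F := in2 y * in1 x * (in2 y)^-1 * (in1 x)^-1.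

Let Nd x y : N (d x y).
Proof.
rewrite /N /kernel /preimage /mkset /d !(gmulfF phi) gmulfM !free_prod_proj1 !free_prod_proj2.
by rewrite !(pair_invE, pair_mulE) !invg1 !mul1g !mulg1 !mulgV.
Qed.

Let dh x y : subg N := insubg (Nd x y).

Section Cocycle.
Variables (K : groupType) (f : subg N -> K).

Let D x y : K := if (x == 1) || (y == 1) then 1 else f (dh x y).

Let T : Type := (X * Y * K)%type.

(* An element n of the kernel will send (1, 1, 1) to (1, 1, g n), and d x y to
   (1, 1, D x y); this defines the homomorphism g extending f. *)
Let act1 (x : X) (t : T) : T :=
  (t.1.1 * x, t.1.2, t.2 * ((D t.1.1 t.1.2)^-1 * D (t.1.1 * x) t.1.2)).
Let act2 (y : Y) (t : T) : T := (t.1.1, t.1.2 * y, t.2).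

Let act11 t : act1 1 t = t.
Proof. by case: t => [[x y] k]; rewrite /act1 /= !mulg1 mulVg mulg1. Qed.
Let act1M x x' t : act1 (x * x') t = act1 x' (act1 x t).
Proof. by case: t => [[u v] k]; rewrite /act1 /= !mulgA mulgK. Qed.
Let act21 t : act2 1 t = t.
Proof. by case: t => [[x y] k]; rewrite /act2 /= !mulg1. Qed.
Let act2M y y' t : act2 (y * y') t = act2 y' (act2 y t).
Proof. by case: t => [[u v] k]; rewrite /act2 /= !mulgA. Qed.

Let compat (h : void) : act_hom act11 act1M (of_void X h) = act_hom act21 act2M (of_void Y h).
Proof. by case: h. Qed.

Let psi : hom F (sym T) := gfp_hom compat.

Let psi1 x t : psi (in1 x) t = act1 x t. Proof. by rewrite /psi gfp_hom1. Qed.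
Let psi2 y t : psi (in2 y) t = act2 y t. Proof. by rewrite /psi gfp_hom2. Qed.

Let psi_shape z x y : exists c, forall k,
  psi z (x, y, k) = (x * (phi z).1, y * (phi z).2, k * c).
Proof.
move: x y; pattern z; apply: gfp_ind => {z} [|a z IH|b z IH] x y.
- by exists 1 => k; rewrite !gmulf1 !mulg1.
- have [c cE] := IH (x * a) y; exists ((D x y)^-1 * D (x * a) y * c) => k.
  by rewrite gmulfM symM psi1 /act1 /= cE gmulfM free_prod_proj1 /= mul1g -!mulgA.
have [c cE] := IH x (y * b); exists c => k.
by rewrite gmulfM symM psi2 /act2 /= cE gmulfM free_prod_proj2 /= mul1g -!mulgA.
Qed.

Let g_fun (n : subg N) : K := (psi (val n) (1, 1, 1)).2.

Let Nval (n : subg N) : phi (val n) = 1.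
Proof. exact: (subg_val n sN). Qed.

Let g_funE n k : psi (val n) (1, 1, k) = (1, 1, k * g_fun n).
Proof.
rewrite /g_fun; have [c cE] := psi_shape (val n) 1 1.
by rewrite !cE Nval /= !mulg1 mul1g.
Qed.

Let g_morph : {morph g_fun : m n / m * n}.
Proof.
move=> m n; have := g_funE (m * n) 1.
rewrite (_ : val (m * n) = val m * val n) // (gmulfM (val m)) symM !g_funE !mul1g.
by case.
Qed.

Let g : hom (subg N) K := mkhom g_morph.

Let g_d x y : x <> 1 -> y <> 1 -> g (dh x y) = f (dh x y).
Proof.
move=> x1 y1; rewrite mkhomE /g_fun /= /d !gmulfM !symM -!gmulfV psi2 psi1 psi2 psi1.
have D1 y' : D 1 y' = 1 by rewrite /D eqxx.
have D2 x' : D x' 1 = 1 by rewrite /D eqxx orbT.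
have -> : f (dh x y) = D x y by rewrite /D; case: eqP => // _; case: eqP.
by rewrite /act1 /act2 /= !mul1g !mulgV !D1 !D2 invg1 !mul1g !mulg1.
Qed.

Let g_unique (g' : hom (subg N) K) :
  (forall x y, x <> 1 -> y <> 1 -> g' (dh x y) = f (dh x y)) -> g' =1 g.
Proof.
move=> g'd; pose e := extend_by_one g'.
have De x y : D x y = e (d x y).
  rewrite /e (extend_in g' sN (Nd x y)) /D; case: ifP => [xy|/negbT].
    suff -> : insubg (Nd x y) = 1 by rewrite gmulf1.
    apply: val_inj; rewrite val1 insubgK /d.
    by case/orP: xy => /eqP ->; rewrite !gmulf1 invg1 ?mul1g !mulg1 mulgV.
  by rewrite negb_or => /andP [/eqP x1 /eqP y1]; rewrite g'd.
(* A transversal of the kernel. The increments of [act1] are the values of g' on its Schreier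
   generators, so [key] expresses the action of every z through g'; at x = y = 1 and z in the kernel
   it returns g' itself. *)
pose t x y : F := in1 x * in2 y.
have Nt x y z : N (t x y * z * (t (x * (phi z).1) (y * (phi z).2))^-1).
  rewrite /N /kernel /preimage /mkset (gmulfF phi) /t !gmulfM !free_prod_proj1 !free_prod_proj2.
  rewrite -/phi /=; case: (phi z) => u v /=.
  by rewrite !(pair_invE, pair_mulE) !mul1g !mulg1 !mulgV.
have N1 x y a : N (t x y * in1 a * (t (x * a) y)^-1).
  by have := Nt x y (in1 a); rewrite free_prod_proj1 /= mulg1.
have De1 x y a : (D x y)^-1 * D (x * a) y = e (t x y * in1 a * (t (x * a) y)^-1).
  rewrite !De -(extendV g' sN) // -(extendM g' sN) //; last exact: subgroupV.
  by congr (e _); rewrite /d /t !gmulfM !gnorm.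
have tM x y b : t x (y * b) = t x y * in2 b by rewrite /t gmulfM mulgA.
have t11 : t 1 1 = 1 by rewrite /t !gmulf1 mulg1.
clearbody t.
have key z x y k : psi z (x, y, k) =
    (x * (phi z).1, y * (phi z).2, k * e (t x y * z * (t (x * (phi z).1) (y * (phi z).2))^-1)).
  move: x y k; pattern z; apply: gfp_ind => {z} [|a z IH|b z IH] x y k.
  - by rewrite !gmulf1 sym1 /= !mulg1 mulgV /e extend1 // mulg1.
  - rewrite gmulfM symM psi1 /act1 /= IH gmulfM free_prod_proj1 /= mul1g -!mulgA.
    rewrite (mulgA (_^-1)) De1 -(extendM g' sN) //.
      by congr (_, _, _ * e _); rewrite !mulgA mulgVK.
    by have := Nt (x * a) y z; rewrite !mulgA.
  rewrite gmulfM symM psi2 /act2 /= IH gmulfM free_prod_proj2 /= mul1g -!mulgA.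
  by congr (_, _, _ * e _); rewrite tM !mulgA.
move=> n; rewrite mkhomE /g_fun key Nval /= !mulg1 mul1g t11 invg1 mulg1 mul1g.
by rewrite /e extend_val.
Qed.

Lemma free_kernel_universal : exists2 g0 : hom (subg N) K,
  (forall x y, x <> 1 -> y <> 1 -> g0 (dh x y) = f (dh x y)) &
  forall g' : hom (subg N) K,
    (forall x y, x <> 1 -> y <> 1 -> g' (dh x y) = f (dh x y)) -> g' =1 g0.
Proof. by exists g; [apply: g_d|apply: g_unique]. Qed.

End Cocycle.

Lemma free_prod_kernel_free : class_free (subg (kernel free_prod_proj)).
Proof.
exists [set n | exists x y, [/\ x <> 1, y <> 1 & n = dh x y]] => K f.
have [g gd gu] := free_kernel_universal f.
exists g => [n [x [y [x1 y1 ->]]]|g' g'd n]; first exact: gd.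
by apply: gu => x y x1 y1; apply: g'd; exists x, y.
Qed.

End FreeKernel.

(** * Residual properties of free groups *)

Section Syllables.
Variable X : groupType.

(** A pair of natural numbers (a, b) encodes the integer exponent a - b. *)
Definition syllable (u : X * (nat * nat)) : X := u.1 ^+ u.2.1 / u.1 ^+ u.2.2.
Definition sprod (l : seq (X * (nat * nat))) : X := foldr (fun u x => syllable u * x) 1 l.

Lemma sprod_cat l m : sprod (l ++ m) = sprod l * sprod m.
Proof. by elim: l => [|u l IHl] /=; rewrite ?mul1g // IHl mulgA. Qed.

Lemma syllableM x a b c d :
  syllable (x, (a, b)) * syllable (x, (c, d)) = syllable (x, (a + c, d + b))%N.
Proof.
rewrite /syllable /= !expgnDr invgM -!mulgA; congr (_ * _).
rewrite !mulgA; congr (_ * _); exact/commute_sym/commuteV/commuteX2.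
Qed.

Lemma generated_sprod (S : set X) x : generated S x ->
  exists2 l, (forall u, u \in l -> S u.1) & x = sprod l.
Proof.
suff: generated S `<=` [set x | exists2 l, (forall u, u \in l -> S u.1) & x = sprod l].
  by apply.
apply: generated_sub => [|y Sy]; last first.
  exists [:: (y, (1, 0)%N)] => [u|]; first by rewrite inE => /eqP ->.
  by rewrite /= /syllable /= divg1 mulg1.
split=> [|_ _ [l lS ->] [m mS ->]]; first by exists [::].
pose inv_s (u : X * (nat * nat)) := (u.1, (u.2.2, u.2.1)).
exists (l ++ rev (map inv_s m)) => [u|].
  rewrite mem_cat mem_rev => /orP [/lS //|/mapP [v /mS Sv -> //]].
rewrite sprod_cat; congr (_ * _); elim: m {mS} => [|u m IHm] /=; first exact: invg1.
rewrite rev_cons -cats1 sprod_cat -IHm /= mulg1 invgM; congr (_ * _).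
by rewrite /syllable /= invgF.
Qed.

Definition reduced_syllables (l : seq (X * (nat * nat))) : Prop :=
  (forall u, u \in l -> u.2.1 != u.2.2) /\
  sorted (fun u v => u.1 != v.1) l.

(** A shortest expression is reduced: a syllable with exponent 0 could be dropped, and two
    neighbours with the same generator could be merged. *)
Lemma generated_reduced_sprod (S : set X) x : generated S x ->
  exists2 l, reduced_syllables l & (forall u, u \in l -> S u.1) /\ x = sprod l.
Proof.
move=> /generated_sprod [l0 l0S xl0].
pose Q n := `[< exists l, [/\ size l = n, forall u, u \in l -> S u.1 & x = sprod l] >].
have exQ : exists n, Q n by exists (size l0); apply/asboolP; exists l0.
case: (ex_minnP exQ) => n /asboolP [l [szl lS xl]] nmin.
have short m : (size m < size l)%N -> (forall u, u \in m -> S u.1) -> x = sprod m -> False.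
  move=> lt_ml mS xm; have /nmin : Q (size m) by apply/asboolP; exists m.
  by rewrite -szl leqNgt lt_ml.
exists l => //; split=> [[y [a b]] yl|].
  apply/negP => /= /eqP ab; subst b; move: yl lS xl short.
  move=> /splitPr [l1 l2] lS xl short.
  apply: (short (l1 ++ l2)); first by rewrite !size_cat /= addnS ltnS.
    by move=> u; rewrite mem_cat => /orP [ul|ul]; apply: lS; rewrite mem_cat ?inE ul ?orbT.
  by rewrite xl !sprod_cat /= /syllable /= mulgV mul1g.
apply/(sortedP (x, (0, 0)%N)) => k kl; apply/negP => /eqP E.
pose u0 : X * (nat * nat) := (x, (0, 0)%N).
have lE : l = take k l ++ nth u0 l k :: nth u0 l k.+1 :: drop k.+2 l.
  by rewrite -drop_nth // -drop_nth ?cat_take_drop // ltnW.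
case uE: (nth u0 l k) E lE => [y [a b]] /=; rewrite -/u0.
case vE: (nth u0 l k.+1) => [z [c d]] /= yz lE; subst z.
apply: (short (take k l ++ (y, (a + c, d + b)%N) :: drop k.+2 l)).
- by rewrite [X in (_ < size X)%N]lE !size_cat /= !addnS.
- move=> u; rewrite mem_cat inE => /or3P [ul|/eqP ->|ul].
  + by apply: (lS u); rewrite lE mem_cat ul.
  + by have := mem_nth u0 (ltnW kl); rewrite uE => /lS.
  by apply: (lS u); rewrite lE mem_cat !inE ul !orbT.
by rewrite xl {1}lE !sprod_cat /= -syllableM !mulgA.
Qed.

End Syllables.

(** The map extending S -> <S>, followed by the inclusion, agrees with the identity on S, hence
    everywhere by uniqueness. *)
Lemma free_generated (X : groupType) (S : set X) :
  (forall (Y : groupType) (f : X -> Y),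
    exists2 g : hom X Y, (forall x, S x -> g x = f x) &
      forall g' : hom X Y, (forall x, S x -> g' x = f x) -> g' =1 g) ->
  forall x, generated S x.
Proof.
move=> univ x.
pose f y : subg S := if pselect (generated S y) is left gy then Subg (asboolT gy) else 1.
have [g gS _] := univ _ f; have [e _ eu] := univ _ (idfun : X -> X).
have gE y : S y -> val (g y) = y.
  move=> Sy; rewrite gS // /f; case: pselect => // -[]; exact: sub_generated.
have -> : x = (subg_incl S \o g) x.
  transitivity (e x); first exact: (eu idfun).
  by apply/esym/(eu (subg_incl S \o g)) => y Sy; apply: gE.
exact: subgP.
Qed.

(** * Unipotent actions on vectors over the integers modulo a power of p *)

Section TriangularAction.
Variables (X : groupType) (p e k : nat) (gen : nat -> X).
Hypotheses (pp : prime p) (e0 : (0 < e)%N).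
Import GRing.Theory.
Local Notation R := 'Z_(p ^ e).
Local Notation state := {ffun 'I_k.+1 -> R}.

Definition at_ (v : state) (n : nat) : R := v (inord n).

Lemma state_ext (v w : state) : (forall n, (n <= k)%N -> at_ v n = at_ w n) -> v = w.
Proof.
move=> E; apply/ffunP => i; have := E i; rewrite /at_ inord_val; apply.
by rewrite -ltnS.
Qed.

(* gen lists the generators of the syllables of a reduced product; a generator x
   adds the entry n - 1 to the entry n wherever gen n.-1 is x.  From the state
   (1, 0, ..., 0) the whole product then leads to a state whose last entry is the
   product of the exponents of the syllables. *)
Definition active (x : X) n := (0 < n)%N && (gen n.-1 == x).

Definition shear (x : X) (v : state) : state :=
  [ffun i : 'I_k.+1 => (at_ v i + (if active x i then at_ v i.-1 else 0))%R].

Lemma at_shear x v n : (n <= k)%N ->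
  at_ (shear x v) n = (at_ v n + (if active x n then at_ v n.-1 else 0))%R.
Proof. by move=> nk; rewrite {1}/at_ ffunE inordK. Qed.

Lemma shear_inj x : injective (shear x).
Proof.
move=> v w E; apply: state_ext; elim/ltn_ind => n IH nk.
have := congr1 (at_ ^~ n) E; rewrite /= !at_shear //.
case: ifP => [/andP [n0 _]|_]; last by rewrite !addr0.
rewrite (IH n.-1) ?ltn_predL //; last exact: leq_trans (leq_pred _) nk.
exact: addIr.
Qed.

Lemma shear_bij x : bijective (shear x).
Proof. exact: injF_bij (@shear_inj x). Qed.

Definition shear_sym x : sym state := MkSym (shear_bij x).

(** The analogue of a unitriangular matrix, for maps that may be nonlinear: the change of an entry
    depends on the earlier entries alone. *)
Definition triangular (s : sym state) : Prop := forall n, (n <= k)%N -> forall v w : state,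
  (forall l, (l < n)%N -> at_ v l = at_ w l) ->
  (at_ (s v) n - at_ v n = at_ (s w) n - at_ w n)%R.

Lemma triangular_agree s n v w : triangular s -> (n <= k.+1)%N ->
  (forall l, (l < n)%N -> at_ v l = at_ w l) ->
  forall l, (l < n)%N -> at_ (s v) l = at_ (s w) l.
Proof.
move=> ts nk vw l ln.
have := ts l (leq_trans ln nk) v w (fun l' l'l => vw l' (ltn_trans l'l ln)).
by rewrite vw // => /addIr.
Qed.

Lemma triangular_shear x : triangular (shear_sym x).
Proof.
move=> n nk v w vw; rewrite /= !at_shear // ![(at_ _ n + _)%R]addrC !addrK.
by case: ifP => // /andP [n0 _]; apply: vw; rewrite ltn_predL.
Qed.

Lemma triangularM s t : triangular s -> triangular t -> triangular (s * t).
Proof.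
move=> ts tt n nk v w vw; rewrite !symM.
have E := tt n nk _ _ (triangular_agree ts (leqW nk) vw).
rewrite -[at_ (t (s v)) n](subrK (at_ (s v) n)) E -addrA (ts n nk v w vw).
by rewrite addrA subrK.
Qed.

Lemma triangularV t : triangular t -> triangular (t^-1)%g.
Proof.
move=> tt n nk v w vw.
have agree l : (l <= n)%N -> (forall l', (l' < l)%N -> at_ ((t^-1)%g v) l' = at_ ((t^-1)%g w) l').
  elim: l => // l IHl ln l'; rewrite ltnS leq_eqVlt => /predU1P [->|]; last first.
    exact: (IHl (ltnW ln)).
  have := tt l (leq_trans (ltnW ln) nk) _ _ (IHl (ltnW ln)).
  by rewrite !symVK vw // => /addrI /oppr_inj.
have := tt n nk _ _ (agree n (leqnn n)); rewrite !symVK => E.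
by rewrite -[LHS]opprK opprB E opprB.
Qed.

Lemma triangular_subgroup : subgroup triangular.
Proof.
split=> [n nk v w vw|s t ts tt]; first by rewrite !sym1 !subrr.
by apply: triangularM => //; apply: triangularV.
Qed.

Lemma mulrn_pe (x : R) : (x *+ (p ^ e) = 0)%R.
Proof.
by rewrite -mulr_natr pchar_Zp ?mulr0 // -(exp1n e) ltn_exp2r // prime_gt1.
Qed.

(** Once a power t fixes all entries before n, it adds the same amount to entry n at every
    application, so t^(p^e) fixes entry n too. Each of the k + 1 entries costs one factor p^e. *)
Lemma triangular_exponent s : triangular s -> s ^+ (p ^ (e * k.+1)) = 1.
Proof.
move=> ts; suff E n : (n <= k.+1)%N -> forall v l, (l < n)%N ->
    at_ ((s ^+ (p ^ (e * n))) v) l = at_ v l.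
  apply: sym_eq1 => v; apply: state_ext => l lk.
  by rewrite E.
elim: n => // n IHn nk; have {}IHn := IHn (ltnW nk).
rewrite mulnS addnC expnD expgnA; set t := s ^+ (p ^ (e * n)) in IHn *.
have tt : triangular t := subgroupX _ triangular_subgroup ts.
have low m v l : (l < n)%N -> at_ ((t ^+ m) v) l = at_ v l.
  by elim: m v => // m IHm v ln; rewrite expgS symM IHm // IHn.
have top m v : at_ ((t ^+ m) v) n = (at_ v n + (at_ (t v) n - at_ v n) *+ m)%R.
  elim: m v => [|m IHm] v; first by rewrite mulr0n addr0.
  rewrite expgS symM IHm (tt n nk (t v) v) => [|l ln]; last exact: IHn.
  by rewrite mulrS addrA [(at_ v n + _)%R]addrC subrK.
move=> v l; rewrite ltnS leq_eqVlt => /predU1P [->|/low //].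
by rewrite top mulrn_pe addr0.
Qed.

Lemma shear_step (j : nat) (x : X) (c y : R) v :
  (j < k)%N -> gen j = x -> ((0 < j)%N -> gen j.-1 != x) ->
  ((j.+1 < k)%N -> gen j.+1 != x) ->
  at_ v j = c -> at_ v j.+1 = y -> (forall l, (j.+1 < l <= k)%N -> at_ v l = 0%R) ->
  [/\ at_ (shear x v) j = c, at_ (shear x v) j.+1 = (y + c)%R &
      forall l, (j.+1 < l <= k)%N -> at_ (shear x v) l = 0%R].
Proof.
move=> jk gj gj1 gj2 vj vj1 vl; split.
- rewrite at_shear ?(ltnW jk) // vj /active; case: ifP; rewrite ?addr0 //.
  by move=> /andP [/gj1 /negPf ->].
- by rewrite at_shear // vj1 /active /= gj eqxx vj.
move=> l /andP [jl lk]; rewrite at_shear // vl ?jl //.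
case: ifP => [/andP [l0 gl]|_]; last by rewrite addr0.
have [jl1|jl1] := ltnP j.+1 l.-1; first by rewrite vl ?addr0 // jl1 (leq_trans (leq_pred _) lk).
have {jl1} lE : l = j.+2.
  by apply/eqP; rewrite eqn_leq jl andbT -(prednK l0) ltnS.
by move: gl lk; rewrite lE /= => gl /gj2; rewrite gl.
Qed.

Lemma shear_unstep (j : nat) (x : X) (c y : R) v :
  (j < k)%N -> gen j = x -> ((0 < j)%N -> gen j.-1 != x) ->
  ((j.+1 < k)%N -> gen j.+1 != x) ->
  at_ (shear x v) j = c -> at_ (shear x v) j.+1 = y ->
  (forall l, (j.+1 < l <= k)%N -> at_ (shear x v) l = 0%R) ->
  [/\ at_ v j = c, at_ v j.+1 = (y - c)%R &
      forall l, (j.+1 < l <= k)%N -> at_ v l = 0%R].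
Proof.
move=> jk gj gj1 gj2 vj vj1 vl.
have vjc : at_ v j = c.
  rewrite -vj at_shear ?(ltnW jk) // /active; case: ifP; rewrite ?addr0 //.
  by move=> /andP [/gj1 /negPf ->].
split=> //; first by rewrite -vj1 at_shear // /active /= gj eqxx vjc addrK.
elim=> // l IHl /andP [jl lk]; have := vl l.+1; rewrite jl lk at_shear //= => /(_ isT).
case: ifP => [/andP [_ gl]|_]; last by rewrite addr0.
have [jl1|jl1] := ltnP j.+1 l; first by rewrite IHl ?addr0 // jl1 ltnW.
have {jl1} lE : l = j.+1 by apply/eqP; rewrite eqn_leq jl1.
by move: gl lk; rewrite lE /= => gl /gj2; rewrite gl.
Qed.

Definition front (j : nat) (c y : R) (v : state) : Prop :=
  [/\ at_ v j = c, at_ v j.+1 = y & forall l, (j.+1 < l <= k)%N -> at_ v l = 0%R].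

(** Reducedness is what makes this work: as the neighbours of [gen j] differ from x, entry j does
    not move and entry j + 2 receives nothing, so c is added to entry j + 1 each time x is
    applied. *)
Lemma front_syllable (j : nat) (x : X) (c y : R) a b v :
  (j < k)%N -> gen j = x -> ((0 < j)%N -> gen j.-1 != x) ->
  ((j.+1 < k)%N -> gen j.+1 != x) -> front j c y v ->
  front j c (y + c *+ a - c *+ b)%R ((shear_sym x ^+ a / shear_sym x ^+ b) v).
Proof.
move=> jk gj gj1 gj2 fv; rewrite symM.
have pos w z : front j c z w -> front j c (z + c *+ a)%R ((shear_sym x ^+ a) w).
  elim: a w z => [|m IHm] w z fw; first by rewrite mulr0n addr0.
  rewrite expgS symM mulrS addrA; apply: IHm.
  by case: fw => wj wj1 wl; apply: shear_step.
have neg w z : front j c z w -> front j c (z - c *+ b)%R ((shear_sym x ^- b) w).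
  elim: b w z => [|m IHm] w z fw; first by rewrite mulr0n subr0 invg1.
  rewrite -expVgn expgS symM expVgn mulrS opprD addrA; apply: IHm.
  case: fw => wj wj1 wl; apply: (@shear_unstep j x) => //;
    by rewrite -[shear x _]/(shear_sym x _) symVK.
exact/neg/pos.
Qed.

End TriangularAction.

Section FreeResidual.
Import GRing.Theory.

Lemma prod_natrB (W : comNzRingType) (I : Type) (l : seq I) (a b : I -> nat) :
  exists c : bool, (\prod_(u <- l) ((a u)%:R - (b u)%:R) =
    (-1) ^+ c * (\prod_(u <- l) ((a u - b u) + (b u - a u)))%N%:R :> W)%R.
Proof.
elim: l => [|u l [c IH]]; first by exists false; rewrite !big_nil mulr1.
rewrite !big_cons IH natrM.
have [le21|/ltnW le12] := leqP (b u) (a u).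
  exists c; rewrite (eqP (_ : b u - a u == 0)%N) ?subn_eq0 // addn0 natrB //.
  by rewrite mulrCA.
exists (~~ c); rewrite (eqP (_ : a u - b u == 0)%N) ?subn_eq0 // add0n natrB //.
by rewrite mulrCA signrN mulNr -mulrN -mulNr opprB.
Qed.

Variables (X : groupType) (p : nat).
Hypotheses (pp : prime p) (fX : class_free X).

Lemma free_residually_F (x : X) : x <> 1 ->
  exists (Z : groupType) (s : hom X Z), class_F p Z /\ s x <> 1.
Proof.
move=> x1; have [S univ] := fX.
have [l [lr ls] [lS xl]] := generated_reduced_sprod (free_generated univ x).
pose dist (u : X * (nat * nat)) := ((u.2.1 - u.2.2) + (u.2.2 - u.2.1))%N.
(* Up to sign, [e] is the product of the exponents of the syllables, which will be the last entry of
   the final state. It is nonzero modulo p^e because 0 < e < p^e. *)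
pose e := (\prod_(u <- l) dist u)%N; pose k := size l.
have k0 : (0 < k)%N by rewrite /k; case: (l) xl x1 => // ->.
have e0 : (0 < e)%N.
  rewrite /e big_seq_cond; apply: prodn_cond_gt0 => u /andP [/lr].
  by rewrite neq_ltn addn_gt0 !subn_gt0 orbC.
pose u0 : X * (nat * nat) := (1, (0, 0)%N).
pose gen j := (nth u0 l j).1.
pose R : pzRingType := 'Z_(p ^ e).
pose T : finType := {ffun 'I_k.+1 -> 'Z_(p ^ e)}.
have [g gS _] := univ (sym T) (fun y => shear_sym p e k gen y).
have fS : finite_set [set: sym T] by apply: finite_sym; apply: finite_finset.
have gT y : triangular (g y).
  have : generated S y := free_generated univ y.
  suff: generated S `<=` g @^-1` (@triangular p e k) by apply.
  apply: generated_sub; first exact/preimage_subgroup/triangular_subgroup.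
  by move=> z Sz; rewrite /preimage /mkset gS //; apply: triangular_shear.
exists (subg (range g)), (corestr g); split.
  apply: class_F_intro => //.
    by apply: (@finite_inj _ _ (subg_incl (range g))) => //; apply: val_inj.
  move=> z; have [y _ yz] := subg_val z (range_subgroup g).
  exists (e * k.+1)%N; apply: val_inj; rewrite val1 -subg_inclE gmulfXn subg_inclE -yz.
  exact: triangular_exponent (gT y).
move=> /corestr_eq1 gx1.
pose v0 : T := [ffun i : 'I_k.+1 => if val i == 0%N then 1%R else 0%R].
have at0 n : (n <= k)%N -> at_ v0 n = (if n == 0%N then 1 else 0)%R.
  by move=> nk; rewrite /at_ ffunE /= inordK.
pose c j : 'Z_(p ^ e) := (\prod_(u <- take j l) ((u.2.1)%:R - (u.2.2)%:R))%R.
have front_prefix j : (j <= k)%N ->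
    at_ (g (sprod (take j l)) v0) j = c j /\
    forall i, (j < i <= k)%N -> at_ (g (sprod (take j l)) v0) i = 0%R.
  elim: j => [_|j IHj jk].
    rewrite take0 gmulf1 /c take0 big_nil; split=> [|i /andP [i0 ik]]; rewrite sym1 at0 //.
    by rewrite (gtn_eqF i0).
  have [IHc IH0] := IHj (ltnW jk).
  set u := nth u0 l j; have ul : u \in l by apply: mem_nth.
  have gu : g u.1 = shear_sym p e k gen u.1 by apply: gS; apply: lS.
  have take_u : take j.+1 l = take j l ++ [:: u].
    by rewrite cats1 -take_nth.
  rewrite take_u sprod_cat gmulfM symM /= mulg1 /syllable gmulfM gmulfV !gmulfXn /= gu.
  have [|||[_ fj f0]] := @front_syllable X p e k gen j u.1 (c j) 0%R u.2.1 u.2.2 (g (sprod (take j l)) v0) jk erefl.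
  - by move=> j0; have := sortedP u0 ls j.-1; rewrite prednK //; apply.
  - by move=> j1; have := sortedP u0 ls j j1; rewrite eq_sym.
  - split=> [||i /andP [ji ik]].
    + exact: IHc.
    + by apply: IH0; rewrite leqnn.
    by apply: IH0; rewrite (ltnW ji).
  split=> [|i ji]; last exact: f0.
  rewrite fj /c take_u big_cat big_seq1 /= add0r.
  by rewrite mulrBr !mulr_natr.
have := (front_prefix k (leqnn k)).1; rewrite take_size -xl gx1 sym1 at0 //.
rewrite (gtn_eqF k0) /c take_size => /esym prod0.
have [b prodE] := prod_natrB 'Z_(p ^ e) l (fun u => u.2.1) (fun u => u.2.2).
have pe1 : (1 < p ^ e)%N by rewrite -(exp1n e) ltn_exp2r // prime_gt1.
move: prod0; rewrite prodE => /(congr1 (fun z => ((-1) ^+ b * z)%R)).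
rewrite mulr0 signrMK => /(congr1 val); rewrite /= val_Zp_nat // modn_small.
  by move=> e00; have E : e = 0%N := e00; move: (e0); rewrite E.
exact: ltn_expl (prime_gt1 pp).
Qed.

End FreeResidual.

(** * Finite extensions of free groups *)

Section Induction.
Variables (p : nat) (X Q Z : groupType) (phi : hom X Q).
Hypotheses (pp : prime p) (phiT : range phi = [set: Q]) (fQ : finite_group Q).
Variable s : hom (subg (kernel phi)) Z.
Hypothesis FZ : class_F p Z.

Let N := kernel phi.
Let sN : subgroup N. Proof. by case: (kernel_normal phi). Qed.
Let e := extend_by_one s.
Let t (q : Q) : X := sval (cid ((surjP phi).1 phiT q)).
Let tK q : phi (t q) = q. Proof. by rewrite /t; case: cid. Qed.

Let Nt q g : N (t q * g * (t (q * phi g))^-1).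
Proof. by rewrite /N /kernel /preimage /mkset (gmulfF phi) gmulfM /= !tK mulgV. Qed.

(* The representation of X induced from s. *)
Let act (g : X) (u : Q * Z) : Q * Z :=
  (u.1 * phi g, u.2 * e (t u.1 * g * (t (u.1 * phi g))^-1)).

Let act1 u : act 1 u = u.
Proof.
by case: u => q z; rewrite /act /= gmulf1 !mulg1 mulgV /e (extend1 s sN) mulg1.
Qed.

Let actM g h u : act (g * h) u = act h (act g u).
Proof.
case: u => q z; rewrite /act /= gmulfM mulgA; congr (_, _).
rewrite -[RHS]mulgA; congr (_ * _); rewrite /e -(extendM s sN); [|exact: Nt|exact: Nt].
by rewrite !mulgA mulgVK.
Qed.

(** An element n of the kernel preserves each fibre over q and translates it by the value of s at a
    conjugate of n; so its order divides the exponent of Z. *)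
Lemma induced_hom : exists (E : groupType) (sigma : hom X E),
  [/\ range sigma = [set: E], finite_group E,
      exists k, forall n, kernel phi n -> sigma n ^+ (p ^ k) = 1
    & forall n, kernel phi n -> extend_by_one s n <> 1 -> sigma n <> 1].
Proof.
pose r := act_hom act1 actM.
have kerE n q z : N n -> r n (q, z) = (q, z * e (n ^ (t q)^-1)).
  move=> Nn; have phin : phi n = 1 by [].
  by rewrite act_homE /act /= phin mulg1 conjgE invgK mulgA.
have NJ n q : N n -> N (n ^ (t q)^-1) by apply: (proj2 (kernel_normal phi)).
exists (subg (range r)), (corestr r); split.
- exact: corestr_surj.
- apply: (@finite_inj _ _ (subg_incl (range r))); first exact: val_inj.
  by apply: finite_sym; apply: finite_prod => //; case: FZ.
- have [k Zk] := class_F_exponent pp FZ; exists k => n Nn.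
  apply: val_inj; rewrite val1 -subg_inclE gmulfXn subg_inclE corestrE.
  rewrite -gmulfXn; apply: sym_eq1 => -[q z].
  rewrite kerE; last exact: subgroupX.
  by rewrite conjXg /e (extendX s sN) ?Zk ?mulg1 //; apply: NJ.
move=> n Nn sn /corestr_eq1 rn; apply: sn.
have := kerE n 1 1 Nn; rewrite rn sym1 mul1g => -[] /esym E.
(* The representative t 1 need not be 1, but it lies in the kernel; so on the fibre over 1 the value
   of s at n is only conjugated. *)
have N1 : N (t 1) by rewrite /N /kernel /preimage /mkset tK.
have N1' : N (t 1)^-1 by apply: subgroupV.
have NJn := NJ n 1 Nn; rewrite -(conjgKV (t 1) n) conjgE.
rewrite (extendM s sN) //; last exact: subgroupM.
by rewrite (extendM s sN) // -/e E mul1g -(extendM s sN) // mulVg extend1.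
Qed.

End Induction.

Section Extensions.
Variable P : set nat.

Lemma factor_FN (X Z Y : groupType) (r : hom X Z) (s : hom X Y) :
  range r = [set: Z] -> range s = [set: Y] -> kernel r `<=` kernel s ->
  class_FN P Z -> class_FN P Y.
Proof.
move=> rT sT rs FNZ; have [t tE] := factor_hom rT rs.
apply: (class_FN_surj (f := t)) => //; apply/surjP => y.
by have [x <-] := (surjP s).1 sT y; exists (r x).
Qed.

Lemma class_ext_kernel (C : groupType -> Prop) (X Z : groupType) (r : hom X Z) :
  range r = [set: Z] -> C (subg (kernel r)) -> class_FN P Z ->
  class_ext C (class_FN P) X.
Proof.
move=> rT CN FNZ; exists (kernel r); split=> //; first exact: kernel_normal.
apply: (@factor_FN _ _ _ r (quo_pi (kernel r)) rT) => //; first exact: quo_pi_surj.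
by rewrite quo_pi_kernel; apply: sub_normal_closure.
Qed.

Lemma class_ext_FN (C : groupType -> Prop) (X : groupType) :
  (forall Y : groupType, (forall y : Y, y = 1) -> C Y) -> class_FN P X ->
  class_ext C (class_FN P) X.
Proof.
move=> C1 FNX; apply: (@class_ext_kernel C _ _ (idfun : hom X X)) => //.
  by apply/surjP => x; exists x.
apply: C1 => y; apply: val_inj; rewrite val1.
exact: (subg_val y (proj1 (kernel_normal (idfun : hom X X)))).
Qed.

Lemma class_free_triv (X : groupType) : (forall x : X, x = 1) -> class_free X.
Proof.
move=> X1; exists set0 => Y f; exists (one_fun Y : hom X Y) => // g _ x.
by rewrite (X1 x) !gmulf1.
Qed.

Variables X Y : groupType.

Lemma free_prod_class_ext : class_FN P X -> class_FN P Y ->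
  class_ext class_free (class_FN P) (free_prod X Y).
Proof.
move=> FNX FNY; apply: (class_ext_kernel (free_prod_proj_surj X Y)).
  exact: free_prod_kernel_free.
exact: class_FN_prod.
Qed.

Lemma free_prod_residual_hom p (z : free_prod X Y) : prime p ->
  finite_group X -> finite_group Y -> free_prod_proj X Y z = 1 -> z <> 1 ->
  exists (E : groupType) (sigma : hom (free_prod X Y) E),
  [/\ range sigma = [set: E], finite_group E,
      exists k, forall n, kernel (free_prod_proj X Y) n -> sigma n ^+ (p ^ k) = 1
    & sigma z <> 1].
Proof.
move=> pp fX fY phz z1; pose phi := free_prod_proj X Y.
have [|Z [s [FZ sz]]] := free_residually_F pp (@free_prod_kernel_free X Y) (x := insubg phz).
  by move=> /(congr1 val); rewrite val1.
have fQ : finite_group (X * Y)%type by apply: finite_prod.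
have [E [sigma [sT fE kE ne]]] := induced_hom pp (free_prod_proj_surj X Y) fQ s FZ.
exists E, sigma; split=> //; apply: ne => //.
by rewrite (extend_in s (proj1 (kernel_normal _)) phz).
Qed.

Lemma free_prod_residually_F q (z : free_prod X Y) :
  prime q -> class_F q X -> class_F q Y -> z <> 1 ->
  exists (E : groupType) (sigma : hom (free_prod X Y) E),
    [/\ class_F q E, range sigma = [set: E] & sigma z <> 1].
Proof.
move=> qp FX FY z1; have FXY := class_F_prod qp FX FY.
have [zk|zk] := pselect (free_prod_proj X Y z = 1); last first.
  by exists (X * Y)%type, (free_prod_proj X Y); split=> //; apply: free_prod_proj_surj.
have [E [sigma [sT fE [k kE] sz]]] := free_prod_residual_hom qp (proj1 FX) (proj1 FY) zk z1.
exists E, sigma; split=> //; apply: class_F_intro => // y.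
have [x <-] := (surjP sigma).1 sT y; have [l XYl] := class_F_exponent qp FXY.
exists (l + k)%N; rewrite expnD expgnA -gmulfXn; apply: kE.
by rewrite /kernel /preimage /mkset gmulfXn.
Qed.

Lemma free_prod_residually_F_FN p (z : free_prod X Y) :
  prime p -> class_FN P X -> class_FN P Y -> z <> 1 ->
  exists (E : groupType) (sigma : hom (free_prod X Y) E),
    [/\ class_ext (class_F p) (class_FN P) E, range sigma = [set: E] & sigma z <> 1].
Proof.
move=> pp FNX FNY z1; have FNXY := class_FN_prod FNX FNY.
have phT := free_prod_proj_surj X Y.
have [zk|zk] := pselect (free_prod_proj X Y z = 1); last first.
  exists (X * Y)%type, (free_prod_proj X Y); split=> //.
  by apply: class_ext_FN => //; apply: class_F_triv.
have [fX _ _] := FNX; have [fY _ _] := FNY.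
have [E [sigma [sT fE [k kE] sz]]] := free_prod_residual_hom pp fX fY zk z1.
exists E, sigma; split=> //; pose N := sigma @` kernel (free_prod_proj X Y).
have nN : normal N by apply: image_normal => //; apply: kernel_normal.
exists N; split=> //.
  apply: class_F_intro => // [|y].
    by apply: (@finite_inj _ _ (subg_incl N)) => //; apply: val_inj.
  have [n Nn ny] := subg_val y (proj1 nN); exists k; apply: val_inj.
  by rewrite val1 -subg_inclE gmulfXn subg_inclE -ny kE.
apply: (@factor_FN _ _ _ (free_prod_proj X Y) (quo_pi N \o sigma)) => //.
  exact: range_comp sT (quo_pi_surj N).
by move=> x xk; apply/(quo_eq1n _ nN); exists x.
Qed.

End Extensions.

(** * The quotient of an amalgam by the amalgamated subgroup *)

Section FreeProdMap.
Variables (X Y X' Y' : groupType) (s : hom X X') (t : hom Y Y').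

Fact free_prod_map_compat (h : void) :
  (gfp_in1 (of_void X') (of_void Y') \o s) (of_void X h) =
  (gfp_in2 (of_void X') (of_void Y') \o t) (of_void Y h).
Proof. by case: h. Qed.

Definition free_prod_map : hom (free_prod X Y) (free_prod X' Y') :=
  @gfp_hom _ _ _ _ _ _ (gfp_in1 (of_void X') (of_void Y') \o s)
    (gfp_in2 (of_void X') (of_void Y') \o t) free_prod_map_compat.

Definition letter_map (u : X + Y) : X' + Y' :=
  match u with inl x => inl (s x) | inr y => inr (t y) end.

Lemma free_prod_map_surj : range s = [set: X'] -> range t = [set: Y'] ->
  range free_prod_map = [set: free_prod X' Y'].
Proof.
move=> /surjP sT /surjP tT; apply/surjP; apply: gfp_ind => [|x z [g gz]|y z [g gz]].
- by exists 1; rewrite gmulf1.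
- have [a ax] := sT x; exists (gfp_in1 (of_void X) (of_void Y) a * g).
  by rewrite gmulfM gz gfp_hom1 /= ax.
have [b bY] := tT y; exists (gfp_in2 (of_void X) (of_void Y) b * g).
by rewrite gmulfM gz gfp_hom2 /= bY.
Qed.

Lemma free_prod_map_wprod w : free_prod_map (wprod w) = wprod (map letter_map w).
Proof.
elim: w => [|u w IHw]; first exact: gmulf1.
rewrite wprod_cons gmulfM IHw [RHS]/= [RHS]wprod_cons; congr (_ * _).
by case: u => x; [apply: gfp_hom1|apply: gfp_hom2].
Qed.

Lemma free_prod_map_neq1 w : reduced w -> w != [::] ->
  (forall u, u \in w -> ~~ ltriv (letter_map u)) -> free_prod_map (wprod w) <> 1.
Proof.
move=> rw w0 wt; rewrite free_prod_map_wprod -(wprod_nil X' Y') => /reduced_form_inj E.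
have /E : reduced (map letter_map w).
  move: rw; rewrite /reduced sorted_map => /andP [sw _]; apply/andP; split.
    by apply: sub_sorted sw => -[x|y] [x'|y'].
  by rewrite all_map; apply/allP.
by case: (w) w0 => // u v _ /(_ isT).
Qed.

End FreeProdMap.

Section ModuloAmalgam.
Variables (H A B : groupType) (i : hom H A) (j : hom H B).
Hypotheses (iI : injective i) (jI : injective j).
Hypotheses (nA : normal (range i)) (nB : normal (range j)).
Let QA : groupType := quotient (range i).
Let QB : groupType := quotient (range j).

Fact mod_compat h : (gfp_in1 (of_void QA) (of_void QB) \o quo_pi (range i)) (i h) =
  (gfp_in2 (of_void QA) (of_void QB) \o quo_pi (range j)) (j h).
Proof.
rewrite /= (_ : quo_pi _ (i h) = 1); last by apply/(quo_eq1n _ nA); exists h.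
rewrite (_ : quo_pi _ (j h) = 1) ?gmulf1 //; by apply/(quo_eq1n _ nB); exists h.
Qed.

Definition mod_amalgam : hom (gfp i j) (free_prod QA QB) :=
  @gfp_hom _ _ _ _ _ _ (gfp_in1 (of_void QA) (of_void QB) \o quo_pi (range i))
    (gfp_in2 (of_void QA) (of_void QB) \o quo_pi (range j)) mod_compat.

Lemma mod_amalgam1 a : mod_amalgam (gfp_in1 i j a) = wprod [:: inl (quo_pi (range i) a)].
Proof. exact: gfp_hom1. Qed.

Lemma mod_amalgam2 b : mod_amalgam (gfp_in2 i j b) = wprod [:: inr (quo_pi (range j) b)].
Proof. exact: gfp_hom2. Qed.

Lemma mod_amalgam_surj : range mod_amalgam = [set: free_prod QA QB].
Proof.
apply/surjP; apply: gfp_ind => [|x z [g gz]|y z [g gz]].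
- by exists 1; rewrite gmulf1.
- have [a ax] := quo_surj x; exists (gfp_in1 i j a * g).
  by rewrite gmulfM gz mod_amalgam1 ax.
have [b bY] := quo_surj y; exists (gfp_in2 i j b * g).
by rewrite gmulfM gz mod_amalgam2 bY.
Qed.

Lemma mod_amalgam_eq1 g : mod_amalgam g = 1 <-> gfp_amalgamated i j g.
Proof.
split=> [E|[_ [h _ <-] <-]]; last first.
  rewrite mod_amalgam1 (_ : quo_pi _ (i h) = 1) ?wprod_ltriv //=.
  by apply/(quo_eq1n _ nA); exists h.
have nN := amalgamated_normal iI jI nA nB; set N := gfp_amalgamated i j in nN *.
pose pN : hom (gfp i j) (quotient N) := quo_pi N.
have inN h : N (gfp_in1 i j (i h)) by exists (i h) => //; exists h.
have [|a aE] := @quo_factor _ _ (range i) (pN \o gfp_in1 i j).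
  by move=> _ [h _ <-]; apply/(quo_eq1n _ nN)/inN.
have [|b bE] := @quo_factor _ _ (range j) (pN \o gfp_in2 i j).
  by move=> _ [h _ <-]; apply/(quo_eq1n _ nN); have := inN h; rewrite gfp_in_amalgam.
have ab (h : void) : a (of_void QA h) = b (of_void QB h) by case: h.
(* The projection G -> G/H factors through the free product, so the kernel of [mod_amalgam] is no
   larger than [H]. *)
have back z : gfp_hom ab (mod_amalgam z) = pN z.
  pattern z; apply: gfp_ind => {z} [|x z IH|y z IH]; first by rewrite !gmulf1.
    by rewrite !gmulfM IH mod_amalgam1 gfp_hom1 aE.
  by rewrite !gmulfM IH mod_amalgam2 gfp_hom2 bE.
by apply/(quo_eq1n _ nN); rewrite -[LHS]/(pN g) -back E gmulf1.
Qed.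

Section SeparableAmalgam.
Variable C : groupType -> Prop.
Hypothesis C_prod : forall X Y : groupType, C X -> C Y -> C (X * Y)%type.
Hypothesis C_triv : forall X : groupType, (forall x : X, x = 1) -> C X.
Hypothesis C_surj : forall (X Y : groupType) (f : hom X Y),
  range f = [set: Y] -> C X -> C Y.
Hypothesis C_inj : forall (X Y : groupType) (f : hom X Y), injective f -> C Y -> C X.

(** A homomorphism witnessing separability may be nontrivial on [N]. Factoring out the image of [N]
    makes it descend to X/N, and separability says exactly that the given element stays
    nontrivial. *)
Lemma separable_quotient (X : groupType) (N : set X) (l : seq (quotient N)) :
  normal N -> separable C N -> (forall x, x \in l -> x != 1) ->
  exists (Z : groupType) (s : hom (quotient N) Z),
    [/\ C Z, range s = [set: Z] & forall x, x \in l -> s x <> 1].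
Proof.
move=> nN sepN l1.
have [|Z [s [CZ _ sl]]] := combine_homs C_prod C_triv (N := set0) (l := l); last first.
  exists (subg (range s)), (corestr s); split.
  - by apply: (C_inj (f := subg_incl (range s))) => //; apply: val_inj.
  - exact: corestr_surj.
  by move=> x xl /corestr_eq1; apply: sl.
move=> x xl; have [u ux] := quo_surj x; subst x.
have [|Z [s [CZ sT su]]] := sepN u.
  by move=> Nu; move: (l1 _ xl); rewrite (quo_eq1n _ nN).2 ?eqxx.
have nsN : normal (s @` N) by apply: image_normal.
have [|t tE] := @quo_factor _ _ N (quo_pi (s @` N) \o s).
  by move=> v Nv; apply/(quo_eq1n _ nsN); exists v.
exists (quotient (s @` N)), t; split=> //.
  by apply: C_surj CZ; apply: quo_pi_surj.
by rewrite tE => /(quo_eq1n _ nsN).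
Qed.

(** Only the finitely many letters of the reduced word of g have to stay nontrivial; then its image
    is again a nonempty reduced word. *)
Lemma outside_amalgam g :
  separable C (range i) -> separable C (range j) -> ~ gfp_amalgamated i j g ->
  exists (X Y : groupType) (s : hom (gfp i j) (free_prod X Y)),
    [/\ C X, C Y, range s = [set: free_prod X Y] & s g <> 1].
Proof.
move=> sepA sepB gN; have [w rw gw] := reduced_form (mod_amalgam g).
have w0 : w != [::] by apply/eqP => w0; apply/gN/mod_amalgam_eq1; rewrite gw w0.
have wt u : u \in w -> ~~ ltriv u by move=> uw; have /andP [_ /allP] := rw; apply.
pose lA := pmap (fun u : QA + QB => if u is inl x then Some x else None) w.
pose lB := pmap (fun u : QA + QB => if u is inr y then Some y else None) w.
have [|X [s [CX sT sl]]] := separable_quotient (l := lA) nA sepA.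
  by move=> x; rewrite mem_pmap => /mapP [[x'|//] /wt /= x1 [->]].
have [|Y [t [CY tT tl]]] := separable_quotient (l := lB) nB sepB.
  by move=> y; rewrite mem_pmap => /mapP [[//|y'] /wt /= y1 [->]].
exists X, Y, (free_prod_map s t \o mod_amalgam); split=> //.
  exact: range_comp mod_amalgam_surj (free_prod_map_surj sT tT).
rewrite /= gw.
apply: free_prod_map_neq1 => // -[x|y] uw /=; apply/eqP.
  by apply: sl; rewrite mem_pmap; apply/mapP; exists (inl x).
by apply: tl; rewrite mem_pmap; apply/mapP; exists (inr y).
Qed.

End SeparableAmalgam.
End ModuloAmalgam.

(** * Closure of the amalgamated subgroup *)

Lemma subgroup_root (X : groupType) (S : set X) (x : X) n r : subgroup S ->
  (0 < r)%N -> coprime r n -> x ^+ n = 1 -> S (x ^+ r) -> S x.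
Proof.
move=> sS r0 /(coprimeP _ r0) [[u v] /= E] xn Sx.
have : S (x ^+ r ^+ u) by apply: subgroupX.
have /ltnW vu : (v * n < u * r)%N by rewrite -subn_gt0 E.
rewrite -expgnA mulnC -(subnK vu) E expgnDr expg1 mulnC expgnA xn expg1n.
by rewrite mulg1.
Qed.

Lemma residually_F_of_FN (P : set nat) (X : groupType) :
  residually (class_FN P) X ->
  residually (fun Z => exists p, [/\ P p, prime p & class_F p Z]) X.
Proof.
move=> rX x /rX [Y [s [FNY _ sx]]].
have [p [pp Pp [Z [t [FZ tsx]]]]] := class_FN_residual_F FNY sx.
exists (subg (range (t \o s))), (corestr (t \o s)); split.
- by exists p; split=> //; apply: class_F_range.
- exact: corestr_surj.
by move=> /corestr_eq1.
Qed.

Section Closure.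
Variables (H A B : groupType) (i : hom H A) (j : hom H B).
Hypotheses (iI : injective i) (jI : injective j).
Hypotheses (nA : normal (range i)) (nB : normal (range j)).
Let G : groupType := gfp i j.
Let NG : set G := gfp_amalgamated i j.
Let nNG : normal NG := amalgamated_normal iI jI nA nB.
Let red := mod_amalgam nA nB.
Let red1 g : red g = 1 <-> NG g := mod_amalgam_eq1 iI jI nA nB g.

Lemma amalgamated1 a : NG (gfp_in1 i j a) <-> range i a.
Proof.
split=> [/red1|[h _ <-]]; last by exists (i h) => //; exists h.
rewrite /red mod_amalgam1 -(wprod_nil (quotient (range i)) (quotient (range j))).
have [/(quo_eq1n _ nA) //|/eqP a1] := pselect (quo_pi (range i) a = 1).
by move=> /reduced_form_inj; rewrite reduced1 /= a1 => /(_ isT isT).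
Qed.

Lemma amalgamated2 b : NG (gfp_in2 i j b) <-> range j b.
Proof.
split=> [/red1|[h _ <-]]; last by exists (i h); [exists h|apply: gfp_in_amalgam].
rewrite /red mod_amalgam2 -(wprod_nil (quotient (range i)) (quotient (range j))).
have [/(quo_eq1n _ nB) //|/eqP b1] := pselect (quo_pi (range j) b = 1).
by move=> /reduced_form_inj; rewrite reduced1 /= b1 => /(_ isT isT).
Qed.

Variable C : groupType -> Prop.

Definition amalgam_closure : set G := [set g | forall (Z : groupType) (s : hom G Z),
  C Z -> range s = [set: Z] -> (s @` NG) (s g)].
Let D := amalgam_closure.

Lemma amalgam_closureJ g x : D g -> D (g ^ x).
Proof.
move=> Dg Z s CZ sT; have [_ nJ] := image_normal sT nNG.
by rewrite gmulfJ; apply: nJ; apply: Dg.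
Qed.

Lemma amalgam_closureR g x : D g -> D [~ g, x].
Proof.
move=> Dg Z s CZ sT; have nsN := image_normal sT nNG.
by rewrite gmulfR; apply: normalR nsN (Dg _ _ CZ sT).
Qed.

Lemma amalgam_closure_root x r : prime r -> NG (x ^+ r) ->
  (forall (Z : groupType) (s : hom G Z), C Z -> exists2 n, coprime r n & s x ^+ n = 1) ->
  D x.
Proof.
move=> rp Nx Cn Z s CZ sT; have [n rn xn] := Cn Z s CZ.
apply: (subgroup_root _ (prime_gt0 rp) rn xn); first by case: (image_normal sT nNG).
by rewrite -gmulfXn; exists (x ^+ r).
Qed.

Hypothesis resC : residually C G.
Hypothesis nilH : nilpotent_group H.

(* Iterated commutators of elements of the closure have images in the images of
   the upper central terms of H, so they become trivial; z is the last one outside. *)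
Lemma closure_center x : D x -> ~ NG x ->
  exists z, [/\ D z, ~ NG z & forall d, D d -> NG [~ z, d]].
Proof.
have [c Hc] := (nilpotentP H).1 nilH.
suff IH k z : (forall (Z : groupType) (s : hom G Z), C Z -> range s = [set: Z] ->
    exists2 h, upper_central H k h & s z = s (gfp_in1 i j (i h))) ->
    D z -> ~ NG z -> exists z, [/\ D z, ~ NG z & forall d, D d -> NG [~ z, d]].
  move=> Dx; apply: (IH c) => // Z s CZ sT.
  by have [_ [_ [h _ <-] <-] E] := Dx Z s CZ sT; exists h; rewrite ?Hc.
elim: k z => [|k IHk] z zk Dz Nz.
  case: Nz; suff -> : z = 1 by case: nNG => -[].
  apply: contrapT => /resC [Z [s [CZ sT]]]; apply.
  by have [_ -> ->] := zk Z s CZ sT; rewrite !gmulf1.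
have [zC|zNC] := pselect (forall d, D d -> NG [~ z, d]); first by exists z.
have [d Dd Nzd] : exists2 d, D d & ~ NG [~ z, d].
  apply: contrapT => nd; apply: zNC => d Dd; apply: contrapT => Nzd.
  by apply: nd; exists d.
apply: (IHk [~ z, d]) => //; last exact: amalgam_closureR.
move=> Z s CZ sT; have [h Zh E] := zk Z s CZ sT.
have [_ [_ [h' _ <-] <-] E'] := Dd Z s CZ sT.
by exists [~ h, h']; [apply: Zh|rewrite !gmulfR E -E'].
Qed.

Hypotheses (iT : range i <> [set: A]) (jT : range j <> [set: B]).

Lemma proper_quotient (X : groupType) (N : set X) : normal N -> N <> [set: X] ->
  exists x : quotient N, x <> 1.
Proof.
move=> nN NT; apply: contrapT => nx; apply: NT; apply/seteqP; split=> // u _.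
apply/(quo_eq1n _ nN); apply: contrapT => u1; apply: nx.
by exists (quo_pi N u).
Qed.

Let QA : groupType := quotient (range i).
Let QB : groupType := quotient (range j).

(** The element z of [closure_center] commutes modulo [H] with the closure, hence with its own
    conjugates. The first two alternatives supply a letter commuting with it; in the last two, 1, a
    and a^2 are distinct modulo [H], so a factor has more than two elements. *)
Lemma closure_contradiction x : D x -> ~ NG x ->
  [\/ exists a, ~ range i a /\ D (gfp_in1 i j a),
      exists b, ~ range j b /\ D (gfp_in2 i j b),
      exists a, ~ range i a /\ ~ range i (a ^+ 2)
    | exists b, ~ range j b /\ ~ range j (b ^+ 2)] -> False.
Proof.
move=> Dx Nx extra; have [z [Dz Nz zC]] := closure_center Dx Nx.
have zC' d : D d -> commute (red z) (red d).
  by move=> /zC /red1; rewrite gmulfR => /eqP /commgP.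
apply: (@no_abelian_normal QA QB (red z)).
- by move=> /red1.
- exact: proper_quotient.
- exact: proper_quotient.
- move=> g; have [g' <-] := (surjP red).1 (mod_amalgam_surj nA nB) g.
  by rewrite -gmulfJ; apply/zC'/amalgam_closureJ.
have nt1 a : ~ range i a -> quo_pi (range i) a != 1.
  by move=> na; apply/eqP => /(quo_eq1n _ nA).
have nt2 b : ~ range j b -> quo_pi (range j) b != 1.
  by move=> nb; apply/eqP => /(quo_eq1n _ nB).
case: extra => [[a [na Da]]|[b [nb Db]]|[a [na na2]]|[b [nb nb2]]].
- left; exists (inl (quo_pi (range i) a)); first exact: nt1.
  by rewrite -(mod_amalgam1 nA nB); apply/commute_sym/zC'.
- left; exists (inr (quo_pi (range j) b)); first exact: nt2.
  by rewrite -(mod_amalgam2 nA nB); apply/commute_sym/zC'.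
(* The letter distinct from 1 and from x' is y if x' is not y, and y^2 otherwise. *)
- right; exists true => -[x'|//] _; pose y := quo_pi (range i) a.
  have [xy|xy] := eqVneq x' y; last first.
    exists (inl y); split=> //; first exact: nt1.
    by exists (inl (y^-1 * x')) => //=; apply: contraNN xy => /eqP /mulg1_eq; rewrite invgK => ->.
  exists (inl (y ^+ 2)); split=> //=; first by rewrite -gmulfXn; apply: nt1.
  exists (inl (y ^- 2 * x')) => //=; rewrite xy expgS invgM expg1 mulgVK invg_eq1.
  exact: nt1.
right; exists false => -[//|x'] _; pose y := quo_pi (range j) b.
have [xy|xy] := eqVneq x' y; last first.
  exists (inr y); split=> //; first exact: nt2.
  by exists (inr (y^-1 * x')) => //=; apply: contraNN xy => /eqP /mulg1_eq; rewrite invgK => ->.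
exists (inr (y ^+ 2)); split=> //=; first by rewrite -gmulfXn; apply: nt2.
exists (inr (y ^- 2 * x')) => //=; rewrite xy expgS invgM expg1 mulgVK invg_eq1.
exact: nt2.
Qed.

End Closure.

Section LettersCommute.
Variables X Y : groupType.
Implicit Types s t u : (X + Y)%type.

Lemma letters_not_commute s t : ~~ ltriv s -> ~~ ltriv t -> lside s != lside t ->
  ~ commute (wprod [:: s]) (wprod [:: t]).
Proof.
move=> s1 t1 st; rewrite /commute -!wprod_cons => /reduced_form_inj.
rewrite !reduced_cons s1 t1 (eq_sym (lside t)) st => /(_ isT isT) [E _].
by rewrite E eqxx in st.
Qed.

Lemma letter_conj_not_commute s t u : ~~ ltriv s -> ~~ ltriv t -> ~~ ltriv u ->
  lside s = lside t -> lside s != lside u ->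
  ~ commute (wprod [:: s]) (wprod [:: t] ^ wprod [:: u]).
Proof.
move=> s1 t1 u1 st su.
have -> : wprod [:: t] ^ wprod [:: u] = wprod [:: letter_inv u; t; u].
  by rewrite conjgE -wprod1 (wprod_cons (letter_inv u) [:: t; u]) (wprod_cons t [:: u]).
rewrite /commute -wprod_cons -wprod_cat => /reduced_form_inj.
have us : lside u != lside s by rewrite eq_sym.
rewrite !reduced_cons ltriv_inv !lside_inv s1 t1 u1 /= -st su us.
move=> /(_ isT isT) [E _ _ _].
by rewrite E lside_inv eqxx in su.
Qed.

End LettersCommute.

(** * Roots of elements of the amalgamated subgroup *)

Section Isolation.
Variables (H A B : groupType) (i : hom H A) (j : hom H B) (P : set nat).
Hypotheses (iI : injective i) (jI : injective j).
Hypotheses (nA : normal (range i)) (nB : normal (range j)).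
Hypotheses (iT : range i <> [set: A]) (jT : range j <> [set: B]).
Hypotheses (Pp : P `<=` [set p | prime p]) (P0 : P !=set0) (nilH : nilpotent_group H).
Let G : groupType := gfp i j.
Let NG : set G := gfp_amalgamated i j.
Let nNG : normal NG := amalgamated_normal iI jI nA nB.

Definition amalgam_root r (x : G) : Prop :=
  [/\ prime r, NG (x ^+ r) &
    (exists2 a, x = gfp_in1 i j a & ~ range i a) \/
    (exists2 b, x = gfp_in2 i j b & ~ range j b)].

Lemma amalgam_root_notin r x : amalgam_root r x -> ~ NG x.
Proof.
by case=> _ _ [[a -> na]|[b -> nb]] => [/(amalgamated1 iI jI nA nB)|/(amalgamated2 iI jI nA nB)].
Qed.

Lemma not_isolated_root q : ~ (isolated q (range i) /\ isolated q (range j)) ->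
  exists r x, r != q /\ amalgam_root r x.
Proof.
have iso (X : groupType) (f : hom H X) : ~ isolated q (range f) ->
    exists r x, [/\ prime r, r != q, range f (x ^+ r) & ~ range f x].
  move=> ni; apply: contrapT => no; apply: ni; split; first exact: range_subgroup.
  move=> r rp rq x fx; apply: contrapT => nx; apply: no.
  by exists r, x.
move=> /not_andP [/iso [r [a [rp rq ar na]]]|/iso [r [b [rp rq br nb]]]].
  exists r, (gfp_in1 i j a); split=> //; split=> //; last by left; exists a.
  by rewrite -gmulfXn; apply/(amalgamated1 iI jI nA nB).
exists r, (gfp_in2 i j b); split=> //; split=> //; last by right; exists b.
by rewrite -gmulfXn; apply/(amalgamated2 iI jI nA nB).
Qed.

Lemma amalgam_root_image r x p (Z : groupType) (s : hom G Z) :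
  amalgam_root r x -> prime p -> p != r -> class_F p Z -> range s = [set: Z] ->
  (s @` NG) (s x).
Proof.
move=> [rp Nx _] pp pr FZ sT; have [k Zk] := class_F_exponent pp FZ.
apply: (@subgroup_root _ _ _ (p ^ k) r).
- by case: (image_normal sT nNG).
- exact: prime_gt0.
- by rewrite coprimeXr // prime_coprime // dvdn_prime2 // eq_sym.
- exact: Zk.
by rewrite -gmulfXn; exists (x ^+ r).
Qed.

Let C (Z : groupType) := exists p, [/\ P p, prime p & class_F p Z].
Let D := @amalgam_closure H A B i j C.

(** A prime p differs from r1 or from r2, so in a finite p-group one of x1, x2 falls into the image
    of [H]; as this image is normal, it absorbs the commutator. *)
Lemma two_roots_closure r1 x1 r2 x2 g : r1 != r2 -> amalgam_root r1 x1 -> amalgam_root r2 x2 ->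
  D [~ x1, x2 ^ g].
Proof.
move=> r12 R1 R2 Z s [p [_ pp FZ]] sT; have nsN := image_normal sT nNG.
have [pr1|pr1] := eqVneq p r1.
  have pr2 : p != r2 by rewrite pr1.
  rewrite gmulfR gmulfJ; apply: (normalRr _ nsN); apply: (proj2 nsN).
  exact: amalgam_root_image R2 pp pr2 FZ sT.
by rewrite gmulfR; apply: normalR nsN (amalgam_root_image R1 pp pr1 FZ sT).
Qed.

Lemma proper_ex (X : groupType) (S : set X) : S <> [set: X] -> exists x, ~ S x.
Proof.
move=> ST; apply: contrapT => no; apply: ST; apply/seteqP; split=> // x _.
by apply: contrapT => nx; apply: no; exists x.
Qed.

(** Letters on different sides do not commute, and two letters on the same side cease to commute
    when one is conjugated by a letter of the other side. *)
Lemma two_roots_conj r1 x1 r2 x2 : amalgam_root r1 x1 -> amalgam_root r2 x2 ->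
  exists g, ~ NG [~ x1, x2 ^ g].
Proof.
have red1 := mod_amalgam_eq1 iI jI nA nB; pose red := mod_amalgam nA nB.
have nt1 a : ~ range i a -> quo_pi (range i) a != 1.
  by move=> na; apply/eqP => /(quo_eq1n _ nA).
have nt2 b : ~ range j b -> quo_pi (range j) b != 1.
  by move=> nb; apply/eqP => /(quo_eq1n _ nB).
have [a0 /nt1 na0] := proper_ex iT; have [b0 /nt2 nb0] := proper_ex jT.
have nc x y g : ~ commute (red x) (red y ^ red g) -> ~ NG [~ x, y ^ g].
  by move=> nc /red1; rewrite -/red gmulfR gmulfJ => /eqP /commgP.
move=> [_ _ [[a1 -> /nt1 na1]|[b1 -> /nt2 nb1]]] [_ _ [[a2 -> /nt1 na2]|[b2 -> /nt2 nb2]]].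
- exists (gfp_in2 i j b0); apply: nc; rewrite /red !mod_amalgam1 mod_amalgam2.
  exact: letter_conj_not_commute.
- exists 1; apply: nc; rewrite /red mod_amalgam1 mod_amalgam2 gmulf1 conjg1.
  exact: letters_not_commute.
- exists 1; apply: nc; rewrite /red mod_amalgam1 mod_amalgam2 gmulf1 conjg1.
  exact: letters_not_commute.
exists (gfp_in1 i j a0); apply: nc; rewrite /red !mod_amalgam2 mod_amalgam1.
exact: letter_conj_not_commute.
Qed.

Lemma odd_root (X : groupType) (S : set X) (x : X) r : subgroup S -> prime r -> r != 2 ->
  S (x ^+ r) -> ~ S x -> ~ S (x ^+ 2).
Proof.
move=> sS rp r2 Sr nx S2; apply: nx.
have -> : x = x ^+ r / (x ^+ 2 ^+ r./2).
  have odd_r : odd r by case: (even_prime rp) r2 => // ->.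
  by rewrite -expgnA mul2n -{1}(odd_double_half r) odd_r expgnDr mulgK.
by apply: subgroupF => //; apply: subgroupX.
Qed.

Lemma isolated_ex : residually (class_FN P) G ->
  exists q, [/\ P q, isolated q (range i) & isolated q (range j)].
Proof.
move=> /residually_F_of_FN resC; apply: contrapT => noq.
have rootq q : P q -> exists r x, r != q /\ amalgam_root r x.
  by move=> Pq; apply: not_isolated_root => -[iq jq]; apply: noq; exists q.
have [q0 Pq0] := P0; have [r1 [x1 [_ R1]]] := rootq _ Pq0.
have contra := @closure_contradiction _ _ _ _ _ iI jI nA nB C resC nilH iT jT.
have N1 := amalgam_root_notin R1.
have [Pr1|nPr1] := pselect (P r1); last first.
  have Dx : D x1.
    move=> Z s [p [Pp' pp FZ]] sT; apply: (amalgam_root_image R1 pp) => //.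
    by apply/eqP => E; rewrite E in Pp'.
  apply: (contra _ Dx N1); case: R1 Dx => _ _ [[a -> na]|[b -> nb]] Dx.
    by apply: Or41; exists a.
  by apply: Or42; exists b.
(* As r1 lies in [P], the assumed failure for q = r1 supplies a root for a second prime. *)
have [r2 [x2 [r21 R2]]] := rootq _ Pr1; have r12 : r1 != r2 by rewrite eq_sym.
have [g Ng] := two_roots_conj R1 R2.
apply: (contra _ (two_roots_closure g r12 R1 R2) Ng).
have big r x : r != 2 -> amalgam_root r x ->
    (exists a, ~ range i a /\ ~ range i (a ^+ 2)) \/ (exists b, ~ range j b /\ ~ range j (b ^+ 2)).
  move=> r2' [rp Nx [[a xa na]|[b xb nb]]]; [left; exists a|right; exists b]; split=> //;
    apply: (odd_root (r := r)) => //; try exact: range_subgroup.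
    by move: Nx; rewrite xa -gmulfXn => /(amalgamated1 iI jI nA nB).
  by move: Nx; rewrite xb -gmulfXn => /(amalgamated2 iI jI nA nB).
have [|] : (exists a, ~ range i a /\ ~ range i (a ^+ 2)) \/
    (exists b, ~ range j b /\ ~ range j (b ^+ 2)).
  have [r12'|r12'] := eqVneq r1 2; last exact: big R1.
  by apply: (big r2 x2) => //; rewrite -r12'.
by move=> ?; apply: Or43.
by move=> ?; apply: Or44.
Qed.

Lemma root_contradiction p r x : prime p -> p != r -> ~ P r -> amalgam_root r x ->
  residually (class_ext (class_F p) (class_FN P)) G -> False.
Proof.
move=> pp pr nPr R res; have [rp Nx side] := R.
have Dx : amalgam_closure (class_ext (class_F p) (class_FN P)) x.
  (* The image of x has an exponent m p^k with m a product of primes of [P]; it is coprime to r,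
     which differs from p and is not in [P]. *)
  apply: (amalgam_closure_root iI jI nA nB rp Nx) => Z s [N [nN FN [_ _ /prime_groupP QP]]].
  have [m mP sm] := QP (quo_pi N (s x)).
  have Nsm : N (s x ^+ m) by apply/(quo_eq1n _ nN); rewrite gmulfXn.
  have [k Nk] := class_F_exponent pp FN; exists (m * p ^ k)%N.
    rewrite coprimeMr coprimeXr ?andbT.
      by rewrite coprime_sym (pnumber_coprime rp nPr mP).
    by rewrite prime_coprime // dvdn_prime2 // eq_sym.
  rewrite expgnA; have /(congr1 val) := Nk (insubg Nsm).
  by rewrite val1 -subg_inclE gmulfXn.
apply: (closure_contradiction iI jI nA nB res nilH iT jT Dx (amalgam_root_notin R)).
case: side Dx => [[a -> na]|[b -> nb]] Dx; first by apply: Or41; exists a.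
by apply: Or42; exists b.
Qed.

End Isolation.

(** * Separability and isolation *)

Lemma prime_root (X : groupType) (S : set X) (x : X) n : (0 < n)%N ->
  S (x ^+ n) -> ~ S x ->
  exists r y, [/\ prime r, r %| n, S (y ^+ r) & ~ S y].
Proof.
elim/ltn_ind: n => n IH n0 Sn nx.
have n1 : (1 < n)%N.
  by rewrite ltn_neqAle n0 andbT; apply: contra_notN nx => /eqP E; rewrite -E in Sn.
have pn := pdiv_prime n1; have dn := pdiv_dvd n.
have [Sm|nSm] := pselect (S (x ^+ (n %/ pdiv n))); last first.
  by exists (pdiv n), (x ^+ (n %/ pdiv n)); split=> //; rewrite -expgnA divnK.
have [||r [y [rp rn Sy ny]]] := IH _ _ _ Sm nx.
- by rewrite ltn_Pdiv // prime_gt1.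
- by rewrite divn_gt0 ?prime_gt0 // dvdn_leq.
by exists r, y; split=> //; apply: dvdn_trans rn (dvdn_div dn).
Qed.

Section NonSeparable.
Variables (H A L : groupType) (i : hom H A) (lam : hom A L) (P : set nat).
Hypotheses (iI : injective i) (nH : normal (range i)).
Hypothesis BNlam : class_BN P (subg (range lam)).
Hypothesis lamI : kernel lam `&` range i = [set 1].
Hypotheses (Pp : P `<=` [set p | prime p]) (P0 : P !=set0).
Hypothesis resA : residually (class_FN P) A.

Definition not_separated (a : A) : Prop :=
  forall (Z : groupType) (s : hom A Z), class_FN P Z -> (s @` range i) (s a).

(** Take a finite p-quotient Z in which k survives, with K_m(Z) = 1, and a p-quotient Z' whose
    kernel contains that of [lam] and meets [H] in K_m. In Z x Z' the image of k equals that of some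
    h; the second coordinate puts h into K_m, so h and therefore k die in Z. *)
Lemma not_separated_kernel k : kernel lam k -> not_separated k -> k = 1.
Proof.
move=> lk nk; apply: contrapT => k1; have [Y [s [FNY _ sk]]] := resA k1.
have [p [pp Pp' [Z [t [FZ tsk]]]]] := class_FN_residual_F FNY sk.
have [m Zm] := class_F_lower_pcentral pp FZ.
have [Z' [s' [FZ' _ ls' s'K]]] := finite_p_quotient iI nH BNlam lamI m pp Pp'.
have FNZ := class_F_FN pp Pp' (class_F_prod pp FZ FZ').
have [_ [h _ <-] []] := nk _ (pair_hom (t \o s) s') FNZ.
rewrite /= (ls' _ lk) => E /s'K Kh; apply: tsk; rewrite -E.
exact: (Zm _ (lower_pcentral_hom (t \o s \o i) Kh)).
Qed.

(** In the quotient of the image of [lam] by that of [H], an element that is not separated has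
    finite order n prime to [P]. So a^n equals some h of [H] up to an element of the kernel of
    [lam], which is again not separated and hence trivial; thus a^n lies in [H]. *)
Lemma not_separable_root : ~ separable (class_FN P) (range i) ->
  exists r a, [/\ prime r, ~ P r, range i (a ^+ r) & ~ range i a].
Proof.
move=> nsep.
have [a na nsa] : exists2 a, ~ range i a & not_separated a.
  apply: contrapT => no; apply: nsep => a na; apply: contrapT => ns; apply: no.
  exists a => // Z s FNZ; apply: contrapT => nsa; apply: ns.
  exists (subg (range s)), (corestr s); split.
  - by apply: (class_FN_inj (f := subg_incl (range s))) => //; apply: val_inj.
  - exact: corestr_surj.
  by move=> [u iu /(congr1 val) E]; apply: nsa; exists u.
pose X := subg (range lam); pose l : hom A X := corestr lam.
have lT : range l = [set: X] by apply: corestr_surj.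
pose N := l @` range i; have nN : normal N by apply: image_normal.
pose q : hom A (quotient N) := quo_pi N \o l.
have nY : nilpotent_group (quotient N).
  exact: nilpotent_surj (quo_pi_surj N) (class_BN_nilpotent BNlam).
have fY p : P p -> finite_sections p (quotient N).
  by move=> Pp'; apply: finite_sections_surj (quo_pi_surj N) (class_BN_sections Pp' BNlam).
have [[n [n0 nP] qn]|[p [pp Pp' [Z [s [FZ sq]]]]]] :=
    nilpotent_residual_F (q a) Pp P0 nY fY; last first.
  have [_ [h _ <-] E] := nsa _ (s \o q) (class_F_FN pp Pp' FZ).
  case: sq; rewrite -[LHS]E /= (_ : quo_pi N _ = 1) ?gmulf1 //.
  by apply/(quo_eq1n _ nN); exists (i h) => //; exists h.
have [_ [h _ <-] lh] : N (l (a ^+ n)) by apply/(quo_eq1n _ nN); rewrite -[LHS]/(q _) gmulfXn.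
pose k := (i h)^-1 * a ^+ n.
have lk : kernel lam k.
  by apply/corestr_eq1; rewrite -/l /k gmulfM gmulfV lh mulVg.
have nk : not_separated k.
  move=> Z s FNZ; have sS : subgroup (s @` range i).
    by apply: image_subgroup; apply: range_subgroup.
  rewrite gmulfM gmulfV gmulfXn; apply: subgroupM => //.
    by apply: subgroupV => //; exists (i h) => //; exists h.
  by apply: subgroupX => //; apply: nsa.
have an : range i (a ^+ n).
  have := not_separated_kernel lk nk; rewrite /k => /mulg1_eq; rewrite invgK => <-.
  by exists h.
have [r [y [rp rn ry ny]]] := prime_root n0 an na.
by exists r, y; split=> // /nP /negP.
Qed.

End NonSeparable.

(** * Assembly of the three statements *)

Section Main.
Variables (A B H : groupType) (i : hom H A) (j : hom H B).
Variables (P : set nat) (L M : groupType) (lam : hom A L) (mu : hom B M).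
Hypotheses (iI : injective i) (jI : injective j).
Hypothesis Pp : P `<=` [set p | prime p].
Hypothesis resA : residually (class_FN P) A.
Hypotheses (BNlam : class_BN P (subg (range lam))) (BNmu : class_BN P (subg (range mu))).
Hypotheses (lamI : kernel lam `&` range i = [set 1]).
Hypotheses (muI : kernel mu `&` range j = [set 1]).
Hypotheses (nA : normal (range i)) (nB : normal (range j)).
Let U p := power_derived p H.
Let V p := isolator p (set_prod (i @` U p) (kernel lam)).
Let W p := isolator p (set_prod (j @` U p) (kernel mu)).
Hypothesis autP : forall p, P p -> prime_group [set p]
  (subg (aut_in (gfp_rho i j (V p) (W p) @` gfp_amalgamated i j))).
Let G : groupType := gfp i j.

(** A finite p-quotient of [A] in which h survives fixes both the prime p and a level m with h
    outside K_m. *)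
Lemma residual_inside (g : G) : gfp_amalgamated i j g -> g <> 1 ->
  exists (Z : groupType) (s : hom G Z), [/\ class_FN P Z, range s = [set: Z] & s g <> 1].
Proof.
move=> [_ [h _ <-] <-] g1.
have ih1 : i h <> 1 by move=> E; apply: g1; rewrite E gmulf1.
have [Y [s [FNY _ sh]]] := resA ih1.
have [p [pp Pp' [Z [t [FZ tsh]]]]] := class_FN_residual_F FNY sh.
have [m Zm] := class_F_lower_pcentral pp FZ.
have [E [r [FE rT rK]]] := separating_hom iI jI nA nB BNlam BNmu lamI muI pp Pp' m (autP Pp').
exists E, r; split=> //; first exact: class_F_FN FE.
by move=> /rK Kh; apply/tsh/(Zm _ (lower_pcentral_hom (t \o s \o i) Kh)).
Qed.

Lemma residually_FN_if q : P q -> separable (class_F q) (range i) ->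
  separable (class_F q) (range j) -> residually (class_FN P) G.
Proof.
move=> Pq sepA sepB g g1; have qp := Pp Pq.
have [|gN] := pselect (gfp_amalgamated i j g); first by move=> /residual_inside; apply.
have [X [Y [s [FX FY sT sg]]]] := outside_amalgam iI jI nA nB (class_F_prod qp)
  (class_F_triv qp) (@class_F_surj q qp) (@class_F_inj q qp) sepA sepB gN.
have [E [r [FE rT rs]]] := free_prod_residually_F qp FX FY sg.
exists E, (r \o s); split=> //; first exact: class_F_FN FE.
exact: range_comp sT rT.
Qed.

(** Stated for a class [C] so as to cover free groups and finite p-groups at once; elements of [H]
    already survive in finite nilpotent groups, taken as extensions of a trivial group. *)
Lemma residually_ext_if (C : groupType -> Prop) :
  (forall X : groupType, (forall x : X, x = 1) -> C X) ->
  (forall (X Y : groupType) (z : free_prod X Y), class_FN P X -> class_FN P Y -> z <> 1 ->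
    exists (E : groupType) (r : hom (free_prod X Y) E),
      [/\ class_ext C (class_FN P) E, range r = [set: E] & r z <> 1]) ->
  separable (class_FN P) (range i) -> separable (class_FN P) (range j) ->
  residually (class_ext C (class_FN P)) G.
Proof.
move=> C1 Cfree sepA sepB g g1.
have [gN|gN] := pselect (gfp_amalgamated i j g).
  have [Z [s [FNZ sT sg]]] := residual_inside gN g1.
  by exists Z, s; split=> //; apply: class_ext_FN.
have [X [Y [s [FX FY sT sg]]]] := outside_amalgam iI jI nA nB (@class_FN_prod P)
  (@class_FN_triv P) (@class_FN_surj P) (@class_FN_inj P) sepA sepB gN.
have [E [r [FE rT rs]]] := Cfree _ _ _ FX FY sg.
exists E, (r \o s); split=> //; exact: range_comp sT rT.
Qed.

End Main.

Theorem theorem6 (A B H : groupType) (i : hom H A) (j : hom H B)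
    (P : set nat) (L M : groupType) (lam : hom A L) (mu : hom B M) :
  injective i -> injective j ->
  P `<=` [set p | prime p] ->
  condition_star i j P ->
  class_BN P (subg (range lam)) -> class_BN P (subg (range mu)) ->
  kernel lam `&` range i = [set 1] -> kernel mu `&` range j = [set 1] ->
  normal (range i) -> normal (range j) ->
  let U p := power_derived p H in
  let V p := isolator p (set_prod (i @` U p) (kernel lam)) in
  let W p := isolator p (set_prod (j @` U p) (kernel mu)) in
  (forall p, P p ->
     prime_group [set p]
       (subg (aut_in (gfp_rho i j (V p) (W p) @` gfp_amalgamated i j)))) ->
  let G := gfp i j in
  [/\ (exists q, [/\ P q, separable (class_F q) (range i)
                       & separable (class_F q) (range j)]) ->
        residually (class_FN P) G,
      residually (class_FN P) G ->
        exists q, [/\ P q, isolated q (range i) & isolated q (range j)]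
    & (residually (class_ext class_free (class_FN P)) G /\
       forall p, prime p ->
         residually (class_ext (class_F p) (class_FN P)) G)
      <->
      (separable (class_FN P) (range i) /\ separable (class_FN P) (range j))].
Proof.
move=> iI jI Pp [[iT jT] P0 [resA resB] _] BNlam BNmu lamI muI nA nB U V W autP G.
have nilH : nilpotent_group H.
  apply: (nilpotent_inj (f := corestr lam \o i)) (class_BN_nilpotent BNlam).
  apply: gmulf_inj => h /corestr_eq1; exact: kernel_meets_trivially.
have extE := residually_ext_if iI jI resA BNlam BNmu lamI muI nA nB autP.
split.
- by move=> [q [Pq sepA sepB]]; apply: residually_FN_if autP _ Pq sepA sepB.
- exact: isolated_ex.
split=> [[_ resF]|[sepA sepB]]; last first.
  split=> [|p pp]; apply: extE => //.
  - exact: class_free_triv.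
  - move=> X Y z FX FY z1; exists (free_prod X Y), (idfun : hom _ _); split=> //.
      exact: free_prod_class_ext.
    by apply/surjP => y; exists y.
  - exact: class_F_triv.
  by move=> X Y z; apply: free_prod_residually_F_FN.
have no_root r (x : gfp i j) : ~ P r -> amalgam_root r x -> False.
  move=> nPr R; have [p pp pr] : exists2 p, prime p & p != r.
    by have [->|r2] := eqVneq r 2; [exists 3|exists 2; rewrite // eq_sym].
  exact: (root_contradiction iI jI nA nB iT jT nilH pp pr nPr R (resF p pp)).
split; apply: contrapT => nsep.
  have [r [a [rp nPr ar na]]] := not_separable_root iI nA BNlam lamI Pp P0 resA nsep.
  apply: (no_root r (gfp_in1 i j a) nPr); split=> //; last by left; exists a.
  by rewrite -gmulfXn; apply/(amalgamated1 iI jI nA nB).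
have [r [b [rp nPr br nb]]] := not_separable_root jI nB BNmu muI Pp P0 resB nsep.
apply: (no_root r (gfp_in2 i j b) nPr); split=> //; last by right; exists b.
by rewrite -gmulfXn; apply/(amalgamated2 iI jI nA nB).
Qed.
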